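(* Let $m\in\mathbb{C}$ be such that $m^2$ is real, with $m\ge0$ if $m$ is real and $m=i\mu$ with $\mu>0$ otherwise. If $m^2\ge1$, the operator $H_m=L_m^{\min}$ is self-adjoint and homogeneous of degree $-2$. If $m^2<1$, the operator $L_m^{\min}$ has deficiency indices $(1,1)$ and therefore admits a one-parameter family of self-adjoint extensions. More precisely: (1) If $0<m<1$ and, for $0\le\theta<\pi$, $u_\theta(x)=x^{1/2-m}\cos\theta+x^{1/2+m}\sin\theta$, then each self-adjoint extension of $L_m^{\min}$ is of the form $H_m^\theta:=L_m^{u_\theta}$ for a unique $\theta\in[0,\pi)$. There are exactly two homogeneous strict extensions of $L_m^{\min}$, namely the self-adjoint operators $H_m=H_m^{\pi/2}$ and $H_{-m}=H_m^{0}$. (2) If $m=0$ and, for $0\le\theta<\pi$, $u_\theta(x)=x^{1/2}\ln x\,\cos\theta+x^{1/2}\sin\theta$, then each self-adjoint extension of $L_0^{\min}$ is of the form $H_0^\theta:=L_0^{u_\theta}$ for a unique $\theta\in[0,\pi)$. The operator $L_0^{\min}$ has exactly one homogeneous strict extension: the self-adjoint operator $H_0=H_0^{\pi/2}$. (3) If $m^2<0$, $m=i\mu$ with $\mu>0$ and, for $0\le\theta<\pi$, $u_\theta(x)=x^{1/2}\cos(\mu\ln x)\cos\theta+x^{1/2}\sin(\mu\ln x)\sin\theta$, then each self-adjoint extension of $L_m^{\min}$ is of the form $H_m^\theta:=L_m^{u_\theta}$ for a unique $\theta\in[0,\pi)$. The operator $L_m^{\min}$ does not have homogeneous self-adjoint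 extensions but has two homogeneous strict extensions, namely the operators $H_m$ and $H_{-m}$.
   Context: Write $L^2=L^2(0,\infty)$ (complex-valued functions). For $m\in\mathbb{C}$ let $\tilde L_m=-\partial_x^2+(m^2-\tfrac14)x^{-2}$ act on distributions on $(0,\infty)$. $L_m^{\max}$ is its restriction to $\{f\in L^2: \tilde L_mf\in L^2\}$, and $L_m^{\min}$ is the closure in $L^2$ of its restriction to $C_c^\infty(0,\infty)$. Let $\zeta_m(x)=x^{1/2+m}$ and let $\xi$ be a smooth function on $(0,\infty)$ with $\xi=1$ on $(0,1]$ and $\xi=0$ on $[2,\infty)$. For $\mathrm{Re}\,m>-1$, $H_m$ is the restriction of $L_m^{\max}$ to $\mathcal{D}(L_m^{\min})+\mathbb{C}\,\xi\zeta_m$. For $|\mathrm{Re}\,m|<1$ and a non-zero solution $u$ of $\tilde L_mu=0$, $L_m^u$ denotes the restriction of $L_m^{\max}$ to the set of $f\in\mathcal{D}(L_m^{\max})$ with $\lim_{x\to0}\big(u(x)f'(x)-u'(x)f(x)\big)=0$; its domain is $\mathcal{D}(L_m^{\min})+\mathbb{C}\,\xi u$. A strict extension of $L_m^{\min}$ is an operator $H$ with $L_m^{\min}\subsetneq H\subsetneq L_m^{\max}$. An operator $S$ is homogeneous (of degree $-2$) if $U_\tau SU_\tau^{-1}=e^{-2\tau}S$ for all $\tau\in\mathbb{R}$, where $(U_\tau f)(x)=e^{\tau/2}f(e^\tau x)$. *)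

(* Defs.v *)
From HB Require Import structures.
From mathcomp Require Import all_boot all_order all_algebra.
From mathcomp Require Export complex.
From mathcomp Require Import all_classical all_reals all_analysis.

Set Implicit Arguments.
Unset Strict Implicit.
Unset Printing Implicit Defensive.

Import Order.TTheory GRing.Theory Num.Theory.
Import numFieldNormedType.Exports.

Local Open Scope classical_set_scope.
Local Open Scope ring_scope.
Local Open Scope complex_scope.

(* A function on (0,oo) is represented by a function R -> R[i]; its values
   outside (0,oo) are never used.  Elements of L^2(0,oo) are represented by
   functions, identified through [aeq], and operators in L^2(0,oo) by graphs
   that are saturated for this identification, so that equality and inclusion of
   graphs are equality and inclusion of operators. *)

Section L2.
Variable R : realType.
Implicit Types (f g : R -> R[i]).

Definition halfline : set R := `]0, +oo[%classic.

Definition cmeasurable f :=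
  measurable_fun halfline (fun x => complex.Re (f x)) /\
  measurable_fun halfline (fun x => complex.Im (f x)).

Definition cintegral f : R[i] :=
  (\int[@lebesgue_measure R]_(x in halfline) complex.Re (f x))
  +i* (\int[@lebesgue_measure R]_(x in halfline) complex.Im (f x)).

Definition sqnorm f : \bar R :=
  (\int[@lebesgue_measure R]_(x in halfline) ((Normc.normc (f x)) ^+ 2)%:E)%E.

Definition L2 : set (R -> R[i]) :=
  [set f | cmeasurable f /\ (sqnorm f < +oo)%E].

Definition aeq f g :=
  {ae @lebesgue_measure R, forall x, halfline x -> f x = g x}.

Definition inner f g : R[i] := cintegral (fun x => (f x)^* * g x).

Definition has_dim (N : set (R -> R[i])) (n : nat) :=
  exists e : 'I_n -> R -> R[i],
    [/\ forall i, N (e i),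
        forall c : 'I_n -> R[i],
          aeq (fun x => \sum_(i < n) c i * e i x) (fun=> 0) ->
          forall i, c i = 0 &
        forall f, N f ->
          exists c : 'I_n -> R[i], aeq f (fun x => \sum_(i < n) c i * e i x)].

End L2.

Section Operators.
Variable R : realType.
Implicit Types (S T : set ((R -> R[i]) * (R -> R[i]))).

Definition dom S : set (R -> R[i]) := fst @` S.

Definition restriction S (D : set (R -> R[i])) := [set p | S p /\ D p.1].

Definition is_operator S :=
  [/\ S `<=` L2 (R:=R) `*` L2 (R:=R),
      forall f g f' g', S (f, g) -> aeq f f' -> aeq g g' ->
        L2 f' -> L2 g' -> S (f', g'),
      S (fun=> 0, fun=> 0),
      forall (c : R[i]) f g f' g', S (f, g) -> S (f', g') ->
        S (fun x => c * f x + f' x, fun x => c * g x + g' x) &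
      forall f g g', S (f, g) -> S (f, g') -> aeq g g'].

Definition densely_defined S :=
  forall f, L2 f -> forall eps : R, 0 < eps ->
    exists2 g, dom S g & (sqnorm (fun x => f x - g x)%R < eps%:E)%E.

Definition closure_op S : set ((R -> R[i]) * (R -> R[i])) :=
  [set p | [/\ L2 p.1, L2 p.2 &
    forall eps : R, 0 < eps -> exists q, [/\ S q,
      (sqnorm (fun x => p.1 x - q.1 x)%R < eps%:E)%E &
      (sqnorm (fun x => p.2 x - q.2 x)%R < eps%:E)%E]]].

Definition adjoint S : set ((R -> R[i]) * (R -> R[i])) :=
  [set p | [/\ L2 p.1, L2 p.2 &
    forall q, S q -> inner p.1 q.2 = inner p.2 q.1]].

Definition selfadjoint S :=
  [/\ is_operator S, densely_defined S & adjoint S = S].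

Definition symmetric_op S :=
  [/\ is_operator S, densely_defined S & S `<=` adjoint S].

(* the kernel of S - z *)
Definition ker_shift S (z : R[i]) : set (R -> R[i]) :=
  [set f | S (f, fun x => z * f x)].

Definition deficiency_indices S (np nm : nat) :=
  [/\ symmetric_op S, has_dim (ker_shift (adjoint S) 'i) np &
      has_dim (ker_shift (adjoint S) (- 'i)) nm].

Definition dilation (tau : R) (f : R -> R[i]) : R -> R[i] :=
  fun x => (expR (tau / 2))%:C * f (expR tau * x).

(* U_tau S U_tau^{-1}: its graph is the image of the graph of S *)
Definition conj_dilation (tau : R) S :=
  [set (dilation tau p.1, dilation tau p.2) | p in S].

Definition scale_op (c : R) S : set ((R -> R[i]) * (R -> R[i])) :=
  [set (p.1, (fun x => c%:C * p.2 x) : R -> R[i]) | p in S].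

Definition homogeneous S :=
  forall tau : R, conj_dilation tau S = scale_op (expR (- 2 * tau)) S.

End Operators.

Section Schroedinger.
Variable R : realType.
Implicit Types (f g u : R -> R[i]) (m : R[i]).

Definition cderivable f (x : R) :=
  derivable (fun y => complex.Re (f y)) x 1 /\
  derivable (fun y => complex.Im (f y)) x 1.

Definition cderive f : R -> R[i] := fun x =>
  derive1 (fun y => complex.Re (f y)) x
  +i* derive1 (fun y => complex.Im (f y)) x.

Definition smooth f :=
  forall n x, 0 < x -> cderivable (iter n cderive f) x.

Definition test_function f :=
  smooth f /\
  exists a b : R, 0 < a /\ forall x, ~ (a <= x <= b) -> f x = 0.

Definition Ldiff m f : R -> R[i] := fun x =>
  - cderive (cderive f) x + (m ^+ 2 - 4^-1) * (x%:C) ^- 2 * f x.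

(* [Ldiff m f = g] in the sense of distributions on (0,oo): the formal operator
   is its own transpose for the bilinear (not sesquilinear) pairing. *)
Definition Ldistr m f g :=
  forall phi, test_function phi ->
    cintegral (fun x => f x * Ldiff m phi x) =
    cintegral (fun x => g x * phi x).

Definition Lmax m : set ((R -> R[i]) * (R -> R[i])) :=
  [set p | [/\ L2 p.1, L2 p.2 & Ldistr m p.1 p.2]].

Definition Lmin m : set ((R -> R[i]) * (R -> R[i])) :=
  closure_op [set (phi, Ldiff m phi) | phi in test_function].

(* x ^ z for x > 0 *)
Definition cpow (x : R) (z : R[i]) : R[i] :=
  (expR (complex.Re z * ln x))%:C *
  (cos (complex.Im z * ln x) +i* sin (complex.Im z * ln x)).

Definition zeta m : R -> R[i] := fun x => cpow x (2^-1 + m).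

Definition cutoff (xi : R -> R[i]) :=
  [/\ smooth xi, forall x, 0 < x <= 1 -> xi x = 1 &
      forall x, 2 <= x -> xi x = 0].

Definition Hop (xi : R -> R[i]) m :=
  restriction (Lmax m)
    [set f | exists f0 c, dom (Lmin m) f0 /\
                          aeq f (fun x => f0 x + c * (xi x * zeta m x))].

(* An element of the domain of [Lmax m] has a unique representative f0 that is
   differentiable on (0,oo), whose derivative is f'. *)
Definition Lbc m u :=
  restriction (Lmax m)
    [set f | exists f0, [/\ aeq f f0,
       forall x, 0 < x -> cderivable f0 x &
       Normc.normc (u x * cderive f0 x - cderive u x * f0 x)
         @[x --> 0^'+] --> (0 : R)]].

Definition selfadjoint_extension m (H : set ((R -> R[i]) * (R -> R[i]))) :=
  selfadjoint H /\ Lmin m `<=` H.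

Definition strict_extension m (H : set ((R -> R[i]) * (R -> R[i]))) :=
  [/\ is_operator H, Lmin m `<` H & H `<` Lmax m].

Definition u_real m (theta : R) : R -> R[i] := fun x =>
  cpow x (2^-1 - m) * (cos theta)%:C + cpow x (2^-1 + m) * (sin theta)%:C.

Definition u_zero (theta : R) : R -> R[i] := fun x =>
  (x `^ (2^-1) * ln x * cos theta + x `^ (2^-1) * sin theta)%:C.

Definition u_imag (mu theta : R) : R -> R[i] := fun x =>
  (x `^ (2^-1) * cos (mu * ln x) * cos theta +
   x `^ (2^-1) * sin (mu * ln x) * sin theta)%:C.

Definition parametrizes_extensions m (u : R -> R -> R[i]) :=
  (forall theta, 0 <= theta < pi ->
     selfadjoint_extension m (Lbc m (u theta))) /\
  (forall H, selfadjoint_extension m H ->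
     exists! theta, 0 <= theta < pi /\ H = Lbc m (u theta)).

End Schroedinger.

(* Main.v *)
Require Import Defs.
From HB Require Import structures.
From mathcomp Require Import all_boot all_order all_algebra.
From mathcomp Require Import complex.
From mathcomp Require Import all_classical all_reals all_analysis.
From mathcomp Require Import measurable_realfun ring lra.

(** The maximal and the minimal operator depend on m only through kappa = m^2, which
is real.  Hence they split, like L^2 and the test functions, into real and imaginary
parts ([LmaxP], [LminP]), and the analysis can be done with real functions on
(0,oo).

Let u1, u2 be real solutions of the homogeneous equation with constant Wronskian
w <> 0, and write W(F,G) = F G' - F' G.  An L^2 function f with L f = g in the
sense of distributions agrees almost everywhere with a function F given by the
variation of constants ([regularity]); this holds because a test function is L of
a test function as soon as it is orthogonal to u1 and u2 ([test_preimage]).  Such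
an F tends to 0 at infinity together with F' ([sol_tail]), so integrating the
Lagrange identity W(F,G)' = g G - h F over (0,oo) leaves only the limit of W(F,G)
at 0.

If kappa < 1, then u1 and u2 are square integrable near 0, and the boundary values
A_j = lim_(x->0) W(u_j,F) exist.  The Plucker identity
W(u1,F) W(u2,G) - W(u1,G) W(u2,F) = w W(F,G) expresses the limit of W(F,G) through
them; this is the Green formula ([Green]).  The minimal operator is its own double
adjoint, and therefore it is the common kernel of A1 and A2 ([bvc_LminP]).  As
(A1, A2) maps the maximal operator onto C^2, everything becomes linear algebra in
C^2.  The strict extensions are the spaces a A1 + b A2 = 0 ([strict_bspace]), and
the Green formula makes such a space self-adjoint when (a, b) is real up to a
factor, that is (a, b) ~ (cos theta, sin theta) ([bspace_selfadjoint],
[selfadjoint_bspace]).  The operators of the statement are of this kind: L_m^u for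
u = a u1 + b u2 ([Lbc_bspace]), and H_m when x^(1/2+m) = a u1 + b u2
([Hop_bspace]).  An orthogonal projection onto the graph of the extension A1 = 0
solves (H - z) f = h for z = +-i, whence the deficiency indices ([deficiency11]).

A solution has the form x^(1/2) phi(ln x) with phi'' = kappa phi, so a dilation acts
on (A1, A2) as a translation acts on the solutions phi ([bvc_dil_uof]), and the
homogeneous strict extensions are the lines that all translations preserve.  The
translations are diagonal with distinct eigenvalues on e^(-mt), e^(mt) when
0 < m < 1 (two lines), a Jordan block on t, 1 when m = 0 (one line), and rotations on
cos(mu t), sin(mu t) when m = i mu (two lines, both of them non-real, hence not
self-adjoint).

If kappa >= 1, then x^(1/2-m) is not square integrable near 0.  This forces
W(F,G) = O(x) at 0 for any two elements of the maximal operator ([limit_point]),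
which is therefore symmetric and equal to the minimal one. *)

Set Implicit Arguments.
Unset Strict Implicit.
Unset Printing Implicit Defensive.

Import Order.TTheory GRing.Theory Num.Theory.
Import numFieldNormedType.Exports.

Local Open Scope classical_set_scope.
Local Open Scope ring_scope.
Local Open Scope complex_scope.

Lemma halflineE (R : realType) (x : R) : halfline x = (0 < x) :> Prop.
Proof. by rewrite /halfline /= in_itv/= andbT. Qed.

Lemma measurable_halfline (R : realType) :
  measurable (@halfline R : set (measurableTypeR R)).
Proof. exact: measurable_itv. Qed.
#[local] Hint Resolve measurable_halfline : core.

(** * Integrals of real functions *)

Section Integ.
Variable R : realType.
Local Notation mu := (@lebesgue_measure R).
Implicit Types (f g : R -> R) (D E : set (measurableTypeR R)).

Definition integ (D : set R) (f : R -> R) :=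
  mu.-integrable (D : set (measurableTypeR R)) (EFin \o f).

Lemma integ_meas D f : integ D f -> measurable_fun D f.
Proof. by move=> /measurable_int /measurable_EFinP. Qed.

Lemma integ_le D f g : measurable D -> measurable_fun D f ->
  (forall x, D x -> `|f x| <= `|g x|) -> integ D g -> integ D f.
Proof.
move=> mD mf fg; apply: (le_integrable mD); first exact/measurable_EFinP.
by move=> x Dx /=; rewrite lee_fin fg.
Qed.

Lemma integS D E f : measurable D -> measurable E -> E `<=` D ->
  integ D f -> integ E f.
Proof. by move=> mD mE ED; apply: integrableS. Qed.

Lemma eq_integ D f g : measurable D -> (forall x, D x -> f x = g x) ->
  integ D f -> integ D g.
Proof.
by move=> mD fg; apply: (eq_integrable mD) => x /[!inE] Dx /=; rewrite fg.
Qed.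

Lemma integD D f g : measurable D -> integ D f -> integ D g ->
  integ D (fun x => f x + g x).
Proof. by move=> mD; apply: integrableD. Qed.

Lemma integB D f g : measurable D -> integ D f -> integ D g ->
  integ D (fun x => f x - g x).
Proof. by move=> mD; apply: integrableB. Qed.

Lemma integZ D c f : measurable D -> integ D f -> integ D (fun x => c * f x).
Proof. by move=> mD; apply: integrableZl. Qed.

Lemma integN D f : measurable D -> integ D f -> integ D (fun x => - f x).
Proof. by move=> mD; apply: integrableN. Qed.

Lemma integ0 D : integ D (fun=> 0).
Proof. exact: integrable0. Qed.

Lemma integ_norm D f : measurable D -> integ D f -> integ D (fun x => `|f x|).
Proof. by move=> mD; apply: integrable_norm. Qed.

Lemma eq_Rint D f g : (forall x, D x -> f x = g x) ->
  \int[mu]_(x in D) f x = \int[mu]_(x in D) g x.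
Proof. by move=> fg; apply: eq_Rintegral => x /[!inE]; exact: fg. Qed.

Lemma ae_Rint D f g : measurable D -> measurable_fun D f -> measurable_fun D g ->
  {ae mu, forall x, D x -> f x = g x} ->
  \int[mu]_(x in D) f x = \int[mu]_(x in D) g x.
Proof.
move=> mD mf mg fg; congr fine; apply: ae_eq_integral => //.
- exact/measurable_EFinP.
- exact/measurable_EFinP.
- by apply: filterS fg => x fgx Dx /=; rewrite fgx.
Qed.

Lemma Rint_itv_cat f (a b c : R) : a <= b -> b <= c -> integ `[a, c] f ->
  \int[mu]_(x in `[a, c]) f x =
  \int[mu]_(x in `[a, b]) f x + \int[mu]_(x in `[b, c]) f x.
Proof.
move=> ab bc fi.
have := @Rintegral_itvB R f (BLeft a) (BRight c) b fi.
rewrite !bnd_simp => /(_ ab bc) H.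
apply/eqP; rewrite addrC -subr_eq H; apply/eqP.
apply: Rintegral_itv_obnd_cbnd; apply: (@integS `[a, c]) => //.
by apply: subset_itv; rewrite bnd_simp.
Qed.

End Integ.

(** * Absolutely continuous functions on the half-line *)

Section AbsCont.
Variable R : realType.
Local Notation mu := (@lebesgue_measure R).
Implicit Types (p q P Q : R -> R).

Definition locint p := forall a b : R, 0 < a -> integ `[a, b] p.
Definition cont p := forall x, 0 < x -> {for x, continuous p}.
(** An absolutely continuous function together with a chosen almost everywhere
    derivative; no bound is asked at 0. *)
Definition abscont P p := locint p /\
  forall a b, 0 < a -> a <= b -> P b - P a = \int[mu]_(x in `[a, b]) p x.

Lemma locintD p q : locint p -> locint q -> locint (fun x => p x + q x).
Proof. by move=> pi qi a b a0; apply: integD => //; [exact: pi|exact: qi]. Qed.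
Lemma locintB p q : locint p -> locint q -> locint (fun x => p x - q x).
Proof. by move=> pi qi a b a0; apply: integB => //; [exact: pi|exact: qi]. Qed.
Lemma locintZ c p : locint p -> locint (fun x => c * p x).
Proof. by move=> pi a b a0; apply: integZ => //; exact: pi. Qed.
Lemma eq_locint p q : (forall x, 0 < x -> p x = q x) -> locint p -> locint q.
Proof.
move=> pq pi a b a0; apply: eq_integ (pi a b a0) => // x /=.
by rewrite in_itv/= => /andP[ax _]; apply: pq; apply: lt_le_trans ax.
Qed.

Lemma cont_within p (a b : R) : 0 < a -> cont p -> {within `[a, b], continuous p}.
Proof.
move=> a0 pc; apply: continuous_in_subspaceT => x /[!inE]/=.
by rewrite in_itv/= => /andP[ax _]; apply: pc; apply: lt_le_trans ax.
Qed.

Lemma cont_bounded p (a b : R) : 0 < a -> cont p ->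
  exists2 M : R, 0 <= M & forall x, a <= x <= b -> `|p x| <= M.
Proof.
move=> a0 pc.
have /compact_bounded[M [_ Mp]] := continuous_compact (@cont_within p a b a0 pc)
   (@segment_compact _ _ _).
exists (`|M| + 1); first by rewrite addr_ge0.
move=> x xab; apply: (Mp (`|M| + 1)) => /=.
  by rewrite (le_lt_trans (ler_norm _))// ltrDl.
by exists x => //=; rewrite in_itv.
Qed.

Lemma cont_locint p : cont p -> locint p.
Proof.
move=> pc a b a0; apply: continuous_compact_integrable.
  exact: segment_compact.
exact: cont_within.
Qed.

Lemma cont_meas p : cont p -> measurable_fun (@halfline R) p.
Proof.
move=> pc; apply: open_continuous_measurable_fun; first exact: interval_open.
by move=> x; rewrite inE halflineE; exact: pc.
Qed.

Lemma locintM p q : cont q -> locint p -> locint (fun x => q x * p x).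
Proof.
move=> qc pi a b a0; have [M M0 qM] := cont_bounded b a0 qc.
apply: (@integ_le _ _ _ (fun x => M * p x)) => //.
- apply: measurable_funM; apply: integ_meas; last exact: pi.
  exact: cont_locint.
- move=> x /=; rewrite in_itv/= => xab; rewrite !normrM ler_pM//.
  by rewrite (ger0_norm M0) qM.
- by apply: integZ => //; exact: pi.
Qed.

Lemma eq_abscont P p P' p' : (forall x, 0 < x -> P x = P' x) ->
  (forall x, 0 < x -> p x = p' x) -> abscont P p -> abscont P' p'.
Proof.
move=> PP pp [pi PE]; split; first exact: eq_locint pp pi.
move=> a b a0 ab; rewrite -!PP//; last exact: lt_le_trans ab.
rewrite PE//; apply: eq_Rint => x /=.
by rewrite in_itv/= => /andP[ax _]; apply: pp; apply: lt_le_trans ax.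
Qed.

Lemma abscontD P p Q q : abscont P p -> abscont Q q ->
  abscont (fun x => P x + Q x) (fun x => p x + q x).
Proof.
move=> [pi PE] [qi QE]; split; first exact: locintD.
move=> a b a0 ab; rewrite RintegralD//; [|exact: pi|exact: qi].
by rewrite -PE// -QE//; ring.
Qed.

Lemma abscontZ c P p : abscont P p -> abscont (fun x => c * P x) (fun x => c * p x).
Proof.
move=> [pi PE]; split; first exact: locintZ.
by move=> a b a0 ab; rewrite RintegralZl//; [rewrite -PE//; ring|exact: pi].
Qed.

Lemma abscontB P p Q q : abscont P p -> abscont Q q ->
  abscont (fun x => P x - Q x) (fun x => p x - q x).
Proof.
move=> Pp Qq; apply: eq_abscont (abscontD Pp (abscontZ (-1) Qq)) => x x0 /=;
  by rewrite mulN1r.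
Qed.

Lemma abscont_cst c : abscont (fun=> c) (fun=> 0).
Proof.
split; first by move=> a b a0; exact: integ0.
by move=> a b a0 ab; rewrite subrr Rintegral_cst// mul0r.
Qed.

Lemma abscont_cont P p : abscont P p -> cont P.
Proof.
move=> [pi PE] x x0.
have x20 : 0 < x / 2 by rewrite divr_gt0.
have x2x : x / 2 < x by lra.
have H := @parameterized_integral_continuous R (x/2) (x+1) p.
have {H} /(_ ltac:(lra) (pi _ _ x20)) := H.
move=> /continuous_within_itvP -/(_ ltac:(lra))[+ _ _].
move=> /(_ x); rewrite in_itv/= => /(_ ltac:(lra)) H.
have : {for x, continuous (fun y => P (x/2) + parameterized_integral mu (x/2) y p)}.
  by apply: cvgD H; exact: cvg_cst.
move=> H2.
suff -> : {for x, continuous P} = {for x, continuous (fun y => P (x/2) + parameterized_integral mu (x/2) y p)} by [].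
apply/propext; split => // _.
rewrite /prop_for /continuous_at.
have -> : P x = P (x/2) + parameterized_integral mu (x/2) x p.
  rewrite /parameterized_integral -PE//; [ring|lra].
apply: cvg_trans H2; apply: near_eq_cvg.
near=> y; rewrite /parameterized_integral -PE//; first by ring.
by near: y; exact: lt_le_nbhsr.
Unshelve. all: by end_near. Qed.

Lemma abscont_derive P p x : abscont P p -> 0 < x -> {for x, continuous p} ->
  is_derive x 1 P (p x).
Proof.
move=> [pi PE] x0 pc.
have x20 : 0 < x / 2 by rewrite divr_gt0.
have x2x : x / 2 < x by lra.
have := @continuous_FTC1_closed R p (x/2) x (x+1) ltac:(lra) (pi _ _ x20) x2x pc.
set F := fun _ => _ => -[dF FE].
have dF2 : is_derive x 1 (F \+ cst (P (x/2))) (p x).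
  have dF1 : is_derive x 1 F (p x) by split; [exact: dF|rewrite -derive1E; exact: FE].
  by rewrite -[p x]addr0; apply: is_deriveD.
apply: near_eq_is_derive dF2.
near=> y; rewrite /F /= -PE//; first by rewrite subrK.
by near: y; exact: lt_le_nbhsr.
Unshelve. all: by end_near. Qed.

Lemma is_derive_cont P p : (forall x : R, 0 < x -> is_derive x 1 P (p x)) -> cont P.
Proof.
move=> dP x x0; apply/differentiable_continuous/derivable1_diffP.
by have [] := dP x x0.
Qed.

Lemma derive_abscont P p : (forall x : R, 0 < x -> is_derive x 1 P (p x)) -> cont p ->
  abscont P p.
Proof.
move=> dP pc; split; first exact: cont_locint.
move=> a b a0; rewrite le_eqVlt => /predU1P[->|ab].
  by rewrite subrr set_itv1 Rintegral_set1.
have b0 : 0 < b by lra.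
have := @continuous_FTC2 R p P a b ab (cont_within a0 pc).
rewrite /Rintegral => -> //=.
- have Pc := is_derive_cont dP; split => /=.
  + by move=> x; rewrite in_itv/= => /andP[ax _]; have [] := dP x (lt_trans a0 ax).
  + by apply: cvg_at_right_filter; exact: Pc.
  + by apply: cvg_at_left_filter; exact: Pc.
- move=> x; rewrite in_itv/= => /andP[ax _]; rewrite derive1E.
  by have [_ ->] := dP x (lt_trans a0 ax).
Qed.

Lemma abscont_ex p : locint p -> exists P, abscont P p.
Proof.
move=> pi.
exists (fun x => if x <= 1 then - \int[mu]_(t in `[x, 1]) p t else
    \int[mu]_(t in `[1, x]) p t); split=> // a b a0 ab.
case: ifPn => b1; case: ifPn => a1.
- by rewrite (@Rint_itv_cat _ p a b 1)//; [ring|exact: pi].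
- by exfalso; lra.
- rewrite -ltNge in b1.
  by rewrite (@Rint_itv_cat _ p a 1 b)//; [ring|lra|exact: pi].
- rewrite -!ltNge in a1 b1.
  by rewrite (@Rint_itv_cat _ p 1 a b)//; [ring|lra|exact: pi].
Qed.

Lemma Rint_patch (J : set R) q : measurable (J : set (measurableTypeR R)) ->
  integ J q ->
  (\int[mu]_y ((q \_ J) y)%:E)%E = (\int[mu]_(y in J) q y)%:E.
Proof.
move=> mJ qi; rewrite /Rintegral fineK; last exact: integrable_fin_num.
by rewrite [RHS]integral_mkcond; apply: eq_integral => y _; rewrite restrict_EFin.
Qed.

Lemma integ_patch (J : set R) q : measurable (J : set (measurableTypeR R)) ->
  integ J q -> integ setT (q \_ J).
Proof. by move=> mJ /(integrable_mkcond _ mJ); rewrite restrict_EFin. Qed.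

(** Fubini over the triangle y <= x; it is the product rule of absolutely
    continuous functions in integrated form. *)
Lemma fubini_triangle (a b : R) p q : integ `[a, b] p -> integ `[a, b] q ->
  \int[mu]_(x in `[a, b]) (p x * \int[mu]_(y in `[a, x]) q y) =
  \int[mu]_(y in `[a, b]) (q y * \int[mu]_(x in `[y, b]) p x).
Proof.
move=> pi qi; set I : set R := [set` `[a, b]].
have mI : measurable (I : set (measurableTypeR R)) by exact: measurable_itv.
pose pt := p \_ I; pose qt := q \_ I.
have pti : integ setT pt by exact: integ_patch.
have qti : integ setT qt by exact: integ_patch.
pose f (z : measurableTypeR R * measurableTypeR R) : \bar R :=
  (pt z.1 * qt z.2 * (if (z.2 <= z.1)%R then 1 else 0))%:E.
have mf : measurable_fun setT f.
  apply/measurable_EFinP; apply: measurable_funM.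
    apply: measurable_funM.
      by apply: (measurableT_comp (integ_meas pti)); exact: measurable_fst.
    by apply: (measurableT_comp (integ_meas qti)); exact: measurable_snd.
  apply: measurable_fun_ifT => //.
  apply: measurable_fun_ler; [exact: measurable_snd|exact: measurable_fst].
have fi : (mu \x mu)%E.-integrable setT f.
  apply: (proj2 (@integrable12ltyP _ _ (measurableTypeR R) (measurableTypeR R) R mu mu f mf)).
  apply: (@le_lt_trans _ _ (\int[mu]_x (`|pt x|%:E * \int[mu]_y (`|qt y|)%:E))%E).
    apply: ge0_le_integral => //.
    - by move=> x _; apply: integral_ge0.
    - apply: (measurable_fun_fubini_tonelli_F (abse \o f)) => //=.
      exact: measurableT_comp.
    - apply: emeasurable_funM; last exact: measurable_cst.
      by apply/measurable_EFinP; apply: measurableT_comp => //; exact: integ_meas.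
    - move=> x _; rewrite -ge0_integralZl_EFin//; last first.
        by apply/measurable_EFinP; apply: measurableT_comp => //; exact: integ_meas.
      apply: ge0_le_integral => //.
      + apply: measurableT_comp => //.
        exact: (measurableT_comp mf (@pair1_measurable _ _ _ _ x)).
      + apply: emeasurable_funM; first exact: measurable_cst.
        by apply/measurable_EFinP; apply: measurableT_comp => //; exact: integ_meas.
      + move=> y _ /=; rewrite lee_fin !normrM ler_piMr//.
        by case: ifP; rewrite ?normr1 ?normr0.
  rewrite ge0_integralZr//; last 2 first.
    by apply/measurable_EFinP; apply: measurableT_comp => //; exact: integ_meas.
    exact: integral_ge0.
  by apply: lte_mul_pinfty; [exact: integral_ge0| |];
    [apply: integrable_fin_num => //; exact: integ_norm|
     case/integrableP: qti].
have inner1 x : (\int[mu]_y f (x, y))%E =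
    (((fun x => p x * \int[mu]_(y in `[a, x]) q y) \_ I) x)%:E.
  rewrite patchE; case: ifPn => [/[!inE] xI|xI].
    have sJ : `[a, x] `<=` I by apply: subset_itvl; rewrite bnd_simp; move: xI; rewrite /I/= in_itv/= => /andP[].
    rewrite EFinM -Rint_patch//; last exact: integS qi.
    rewrite -integralZl//; last first.
      by apply: integ_patch => //; exact: integS qi.
    apply: eq_integral => y _; rewrite /f/= /pt /qt !patchE mem_set// -EFinM; congr EFin.
    rewrite -mulrA; congr (_ * _).
    have [yx|yx] := leP y x.
      rewrite mulr1; case: ifPn => [/[!inE] yI|/negP yI]; case: ifPn => //.
      + move=> /negP[]; rewrite inE/= in_itv/= yx andbT.
        by move: yI; rewrite /I /= in_itv/= => /andP[].
      + by move=> /[!inE]/sJ yI'; exfalso; apply: yI; rewrite inE.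
    rewrite mulr0; case: ifPn => //; rewrite inE/= in_itv/= => /andP[_].
    by rewrite leNgt yx.
  rewrite integral0_eq// => y _; rewrite /f/= /pt patchE.
  by rewrite (negbTE xI) !mul0r.
have inner2 y : (\int[mu]_x f (x, y))%E =
    (((fun y => q y * \int[mu]_(x in `[y, b]) p x) \_ I) y)%:E.
  rewrite patchE; case: ifPn => [/[!inE] xI|xI].
    have sJ : `[y, b] `<=` I by apply: subset_itvr; rewrite bnd_simp; move: xI; rewrite /I/= in_itv/= => /andP[].
    rewrite EFinM -Rint_patch//; last exact: integS pi.
    rewrite -integralZl//; last first.
      by apply: integ_patch => //; exact: integS pi.
    apply: eq_integral => x _; rewrite /f/= /pt /qt !patchE [y \in I]mem_set// -EFinM; congr EFin.
    rewrite mulrAC [LHS]mulrC; congr (_ * _).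
    have [yx|yx] := leP y x.
      rewrite mulr1; case: ifPn => [/[!inE] yI|/negP yI]; case: ifPn => //.
      + move=> /negP[]; rewrite inE/= in_itv/= yx /=.
        by move: yI; rewrite /I /= in_itv/= => /andP[].
      + by move=> /[!inE]/sJ yI'; exfalso; apply: yI; rewrite inE.
    rewrite mulr0; case: ifPn => //; rewrite inE/= in_itv/= => /andP[+ _].
    by rewrite leNgt yx.
  rewrite integral0_eq// => x _; rewrite /f/= /qt patchE.
  by rewrite (negbTE xI) mulr0 mul0r.
have := Fubini fi.
under eq_integral do rewrite inner1.
under [RHS]eq_integral do rewrite inner2.
move=> H; rewrite Rintegral_mkcond [RHS]Rintegral_mkcond.
by rewrite /Rintegral H.
Qed.

(** On [a,x] each factor is its value at a plus an integral; the product of the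
    two integrals is split along the diagonal by Fubini. *)
Lemma abscontM P p Q q : abscont P p -> abscont Q q ->
  abscont (fun x => P x * Q x) (fun x => P x * q x + Q x * p x).
Proof.
move=> Pp Qq; have [pi PE] := Pp; have [qi QE] := Qq.
have Pc := abscont_cont Pp; have Qc := abscont_cont Qq.
have Pqi := locintM Pc qi; have Qpi := locintM Qc pi.
split; first exact: locintD.
move=> a b a0 ab.
have H := fubini_triangle (pi a b a0) (qi a b a0).
rewrite (@eq_Rint _ _ _ (fun x => Q x * p x - Q a * p x)) in H; last first.
  move=> x /=; rewrite in_itv/= => /andP[ax xb].
  by rewrite -QE//; ring.
rewrite (@eq_Rint _ _ (fun y => q y * _) (fun x => P b * q x - P x * q x)) in H; last first.
  move=> x /=; rewrite in_itv/= => /andP[ax xb].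
  by rewrite -PE//; [ring|lra].
rewrite !RintegralB// in H; [|exact: (locintZ (P b) qi)|exact: Pqi|exact: Qpi|exact: (locintZ (Q a) pi)].
rewrite !RintegralZl// in H; [|exact: qi|exact: pi].
rewrite RintegralD//; [|exact: Pqi|exact: Qpi].
rewrite -PE// -QE// in H.
lra.
Qed.

Lemma Rint_exhaust (D : set R) p (E : nat -> set R) :
  measurable (D : set (measurableTypeR R)) -> integ D p ->
  (forall n, measurable (E n : set (measurableTypeR R))) ->
  (forall n, E n `<=` D) ->
  (forall x, D x -> \forall n \near \oo, E n x) ->
  \int[mu]_(x in E n) p x @[n --> \oo] --> \int[mu]_(x in D) p x.
Proof.
move=> mD pi mE ED Dev.
have [] := @dominated_convergence _ _ _ mu D mD
  (fun n => EFin \o (p \_ (E n))) (EFin \o p) (fun x => `|p x|%:E).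
- move=> n; apply/measurable_EFinP.
  apply/measurable_restrict => //; apply: measurable_funS (integ_meas pi) => //.
- by apply/measurable_EFinP; exact: integ_meas.
- apply: aeW => x Dx; apply: cvg_near_cst; have := Dev x Dx.
  by apply: filterS => n Enx /=; rewrite patchE mem_set.
- exact: integ_norm.
- apply: aeW => x n Dx /=; rewrite patchE; case: ifPn => _; rewrite lee_fin//.
  by rewrite normr0.
move=> _ _ H; rewrite /Rintegral.
apply: fine_cvg; rewrite fineK; last exact: integrable_fin_num.
apply: cvg_trans H; apply: near_eq_cvg; near=> n.
rewrite -{1}(setIidr (@ED n)) integral_mkcondr.
by apply: eq_integral => x _; rewrite restrict_EFin.
Unshelve. all: by end_near. Qed.

(** Along any sequence u n tending to 0 the intervals [u n,1] exhaust (0,1]. *)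
Lemma abscont_cvg0 P p : abscont P p -> integ `]0, 1] p ->
  P x @[x --> 0^'+] --> P 1 - \int[mu]_(x in `]0, 1]) p x.
Proof.
move=> [pi PE] p01; apply/cvg_at_rightP => u [u0 ucvg].
have H : \int[mu]_(x in [set` `]0, 1]%R] `&` [set` `[u n, 1]]) p x @[n --> \oo]
    --> \int[mu]_(x in `]0, 1]) p x.
  apply: Rint_exhaust => //.
  - by move=> n; apply: measurableI.
  - move=> x /=; rewrite in_itv/= => /andP[x0 x1].
    have H : \forall n \near \oo, u n <= x by exact: cvgr_le ucvg _ x0.
    apply: filterS H => n unx; by rewrite /= !in_itv/= x0 x1 unx.
have : P 1 - \int[mu]_(x in [set` `]0, 1]%R] `&` [set` `[u n, 1]]) p x @[n --> \oo]
    --> P 1 - \int[mu]_(x in `]0, 1]) p x.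
  by apply: cvgB => //; exact: cvg_cst.
apply: cvg_trans; apply: near_eq_cvg.
have H1 : \forall n \near \oo, u n <= 1 by exact: cvgr_le ucvg _ ltr01.
apply: filterS H1 => n un1 /=.
rewrite setIidr; last by move=> x /=; rewrite !in_itv/= => /andP[/(lt_le_trans (u0 n)) -> ->].
by rewrite -PE//; ring.
Qed.

Lemma abscont_cvgy P p : abscont P p -> integ `]1, +oo[ p ->
  P x @[x --> +oo] --> P 1 + \int[mu]_(x in `]1, +oo[) p x.
Proof.
move=> [pi PE] p01; apply/cvg_pinftyP => u ucvg.
have H : \int[mu]_(x in `]1, u n]) p x @[n --> \oo]
    --> \int[mu]_(x in `]1, +oo[) p x.
  apply: Rint_exhaust => //.
  - by move=> n; apply: subset_itvl.
  - move=> x /=; rewrite in_itv/= andbT => x1.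
    have /cvgryPge/(_ x) H := ucvg; apply: filterS H => n unx.
    by rewrite /= !in_itv/= x1.
have : P 1 + \int[mu]_(x in `]1, u n]) p x @[n --> \oo]
    --> P 1 + \int[mu]_(x in `]1, +oo[) p x.
  by apply: cvgD => //; exact: cvg_cst.
apply: cvg_trans; apply: near_eq_cvg.
have /cvgryPge/(_ 1) H1 := ucvg; apply: filterS H1 => n unx.
rewrite Rintegral_itv_obnd_cbnd; first by rewrite -PE//; ring.
by apply: integS (pi 1 (u n) ltr01) => //; apply: subset_itvr; rewrite bnd_simp.
Qed.

Lemma halfline_split : @halfline R = [set` `]0, 1]%R] `|` [set` `]1, +oo[%R].
Proof.
apply/seteqP; split => x; rewrite halflineE /= !in_itv/= andbT.
  by have [|] := leP x 1; [left|right]; rewrite ?andbT//; apply/andP.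
by move=> [/andP[]//|]; apply: lt_trans.
Qed.

Lemma halfline_disj : [disjoint [set` `]0, (1 : R)]%R] & [set` `]1, +oo[%R]].
Proof.
apply/disj_set2P; rewrite -subset0 => x [] /=; rewrite !in_itv/= andbT.
by move=> /andP[_ x1] /lt_le_trans/(_ x1); rewrite ltxx.
Qed.

Lemma integ_halfline p : integ (@halfline R) p <-> integ `]0, 1] p /\ integ `]1, +oo[ p.
Proof.
split.
  by move=> pi; split; apply: integS pi => //; rewrite halfline_split;
    [exact: subsetUl|exact: subsetUr].
move=> [p1 p2]; have mp : measurable_fun (@halfline R : set (measurableTypeR R)) p.
  by rewrite halfline_split; apply/measurable_funU => //; split; exact: integ_meas.
apply/integrableP; split; first exact/measurable_EFinP.
rewrite halfline_split ge0_integral_setU//.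
- by apply: lte_add_pinfty; [case/integrableP: p1|case/integrableP: p2].
- rewrite -halfline_split; apply/measurable_EFinP; exact: measurableT_comp.
- exact: halfline_disj.
Qed.

Lemma abscont_Rint_halfline P p (l0 l1 : R) : abscont P p -> integ (@halfline R) p ->
  P x @[x --> 0^'+] --> l0 -> P x @[x --> +oo] --> l1 ->
  \int[mu]_(x in @halfline R) p x = l1 - l0.
Proof.
move=> Pp pi P0 Py; have /integ_halfline[p1 p2] := pi.
have <- := cvg_unique (@Rhausdorff R) (abscont_cvg0 Pp p1) P0.
have <- := cvg_unique (@Rhausdorff R) (abscont_cvgy Pp p2) Py.
rewrite {1}halfline_split Rintegral_setU//; first by ring.
  by rewrite -halfline_split.
exact: halfline_disj.
Qed.

Lemma itv01_bigcup :
  [set` `]0, (1:R)]%R] = \bigcup_(n : nat) [set` `[n.+1%:R^-1, (1:R)]%R].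
Proof.
apply/seteqP; split => x /=.
  rewrite in_itv/= => /andP[x0 x1].
  have [n _ nx] := near_infty_natSinv_lt (PosNum x0).
  by exists n => //=; rewrite in_itv/= x1 andbT; apply/ltW/(nx n)/leqnn.
move=> [n _] /=; rewrite !in_itv/= => /andP[+ ->]; rewrite andbT.
by apply: lt_le_trans; rewrite invr_gt0.
Qed.

(** A primitive that is bounded below controls the increasing integrals over
    [1/n,1] of a nonnegative function, so monotone convergence applies. *)
Lemma abscont_ge0_integ01 P p M : abscont P p -> (forall x, 0 < x -> 0 <= p x) ->
  (forall x, 0 < x <= 1 -> - M <= P x) -> integ `]0, 1] p.
Proof.
move=> [pi PE] p0 PM.
have n0 n : 0 < n.+1%:R^-1 :> R by rewrite invr_gt0.
have n1 n : n.+1%:R^-1 <= 1 :> R by rewrite invf_le1// ler1n.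
have mp : measurable_fun (`]0, 1]%classic : set (measurableTypeR R)) p.
  rewrite itv01_bigcup.
  apply/measurable_fun_bigcup => [//|n]; apply: integ_meas; exact: pi.
have sub (n : nat) : [set` `[n.+1%:R^-1, 1 : R]] `<=` [set` `]0, 1 : R]].
  by apply: subset_itvr; rewrite bnd_simp.
apply/integrableP; split; first exact/measurable_EFinP.
have := @ge0_nondecreasing_set_cvg_integral _ (measurableTypeR R) R
  (fun n => [set` `[n.+1%:R^-1, 1]%R]) (fun x => `|p x|%:E) mu.
rewrite -itv01_bigcup.
have H1 : {homo (fun n => [set` `[n.+1%:R^-1, (1:R)]%R]) : n m / (n <= m)%N >-> (n <= m)%O}.
  move=> i j ij; apply/subsetPset; apply: subset_itvr.
  by rewrite bnd_simp lef_pV2 ?posrE// ler_nat ltnS.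
move=> /(_ H1 (fun=> measurable_itv _)).
have H2 (i : nat) : measurable_fun (`[i.+1%:R^-1, 1]%classic : set (measurableTypeR R)) (fun x => `|p x|%:E).
  apply/measurable_EFinP; apply: measurableT_comp => //.
  apply: integ_meas; exact: pi.
move=> /(_ H2 (fun _ _ _ => lee_tofin (normr_ge0 _))) Hc.
rewrite (@le_lt_trans _ _ (P 1 + M)%:E)// ?ltry//.
rewrite -(cvg_lim _ Hc)//; apply: lime_le; first by apply/cvg_ex; eexists; exact: Hc.
apply: nearW => n.
rewrite (@eq_integral _ _ _ mu _ (EFin \o p)); last first.
  move=> x; rewrite inE/= in_itv/= => /andP[nx _].
  by rewrite ger0_norm// p0// (lt_le_trans (n0 n)).
rewrite -[leLHS]fineK; last by apply: integrable_fin_num => //; exact: pi.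
rewrite lee_fin -/(Rintegral _ _ _) -PE// lerD2l lerNl; apply: PM.
by rewrite n0 n1.
Qed.

End AbsCont.

(** * Real square-integrable functions *)

Section L2real.
Variable R : realType.
Local Notation mu := (@lebesgue_measure R).
Local Notation hl := (@halfline R).
Implicit Types (f g h : R -> R).

Definition L2r f := measurable_fun (hl : set (measurableTypeR R)) f /\
  integ hl (fun x => f x ^+ 2).
Definition ip f g := \int[mu]_(x in hl) (f x * g x).
Definition nsq f := ip f f.
Definition eqae f g := {ae mu, forall x, hl x -> f x = g x}.

Lemma ae_imp (P Q : R -> Prop) : (forall x, P x -> Q x) ->
  {ae mu, forall x, P x} -> {ae mu, forall x, Q x}.
Proof.
by move=> PQ; apply: filterS => //; exact: (ae_filter_ringOfSetsType mu).
Qed.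

Lemma ae_imp2 (P Q S : R -> Prop) : (forall x, P x -> Q x -> S x) ->
  {ae mu, forall x, P x} -> {ae mu, forall x, Q x} -> {ae mu, forall x, S x}.
Proof.
by move=> PQ; apply: filterS2 => //; exact: (ae_filter_ringOfSetsType mu).
Qed.

Lemma L2rM f g : L2r f -> L2r g -> integ hl (fun x => f x * g x).
Proof.
move=> [mf f2] [mg g2].
apply: (@integ_le _ _ _ (fun x => f x ^+ 2 + g x ^+ 2)) => //.
- exact: measurable_funM.
- move=> x _; rewrite normrM (ger0_norm (addr_ge0 (sqr_ge0 _) (sqr_ge0 _))).
  rewrite -(normr_id (f x)) -(real_normK (num_real (f x))) -(real_normK (num_real (g x))) !normr_id.
  have := sqr_ge0 (`|f x| - `|g x|); have := normr_ge0 (f x); have := normr_ge0 (g x).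
  by nra.
- exact: integD.
Qed.

Lemma L2r_le f g : measurable_fun (hl : set (measurableTypeR R)) f ->
  (forall x, 0 < x -> `|f x| <= `|g x|) -> L2r g -> L2r f.
Proof.
move=> mf fg [mg g2]; split=> //; apply: (@integ_le _ _ _ (fun x => g x ^+ 2)) => //.
  exact: measurable_funX.
by move=> x; rewrite halflineE => x0; rewrite !normrX lerXn2r ?nnegrE// fg.
Qed.

Lemma L2rZ c f : L2r f -> L2r (fun x => c * f x).
Proof.
move=> [mf f2]; split; first exact: measurable_funM.
apply: (@eq_integ _ _ (fun x => c ^+ 2 * f x ^+ 2)) => //.
  by move=> x _; rewrite exprMn.
exact: integZ.
Qed.

Lemma L2rD f g : L2r f -> L2r g -> L2r (fun x => f x + g x).
Proof.
move=> Lf Lg; have [mf f2] := Lf; have [mg g2] := Lg.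
split; first exact: measurable_funD.
apply: (@eq_integ _ _ (fun x => (f x ^+ 2 + 2 * (f x * g x)) + g x ^+ 2)) => //.
  by move=> x _; ring.
by apply: integD => //; apply: integD => //; apply: integZ => //; exact: L2rM.
Qed.

Lemma eq_L2r f g : (forall x, 0 < x -> f x = g x) -> L2r f -> L2r g.
Proof.
move=> fg [mf f2]; split.
  apply: eq_measurable_fun mf => x; rewrite inE => hx; apply: fg.
  by rewrite halflineE in hx.
apply: eq_integ f2 => // x; rewrite halflineE => x0; by rewrite fg.
Qed.

Lemma L2rN f : L2r f -> L2r (fun x => - f x).
Proof. by move=> /(L2rZ (-1)); apply: eq_L2r => x _; rewrite mulN1r. Qed.

Lemma L2rB f g : L2r f -> L2r g -> L2r (fun x => f x - g x).
Proof. by move=> Lf /L2rN; exact: L2rD. Qed.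

Lemma L2r0 : L2r (fun=> 0).
Proof.
split; first exact: measurable_cst.
by apply: eq_integ (integ0 _) => // x _; rewrite expr0n.
Qed.

Lemma eqae_refl f : eqae f f.
Proof. by apply: aeW. Qed.

Lemma eqae_sym f g : eqae f g -> eqae g f.
Proof. by apply: ae_imp => x fg hx; rewrite fg. Qed.

Lemma eqae_trans f g h : eqae f g -> eqae g h -> eqae f h.
Proof. by apply: ae_imp2 => x fg gh hx; rewrite fg// gh. Qed.

Lemma eqae_sub f g : eqae (fun x => f x - g x) (fun=> 0) -> eqae f g.
Proof. by apply: ae_imp => x fg hx; apply/eqP; rewrite -subr_eq0 fg. Qed.

Lemma eqae_L2r f g : measurable_fun (hl : set (measurableTypeR R)) g ->
  eqae f g -> L2r f -> L2r g.
Proof.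
move=> mg fg [mf f2]; split=> //.
have mg2 : measurable_fun (hl : set (measurableTypeR R)) (fun x => g x ^+ 2).
  exact: measurable_funX.
apply/integrableP; split; first exact/measurable_EFinP.
rewrite (@ae_eq_integral _ _ _ mu hl (fun x => `|f x ^+ 2|%:E)%E)//.
- by case/integrableP: f2.
- by apply/measurable_EFinP; apply: measurableT_comp.
- apply/measurable_EFinP; apply: measurableT_comp => //; exact: measurable_funX.
- by apply: ae_imp fg => x fg hx /=; rewrite fg.
Qed.

Lemma ipC f g : ip f g = ip g f.
Proof. by apply: eq_Rint => x _; rewrite mulrC. Qed.

Lemma ipDl f g h : L2r f -> L2r g -> L2r h ->
  ip (fun x => f x + g x) h = ip f h + ip g h.
Proof.
move=> Lf Lg Lh; rewrite /ip -RintegralD//; [|exact: L2rM..].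
by apply: eq_Rint => x _; rewrite mulrDl.
Qed.

Lemma ipZl c f h : L2r f -> L2r h -> ip (fun x => c * f x) h = c * ip f h.
Proof.
move=> Lf Lh; rewrite /ip -RintegralZl//; last exact: L2rM.
by apply: eq_Rint => x _; rewrite mulrA.
Qed.

Lemma eq_ip f g f' g' : eqae f f' -> eqae g g' ->
  L2r f -> L2r g -> L2r f' -> L2r g' -> ip f g = ip f' g'.
Proof.
move=> ff gg Lf Lg Lf' Lg'; apply: ae_Rint => //.
- by apply: integ_meas; exact: L2rM.
- by apply: integ_meas; exact: L2rM.
- by apply: ae_imp2 ff gg => x fx gx hx; rewrite fx// gx.
Qed.

Lemma ipNl f h : L2r f -> L2r h -> ip (fun x => - f x) h = - ip f h.
Proof.
move=> Lf Lh; rewrite -mulN1r -ipZl//.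
by apply: eq_Rint => x _; rewrite mulN1r.
Qed.

Lemma ipBl f g h : L2r f -> L2r g -> L2r h ->
  ip (fun x => f x - g x) h = ip f h - ip g h.
Proof.
by move=> Lf Lg Lh; rewrite ipDl//; [rewrite ipNl|exact: L2rN].
Qed.

Lemma ipDr f g h : L2r f -> L2r g -> L2r h ->
  ip h (fun x => f x + g x) = ip h f + ip h g.
Proof. by move=> *; rewrite ipC ipDl// ![ip _ h]ipC. Qed.
Lemma ipBr f g h : L2r f -> L2r g -> L2r h ->
  ip h (fun x => f x - g x) = ip h f - ip h g.
Proof. by move=> *; rewrite ipC ipBl// ![ip _ h]ipC. Qed.
Lemma ipZr c f h : L2r f -> L2r h -> ip h (fun x => c * f x) = c * ip h f.
Proof. by move=> *; rewrite ipC ipZl// ipC. Qed.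
Lemma ipNr f h : L2r f -> L2r h -> ip h (fun x => - f x) = - ip h f.
Proof. by move=> *; rewrite ipC ipNl// ipC. Qed.

Lemma nsq_ge0 f : 0 <= nsq f.
Proof. by apply: Rintegral_ge0 => x _; rewrite -expr2 sqr_ge0. Qed.

Lemma nsqE f : L2r f -> (\int[mu]_(x in hl) (f x ^+ 2)%:E)%E = (nsq f)%:E.
Proof.
move=> Lf; rewrite /nsq /ip /Rintegral fineK.
  by apply: eq_integral => x _; rewrite expr2.
by apply: integrable_fin_num => //; exact: L2rM.
Qed.

Lemma nsq_eq0 f : L2r f -> nsq f = 0 -> eqae f (fun=> 0).
Proof.
move=> Lf f0; have := nsqE Lf; rewrite f0.
have mf2 : measurable_fun (hl : set (measurableTypeR R)) (fun x => (f x ^+ 2)%:E).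
  by apply/measurable_EFinP/measurable_funX; case: Lf.
under eq_integral => x _ do rewrite -(ger0_norm (sqr_ge0 (f x))).
move=> /(@ae_eq_integral_abs _ _ _ mu hl (@measurable_halfline R) _ mf2).
apply: filterS => x H hx; have /= := H hx.
by move=> /eqP; rewrite eqe expf_eq0/= => /eqP.
Qed.

Lemma nsqZ c f : L2r f -> nsq (fun x => c * f x) = c ^+ 2 * nsq f.
Proof.
by move=> Lf; rewrite /nsq ipZl ?ipZr//; [ring|exact: L2rZ].
Qed.

Lemma nsqD f g : L2r f -> L2r g ->
  nsq (fun x => f x + g x) = nsq f + 2 * ip f g + nsq g.
Proof.
move=> Lf Lg; have Lfg := L2rD Lf Lg.
by rewrite /nsq ipDl// !ipDr// (ipC g f); ring.
Qed.

Lemma nsqB f g : L2r f -> L2r g ->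
  nsq (fun x => f x - g x) = nsq f - 2 * ip f g + nsq g.
Proof.
move=> Lf Lg; have Lfg := L2rB Lf Lg.
by rewrite /nsq ipBl// !ipBr// (ipC g f); ring.
Qed.

Lemma nsqD_le f g : L2r f -> L2r g ->
  nsq (fun x => f x + g x) <= 2 * nsq f + 2 * nsq g.
Proof.
move=> Lf Lg; rewrite nsqD//; have := nsq_ge0 (fun x => f x - g x).
by rewrite nsqB//; lra.
Qed.

(** Young's inequality stands in for Cauchy-Schwarz: with a free weight t it
    needs no square roots. *)
Lemma ip_young f g (t : R) : 0 < t -> L2r f -> L2r g ->
  `|ip f g| <= (t * nsq f + t^-1 * nsq g) / 2.
Proof.
move=> t0 Lf Lg.
have := nsq_ge0 (fun x => t * f x - g x); have := nsq_ge0 (fun x => t * f x + g x).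
have Ltf := L2rZ t Lf.
rewrite nsqD// nsqB// nsqZ// ipZl// => H1 H2.
have t1 : 0 < t^-1 by rewrite invr_gt0.
have E : t^-1 * t = 1 by rewrite mulVf// gt_eqF.
rewrite ler_norml; apply/andP; split.
  rewrite -subr_ge0 opprK; have -> : ip f g + (t * nsq f + t^-1 * nsq g) / 2 =
    t^-1 / 2 * (t ^+ 2 * nsq f + 2 * (t * ip f g) + nsq g).
    by transitivity (t^-1 * t * ip f g + (t^-1 * t * t * nsq f + t^-1 * nsq g) / 2); [rewrite E; ring|by field; rewrite gt_eqF].
  by rewrite mulr_ge0// divr_ge0// ltW.
rewrite -subr_ge0; have -> : (t * nsq f + t^-1 * nsq g) / 2 - ip f g =
    t^-1 / 2 * (t ^+ 2 * nsq f - 2 * (t * ip f g) + nsq g).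
  by transitivity (- (t^-1 * t * ip f g) + (t^-1 * t * t * nsq f + t^-1 * nsq g) / 2); [rewrite E; ring|by field; rewrite gt_eqF].
by rewrite mulr_ge0// divr_ge0// ltW.
Qed.

Lemma L2r_indic (D : set R) : measurable (D : set (measurableTypeR R)) ->
  (mu D < +oo)%E -> D `<=` hl -> L2r (\1_D).
Proof.
move=> mD Dfin Dhl; split; first by apply: measurable_funTS; exact: measurable_indic.
apply: (@eq_integ _ _ (\1_D)) => //.
  by move=> x _; rewrite indicE; case: (_ \in _); rewrite ?expr1n ?expr0n.
apply: (@integS _ setT) => //.
apply/integrableP; split; first exact/measurable_EFinP/measurable_indic.
rewrite (@eq_integral _ _ _ mu setT (EFin \o \1_D)); last first.
  by move=> x _ /=; rewrite ger0_norm.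
by rewrite integral_indic// setIT.
Qed.

Lemma L2r_integ (D : set R) f : measurable (D : set (measurableTypeR R)) ->
  (mu D < +oo)%E -> D `<=` hl -> L2r f -> integ D f.
Proof.
move=> mD Dfin Dhl Lf; have Li := L2r_indic mD Dfin Dhl.
have := L2rM Lf Li => /(@integS _ _ D _ (@measurable_halfline R) mD Dhl).
by apply: eq_integ => // x Dx; rewrite indicE mem_set// mulr1.
Qed.

Lemma mu_itvcc_lty (a b : R) : (mu `[a, b]%classic < +oo)%E.
Proof.
have H := @lebesgue_measure_itv R `[a, b].
apply: (@le_lt_trans _ _ (`|b - a|)%:E); last exact: ltry.
have -> : (mu `[a, b]%classic = if (a < b)%R then (b - a)%:E else 0)%E.
  by rewrite [LHS]H /= lte_fin; case: ifP.
by case: ifP; rewrite lee_fin// ler_norm.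
Qed.

Lemma mu_itvoc_lty (a b : R) : (mu `]a, b]%classic < +oo)%E.
Proof.
have H := @lebesgue_measure_itv R `]a, b].
apply: (@le_lt_trans _ _ (`|b - a|)%:E); last exact: ltry.
have -> : (mu `]a, b]%classic = if (a < b)%R then (b - a)%:E else 0)%E.
  by rewrite [LHS]H /= lte_fin; case: ifP.
by case: ifP; rewrite lee_fin// ler_norm.
Qed.

Lemma L2r_locint f : L2r f -> locint f.
Proof.
move=> Lf a b a0; apply: L2r_integ => //; first exact: mu_itvcc_lty.
by move=> x; rewrite halflineE /= in_itv/= => /andP[ax _]; lra.
Qed.

Lemma L2r_integ01 f : L2r f -> integ `]0, 1] f.
Proof.
move=> Lf; apply: L2r_integ => //; first exact: mu_itvoc_lty.
by move=> x; rewrite halflineE /= in_itv/= => /andP[ax _].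
Qed.

(** Needed to replace the integrand by a lower limit in Fatou's lemma. *)
Lemma measurable_limn_einf (D : set (measurableTypeR R)) (f : nat -> R -> \bar R) :
  measurable D -> (forall n, measurable_fun D (f n)) ->
  measurable_fun D (fun x => limn_einf (f^~ x)).
Proof.
move=> mD mf; under eq_fun do rewrite limn_einf_lim.
apply: (@emeasurable_fun_cvg _ _ _ _ (fun n x => einfs (f^~ x) n)).
  by move=> n; exact: measurable_fun_einfs.
by move=> x Dx; exact: is_cvg_einfs.
Qed.

Lemma nsq_fatou (f : nat -> R -> R) g (M : R) : (forall n, L2r (f n)) ->
  measurable_fun (hl : set (measurableTypeR R)) g ->
  {ae mu, forall x, hl x -> f n x @[n --> \oo] --> g x} ->
  (\forall n \near \oo, nsq (f n) <= M) -> L2r g /\ nsq g <= M.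
Proof.
move=> Lf mg fg fM.
have mfn n : measurable_fun (hl : set (measurableTypeR R)) (fun x => (f n x ^+ 2)%:E).
  by apply/measurable_EFinP/measurable_funX; case: (Lf n).
have mg2 : measurable_fun (hl : set (measurableTypeR R)) (fun x => (g x ^+ 2)%:E).
  by apply/measurable_EFinP/measurable_funX.
have H : (\int[mu]_(x in hl) (g x ^+ 2)%:E <= M%:E)%E.
  have F := @fatou _ _ _ mu hl (@measurable_halfline R) (fun n x => (f n x ^+ 2)%:E) mfn
    (fun n x _ => lee_tofin (sqr_ge0 _)).
  apply: (le_trans (le_trans _ F)).
    rewrite [leLHS](@ae_eq_integral _ _ _ mu hl (fun x => limn_einf (fun n => (f n x ^+ 2)%:E)))//.
      exact: measurable_limn_einf.
    apply: ae_imp fg => x fgx hx; apply/esym.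
    have -> // := @cvg_limn_einf_sup _ _ (g x ^+ 2)%:E.
    apply/cvg_EFin; first by apply: nearW.
    rewrite expr2; under eq_fun do rewrite /= expr2.
    by apply: cvgM; exact: fgx.
  rewrite limn_einf_lim; apply: lime_le; first exact: is_cvg_einfs.
  near=> n.
  apply: (@le_trans _ _ (\int[mu]_(x in hl) (f n x ^+ 2)%:E)%E).
    by apply: ereal_inf_lbound; exists n => /=.
  rewrite nsqE// lee_fin; near: n; exact: fM.
have Lg : L2r g.
  split=> //; apply/integrableP; split=> //.
  rewrite (le_lt_trans _ (ltry M))//; apply: le_trans H.
  rewrite (@eq_integral _ _ _ mu hl (fun x => (g x ^+ 2)%:E))// => x _ /=.
  by rewrite ger0_norm// sqr_ge0.
by split=> //; move: H; rewrite nsqE// lee_fin.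
Unshelve. all: by end_near. Qed.

(** With weights 2^-n in Young's inequality the integrals of |h n| over (0,K]
    are summable, so the series of the |h n| is finite almost everywhere there.
    *)
Lemma ae_cvg_of_sum (h : nat -> R -> R) (M : R) :
  (forall n, L2r (h n)) -> (forall n, nsq (h n) <= M * 4^-1 ^+ n) ->
  {ae mu, forall x, hl x -> cvgn (fun n => \sum_(0 <= k < n) h k x)}.
Proof.
move=> Lh hM.
pose b n := 2^-1 ^+ n : R.
have b0 n : 0 < b n by rewrite exprn_gt0.
have mh n : measurable_fun (hl : set (measurableTypeR R)) (fun x => `|h n x|%:E).
  by apply/measurable_EFinP/measurableT_comp => //; case: (Lh n).
have bs : forall N, \sum_(0 <= k < N) b k <= 2.
  move=> N; suff -> : \sum_(0 <= k < N) b k = 2 - 2 * 2^-1 ^+ N.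
    by rewrite lerBlDr lerDl mulr_ge0// exprn_ge0.
  elim: N => [|N IH]; first by rewrite big_geq// expr0; ring.
  by rewrite big_nat_recr//= IH /b exprS; field.
have HK (K : nat) : {ae mu, forall x, ([set` `]0, K%:R : R]] x -> cvgn (fun n => \sum_(0 <= k < n) h k x))}.
  pose D : set R := [set` `]0, K%:R : R]].
  have mD : measurable (D : set (measurableTypeR R)) by exact: measurable_itv.
  have Dhl : D `<=` hl by move=> x; rewrite halflineE /D/= in_itv/= => /andP[].
  have Dfin : (mu D < +oo)%E by exact: mu_itvoc_lty.
  have LD := L2r_indic mD Dfin Dhl.
  have mhD n : measurable_fun (D : set (measurableTypeR R)) (fun x => `|h n x|%:E).
    exact: measurable_funS (mh n).
  have bound n : (\int[mu]_(x in D) `|h n x|%:E <= ((M + nsq (\1_D)) / 2 * b n)%:E)%E.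
    have hD : integ D (fun x => `|h n x|).
      by apply: integ_norm => //; apply: L2r_integ.
    rewrite -[leLHS]fineK; last exact: integrable_fin_num.
    rewrite lee_fin -/(Rintegral _ _ _).
    have -> : \int[mu]_(x in D) `|h n x| = ip (fun x => `|h n x|) (\1_D).
      rewrite /ip Rintegral_mkcond [RHS]Rintegral_mkcond.
      apply: eq_Rint => x _; rewrite !patchE indicE.
      case: ifPn => xD; last by case: ifP => _; rewrite ?mulr0.
      by rewrite mem_set ?mulr1//; apply: Dhl; rewrite inE in xD.
    have Lah : L2r (fun x => `|h n x|).
      by apply: L2r_le (Lh n) => [|x _]; [apply: measurableT_comp => //; case: (Lh n)|rewrite normr_id].
    have bn0 : 0 < (b n)^-1 by rewrite invr_gt0.
    apply: (le_trans (ler_norm _)); apply: (le_trans (ip_young bn0 Lah LD)).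
    rewrite invrK; have -> : nsq (fun x => `|h n x|) = nsq (h n).
      by apply: eq_Rint => x _; rewrite -expr2 real_normK ?num_real// expr2.
    have : (b n)^-1 * nsq (h n) <= M * b n.
      rewrite mulrC ler_pdivrMr// (le_trans (hM n))// -mulrA.
      suff -> : 4^-1 ^+ n = b n * b n :> R by [].
      by rewrite /b -exprMn; congr (_ ^+ _); field.
    lra.
  have fin : (\int[mu]_(x in D) (\big[+%E/0%R]_(0 <= n <oo) `|h n x|%:E) < +oo)%E.
    rewrite integral_nneseries//.
    apply: (@le_lt_trans _ _ ((M + nsq (\1_D)) / 2 * 2)%:E); last exact: ltry.
    apply: lime_le.
      by apply: is_cvg_nneseries => n _ _; exact: integral_ge0.
    apply: nearW => N.
    apply: (@le_trans _ _ (\sum_(0 <= n < N) ((M + nsq (\1_D)) / 2 * b n)%:E)%E).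
      by apply: lee_sum => n _; exact: bound.
    rewrite sumEFin lee_fin -mulr_sumr ler_wpM2l//.
    rewrite divr_ge0// addr_ge0// ?nsq_ge0//.
    by have := hM 0%N; rewrite expr0 mulr1; apply: le_trans; exact: nsq_ge0.
  have mS : measurable_fun (D : set (measurableTypeR R)) (fun x => \big[+%E/0%R]_(0 <= n <oo) `|h n x|%:E)%E.
    exact: ge0_emeasurable_sum.
  have fi : mu.-integrable (D : set (measurableTypeR R)) (fun x => \big[+%E/0%R]_(0 <= n <oo) `|h n x|%:E)%E.
    apply/integrableP; split=> //.
    under eq_integral => x _ do rewrite gee0_abs ?nneseries_ge0//.
    exact: fin.
  have := integrable_ae mD fi; apply: ae_imp => x /[apply] Sx.
  apply: normed_cvg.
  apply: nondecreasing_is_cvgn.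
    by apply/nondecreasing_seqP => n; rewrite /normed_series_of !seriesEnat/= big_nat_recr//= lerDl.
  exists (fine (\big[+%E/0%R]_(0 <= n <oo) `|h n x|%:E)%E) => _ [n _ <-].
  rewrite -lee_fin fineK// /series/= -sumEFin.
  exact: nneseries_lim_ge.
have := ae_foralln HK; apply: ae_imp => x H; rewrite halflineE => x0.
apply: (H (Num.truncn x).+1) => /=; rewrite in_itv/= x0/=.
by apply/ltW/Num.Theory.truncnS_gt.
Qed.

(** Completeness for sequences with a geometric Cauchy rate: the telescoping
    series converges almost everywhere, and Fatou's lemma transfers the rate to
    the limit. *)
Lemma L2_complete (f : nat -> R -> R) :
  (forall n, L2r (f n)) ->
  (forall n m, (n <= m)%N -> nsq (fun x => f n x - f m x) <= 4^-1 ^+ n) ->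
  exists2 g, L2r g & forall n, nsq (fun x => f n x - g x) <= 4^-1 ^+ n.
Proof.
move=> Lf fC.
have LB n m : L2r (fun x => f n x - f m x) by exact: L2rB.
have AE : {ae mu, forall x, hl x -> cvgn (fun n => f n x)}.
  have := @ae_cvg_of_sum (fun n x => f n x - f n.+1 x) 1 (fun n => LB n n.+1).
  have H n : nsq (fun x => f n x - f n.+1 x) <= 1 * 4^-1 ^+ n by rewrite mul1r fC.
  move=> /(_ H); apply: ae_imp => x /[apply] Hc.
  have : cvgn (fun n => f 0 x - \sum_(0 <= k < n) (f k x - f k.+1 x)).
    by apply: is_cvgB => //; exact: is_cvg_cst.
  suff -> : (fun n => f 0%N x - \sum_(0 <= k < n) (f k x - f k.+1 x)) =
    (fun n => f n x) by [].
  apply/funext => n /=.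
  elim: n => [|n IH].
    by rewrite big_geq// subr0.
  rewrite big_nat_recr//=.
  rewrite opprD addrA IH.
  ring.
have [N [mN N0 AEN]] := AE.
(* Set the sequence to 0 on the exceptional null set, so that the pointwise
   limit is measurable. *)
pose f' n := f n \_ (~` N).
have mf' n : measurable_fun (hl : set (measurableTypeR R)) (f' n).
  apply/measurable_restrict => //; first exact: measurableC.
  by apply: measurable_funS (Lf n).1.
have cf' x : hl x -> cvgn (f'^~ x).
  move=> hx; rewrite /f'; case: (pselect (N x)) => Nx.
    under eq_fun do rewrite patchE memNset//=.
    exact: is_cvg_cst.
  under eq_fun do rewrite patchE mem_set//=.
  have := Nx; apply: contra_notP => nc; apply: AEN => /= /(_ hx); exact: nc.
pose g x := limn (f'^~ x).
have mg : measurable_fun (hl : set (measurableTypeR R)) g.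
  by apply: (measurable_fun_cvg mf') => x hx; exact: cf'.
have aeg : {ae mu, forall x, hl x -> f n x @[n --> \oo] --> g x}.
  exists N; split=> // x /= H; apply: contrapT => Nx; apply: H => hx.
  have := cf' x hx; rewrite /g /f'.
  by under eq_fun do rewrite patchE mem_set//=.
have [Lg _] : L2r g /\ nsq g <= 2 * nsq (f 0%N) + 2.
  apply: (@nsq_fatou f) => //; apply: nearW => n.
  have := nsqD_le (Lf 0%N) (LB n 0%N).
  under [X in nsq X]eq_fun do rewrite addrC subrK.
  move=> /le_trans; apply; rewrite lerD2l -[leRHS]mulr1 ler_pM2l//.
  have := fC 0%N n (leq0n n); rewrite expr0.
  by rewrite (_ : nsq (fun x => f 0%N x - f n x) = nsq (fun x => f n x - f 0%N x))//;
    apply: eq_Rint => x _; ring.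
exists g => // n.
apply: (proj2 (@nsq_fatou (fun m x => f n x - f m x) _ _ (LB n) _ _ _)).
- by apply: measurable_funB; [case: (Lf n)|].
- apply: ae_imp aeg => x fg hx; apply: cvgB; [exact: cvg_cst|exact: fg].
- by near=> m; apply: fC; near: m; exact: nbhs_infty_ge.
Unshelve. all: by end_near. Qed.

(** Lets a bound that improves geometrically be read as an equality with 0. *)
Lemma le0_geom (x K : R) : (forall n, x <= 2^-1 ^+ n * K) -> x <= 0.
Proof.
move=> H; have c : (2^-1 ^+ n * K) @[n --> \oo] --> (0 * K : R).
  by apply: cvgM; [apply: cvg_expr; rewrite ger0_norm// invf_lt1// ltr1n|exact: cvg_cst].
rewrite mul0r in c; apply: (@ler_cvg_to _ _ _ _ (fun=> x) _ _ _ _ c).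
  exact: cvg_cst.
exact: nearW.
Qed.

Lemma parallelogram f g h : L2r f -> L2r g -> L2r h ->
  nsq (fun x => g x - h x) = 2 * nsq (fun x => f x - g x) +
   2 * nsq (fun x => f x - h x) -
   4 * nsq (fun x => f x - (2^-1 * g x + 2^-1 * h x)).
Proof.
move=> Lf Lg Lh; have Lg2 := L2rZ 2^-1 Lg; have Lh2 := L2rZ 2^-1 Lh.
rewrite !nsqB//; last exact: L2rD.
have -> : ip f (fun x => 2^-1 * g x + 2^-1 * h x) = 2^-1 * ip f g + 2^-1 * ip f h.
  by rewrite ipDr// !ipZr.
by rewrite nsqD// !nsqZ// ipZl// ipZr//; field.
Qed.

(** Orthogonal projection of (f, g) onto a closed subspace S of L^2 x L^2.  A
    minimising sequence is Cauchy by the parallelogram identity; orthogonality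
    follows by moving the minimiser by multiples t of an element of S with t^2
    = 4^-n. *)
Lemma real_projection (S : set ((R -> R) * (R -> R))) :
  (forall p, S p -> L2r p.1 /\ L2r p.2) -> S (fun=> 0, fun=> 0) ->
  (forall c p q, S p -> S q ->
    S (fun x => c * p.1 x + q.1 x, fun x => c * p.2 x + q.2 x)) ->
  (forall f g, L2r f -> L2r g ->
    (forall e, 0 < e -> exists q, [/\ S q, nsq (fun x => f x - q.1 x) < e &
       nsq (fun x => g x - q.2 x) < e]) -> S (f, g)) ->
  forall f g, L2r f -> L2r g -> exists2 p, S p &
    forall q, S q -> ip (fun x => f x - p.1 x) q.1 + ip (fun x => g x - p.2 x) q.2 = 0.
Proof.
move=> SL S0 Slin Scl f g Lf Lg.
pose N (q : (R -> R) * (R -> R)) := nsq (fun x => f x - q.1 x) + nsq (fun x => g x - q.2 x).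
pose E := [set N q | q in S].
have N0 q : 0 <= N q by rewrite addr_ge0// nsq_ge0.
have Einf : has_inf E.
  split; first by exists (N (fun=> 0, fun=> 0)); exists (fun=> 0, fun=> 0).
  by exists 0 => _ [q _ <-].
pose d := inf E.
have dN q : S q -> d <= N q by move=> Sq; apply: ge_inf; [case: Einf|exists q].
have /choice[q Hq] (n : nat) : exists q, S q /\ N q < d + 4^-1 ^+ n.+1.
  have [|_ [q Sq <-] Hq] := @inf_adherent _ E (4^-1 ^+ n.+1) _ Einf.
    by rewrite exprn_gt0.
  by exists q.
have Sq n : S (q n) by case: (Hq n).
have Nq n : N (q n) < d + 4^-1 ^+ n.+1 by case: (Hq n).
have Lq n : L2r (q n).1 /\ L2r (q n).2 by apply: SL.
have cauchy n m : (n <= m)%N ->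
    nsq (fun x => (q n).1 x - (q m).1 x) + nsq (fun x => (q n).2 x - (q m).2 x) <= 4^-1 ^+ n.
  move=> nm; have [Ln1 Ln2] := Lq n; have [Lm1 Lm2] := Lq m.
  rewrite (parallelogram Lf Ln1 Lm1) (parallelogram Lg Ln2 Lm2).
  have Sm := Slin 2^-1 _ _ (Sq m) S0.
  (* The midpoint of q n and q m is in S, hence at distance at least d from
     (f,g). *)
  have Sn := Slin 2^-1 _ _ (Sq n) Sm.
  have := dN _ Sn; rewrite /N /=.
  under [X in nsq X]eq_fun do rewrite addr0.
  under [X in _ <= _ + nsq X]eq_fun do rewrite addr0.
  have := Nq n; have := Nq m; rewrite /N.
  have : 4^-1 ^+ m.+1 <= 4^-1 ^+ n.+1 :> R.
    by rewrite ler_wiXn2l// invf_le1// ler1n.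
  rewrite !exprS; lra.
have [|l1 Ll1 H1] := @L2_complete (fun n => (q n).1) (fun n => (Lq n).1).
  by move=> n m /cauchy; apply: le_trans; rewrite lerDl nsq_ge0.
have [|l2 Ll2 H2] := @L2_complete (fun n => (q n).2) (fun n => (Lq n).2).
  by move=> n m /cauchy; apply: le_trans; rewrite lerDr nsq_ge0.
exists (l1, l2).
  apply: Scl => // e e0.
  have c : (4^-1 ^+ n : R) @[n --> \oo] --> (0 : R).
    by apply: cvg_expr; rewrite ger0_norm// invf_lt1// ltr1n.
  have : \forall n \near \oo, 4^-1 ^+ n < e by exact: cvgr_lt c _ e0.
  move=> [n _ /(_ n (leqnn n)) ne]; exists (q n); split=> //.
    rewrite (_ : nsq _ = nsq (fun x => (q n).1 x - l1 x)); first exact: le_lt_trans ne.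
    by apply: eq_Rint => x _; ring.
  rewrite (_ : nsq _ = nsq (fun x => (q n).2 x - l2 x)); first exact: le_lt_trans ne.
  by apply: eq_Rint => x _; ring.
move=> s Ss /=; have [Ls1 Ls2] := SL _ Ss.
pose C := nsq s.1 + nsq s.2.
have C0 : 0 <= C by rewrite addr_ge0// nsq_ge0.
have key n (t : R) : t ^+ 2 = 4^-1 ^+ n ->
   2 * t * (ip (fun x => f x - l1 x) s.1 + ip (fun x => g x - l2 x) s.2) <=
    4^-1 ^+ n * (1 + C) + 4^-1 ^+ n * (2 + C).
  move=> t2; have [Ln1 Ln2] := Lq n.
  have := dN _ (Slin t _ _ Ss (Sq n)); have := Nq n; rewrite /N /=.
  have b0 : 0 < 2 ^+ n :> R by rewrite exprn_gt0.
  have bb : 4^-1 ^+ n = (2 ^+ n)^-1 * (2 ^+ n)^-1 :> R.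
    by rewrite -invfM -exprMn exprVn; congr (_ ^+ _)^-1; ring.
  have := ip_young b0 (L2rB Ln1 Ll1) Ls1.
  have := ip_young b0 (L2rB Ln2 Ll2) Ls2.
  have := H1 n; have := H2 n.
  rewrite !ipBl//.
  have E1 (u v : R -> R) z : L2r u -> L2r v -> L2r z ->
     nsq (fun x => u x - (t * v x + z x)) =
     nsq (fun x => u x - z x) - 2 * t * (ip u v - ip z v) + t ^+ 2 * nsq v.
    move=> Lu Lv Lz; have Ltv := L2rZ t Lv.
    rewrite !nsqB//; last exact: L2rD.
    rewrite nsqD// ipDr// nsqZ// ipZr// ipZl// [ip v z]ipC; ring.
  rewrite !E1// t2 => G2 G1 Y2 Y1.
  have T : `|t| = (2 ^+ n)^-1.
    apply/eqP; rewrite -(@eqrXn2 _ 2)// ?invr_ge0 ?exprn_ge0//.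
    by rewrite real_normK ?num_real// t2 bb expr2.
  set b := (2 ^+ n)^-1 in T bb Y1 Y2 *.
  have bpos : 0 < b by rewrite invr_gt0.
  have bE : 2 ^+ n * 4^-1 ^+ n = b :> R by rewrite bb mulrA divff ?mul1r// gt_eqF.
  have Z1 : 2 ^+ n * nsq (fun x => (q n).1 x - l1 x) <= b by rewrite -bE ler_pM2l.
  have Z2 : 2 ^+ n * nsq (fun x => (q n).2 x - l2 x) <= b by rewrite -bE ler_pM2l.
  set X1 := ip (q n).1 s.1 - ip l1 s.1 in Y1 *.
  set X2 := ip (q n).2 s.2 - ip l2 s.2 in Y2 *.
  have W : `|2 * t * (X1 + X2)| <= 4^-1 ^+ n * (2 + C).
    rewrite !normrM T ger0_norm// bb -mulrA.
    have : `|X1 + X2| <= b * (2 + C) / 2.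
      by apply: (le_trans (ler_normD _ _)); rewrite /C; lra.
    by rewrite -(ler_pM2l bpos) -(@ler_pM2l _ 2)// => /le_trans; apply; lra.
  move=> M1 M2; move: W; rewrite ler_norml => /andP[_ W].
  rewrite exprS in M1; rewrite /C in W *.
  have Cn : 0 <= 4^-1 ^+ n :> R by rewrite exprn_ge0.
  have -> : 2 * t * (ip f s.1 - ip l1 s.1 + (ip g s.2 - ip l2 s.2)) =
    2 * t * (ip f s.1 - ip (q n).1 s.1) + 2 * t * (ip g s.2 - ip (q n).2 s.2) +
    2 * t * (X1 + X2) by rewrite /X1 /X2; ring.
  lra.
have b0 n : 0 < 2^-1 ^+ n :> R by rewrite exprn_gt0.
have bb n : (2^-1 ^+ n) ^+ 2 = 4^-1 ^+ n :> R.
  by rewrite exprAC; congr (_ ^+ _); field.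
apply/le_anti/andP; split.
  apply: (@le0_geom _ ((3 + 2 * C) / 2)) => n.
  have := key n _ (bb n); rewrite -bb expr2 -!mulrA => H.
  rewrite -(ler_pM2l (b0 n)); lra.
rewrite -oppr_le0; apply: (@le0_geom _ ((3 + 2 * C) / 2)) => n.
have := key n (- 2^-1 ^+ n); rewrite sqrrN => /(_ (bb n)); rewrite -bb expr2 => H.
rewrite -(ler_pM2l (b0 n)); lra.
Qed.

End L2real.

(** * Smooth functions and the fundamental lemma of the calculus of variations *)

Section Smooth.
Variable R : realType.
Local Notation mu := (@lebesgue_measure R).
Local Notation hl := (@halfline R).
Implicit Types (f g h : R -> R).

(** [derive1] is a total function, so n-fold differentiability on (0,oo) is
    stated along its iterates. *)
Fixpoint Cn (n : nat) f : Prop :=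
  if n is n'.+1 then (forall x, 0 < x -> derivable f x 1) /\ Cn n' (derive1 f)
  else True.

Definition rsmooth f := forall n, Cn n f.

Lemma near_pos (P : R -> Prop) (x : R) : 0 < x -> (forall y, 0 < y -> P y) ->
  \near x, P x.
Proof. by move=> x0 HP; near=> y; apply: HP; near: y; exact: lt_nbhsr.
Unshelve. all: by end_near. Qed.

Lemma eq_derive1 f g (x : R) : 0 < x -> (forall y, 0 < y -> f y = g y) ->
  derive1 f x = derive1 g x.
Proof.
by move=> x0 fg; rewrite !derive1E; apply: near_eq_derive; exact: near_pos.
Qed.

Lemma eq_derivable f g (x : R) : 0 < x -> (forall y, 0 < y -> f y = g y) ->
  derivable f x 1 -> derivable g x 1.
Proof.
by move=> x0 fg; apply: near_eq_derivable; exact: near_pos.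
Qed.

Lemma eq_Cn n f g : (forall x, 0 < x -> f x = g x) -> Cn n f -> Cn n g.
Proof.
elim: n f g => // n IH f g fg [df Cf]; split.
  by move=> x x0; apply: eq_derivable (df x x0).
by apply: IH Cf => x x0; exact: eq_derive1.
Qed.

Lemma CnW n f : Cn n.+1 f -> Cn n f.
Proof.
elim: n f => // n IH f [df Cf]; split=> //; exact: IH.
Qed.

Lemma is_derive_Cn n f g : (forall x : R, 0 < x -> is_derive x 1 f (g x)) ->
  Cn n g -> Cn n.+1 f.
Proof.
move=> fg Cg; split; first by move=> x x0; have [] := fg x x0.
apply: eq_Cn Cg => x x0; rewrite derive1E; by have [_ ->] := fg x x0.
Qed.

Lemma Cn_is_derive n f (x : R) : Cn n.+1 f -> 0 < x -> is_derive x 1 f (derive1 f x).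
Proof. by move=> [df _] x0; split; [exact: df|rewrite derive1E]. Qed.

Lemma CnD n f g : Cn n f -> Cn n g -> Cn n (fun x => f x + g x).
Proof.
elim: n f g => // n IH f g Cf Cg.
apply: (@is_derive_Cn _ _ (fun x => derive1 f x + derive1 g x)).
  by move=> x x0; exact: (is_deriveD (Cn_is_derive Cf x0) (Cn_is_derive Cg x0)).
by apply: IH; [case: Cf|case: Cg].
Qed.

Lemma Cn_cst n c : Cn n (fun=> c).
Proof.
elim: n c => // n IH c; by apply: (@is_derive_Cn _ _ (fun=> 0)) => // x x0.
Qed.

Lemma CnM n f g : Cn n f -> Cn n g -> Cn n (fun x => f x * g x).
Proof.
elim: n f g => // n IH f g Cf Cg.
apply: (@is_derive_Cn _ _ (fun x => f x * derive1 g x + g x * derive1 f x)).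
  move=> x x0.
  exact: (is_deriveM (Cn_is_derive Cf x0) (Cn_is_derive Cg x0)).
by apply: CnD; apply: IH; try exact: CnW; [case: Cg|case: Cf].
Qed.

Lemma CnZ n c f : Cn n f -> Cn n (fun x => c * f x).
Proof. by apply: CnM; exact: Cn_cst. Qed.

Lemma Cn_id n : Cn n (fun x : R => x).
Proof.
case: n => // n; apply: (@is_derive_Cn _ _ (fun=> 1)); last exact: Cn_cst.
Qed.

Lemma Cn_comp n f g : (forall x : R, 0 < x -> 0 < g x) -> Cn n f -> Cn n g ->
  Cn n (fun x => f (g x)).
Proof.
move=> g0; elim: n f => // n IH f Cf Cg.
apply: (@is_derive_Cn n (fun x => f (g x)) (fun x => derive1 f (g x) * derive1 g x)).
  move=> x x0.
  apply: (is_derive1_comp (Cn_is_derive Cf (g0 _ x0)) (Cn_is_derive Cg x0)).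
apply: CnM; last by case: Cg.
by apply: IH; [case: Cf|exact: CnW].
Qed.

Lemma Cn_X n k : Cn n (fun x : R => x ^+ k).
Proof.
elim: k => [|k IH]; first exact: (@Cn_cst n 1).
apply: (@eq_Cn _ (fun x => x * x ^+ k)); first by move=> x _; rewrite exprS.
by apply: CnM IH; exact: Cn_id.
Qed.

Lemma Cn_V n : Cn n (fun x : R => x^-1).
Proof.
elim: n => // n IH.
apply: (@is_derive_Cn _ _ (fun x => - (x^-1 * x^-1))).
  move=> x x0; have x1 : x != 0 by rewrite gt_eqF.
  have := @is_deriveV R id x 1 1 x1 (is_derive_id x 1).
  by rewrite /= -invfM -expr2 [_ *: _]mulr1.
apply: (@eq_Cn _ (fun x => -1 * (x^-1 * x^-1))); first by move=> x _; rewrite mulN1r.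
by apply: CnZ; exact: CnM.
Qed.

Lemma rsmooth_cont f : rsmooth f -> cont f.
Proof.
by move=> sf; apply: is_derive_cont => x x0; exact: (Cn_is_derive (sf 1%N) x0).
Qed.
Lemma rsmooth_derive f : rsmooth f -> rsmooth (derive1 f).
Proof. by move=> sf n; have [] := sf n.+1. Qed.
Lemma rsmooth_is_derive f (x : R) : rsmooth f -> 0 < x -> is_derive x 1 f (derive1 f x).
Proof. by move=> sf; exact: (Cn_is_derive (sf 1%N)). Qed.
Lemma is_derive_rsmooth f g : (forall x : R, 0 < x -> is_derive x 1 f (g x)) ->
  rsmooth g -> rsmooth f.
Proof. by move=> fg sg [//|n]; apply: is_derive_Cn fg (sg n). Qed.
Lemma eq_rsmooth f g : (forall x, 0 < x -> f x = g x) -> rsmooth f -> rsmooth g.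
Proof. by move=> fg sf n; apply: eq_Cn fg (sf n). Qed.
Lemma rsmoothD f g : rsmooth f -> rsmooth g -> rsmooth (fun x => f x + g x).
Proof. by move=> sf sg n; exact: CnD. Qed.
Lemma rsmoothM f g : rsmooth f -> rsmooth g -> rsmooth (fun x => f x * g x).
Proof. by move=> sf sg n; exact: CnM. Qed.
Lemma rsmoothZ c f : rsmooth f -> rsmooth (fun x => c * f x).
Proof. by move=> sf n; exact: CnZ. Qed.
Lemma rsmoothB f g : rsmooth f -> rsmooth g -> rsmooth (fun x => f x - g x).
Proof.
move=> sf sg; apply: eq_rsmooth (rsmoothD sf (rsmoothZ (-1) sg)) => x _.
by rewrite mulN1r.
Qed.

Lemma rsmooth_iter f n (x : R) : rsmooth f -> 0 < x -> derivable (iter n (@derive1 R R) f) x 1.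
Proof.
elim: n f => [|n IH] f sf x0; first by have [/(_ x x0)] := sf 1%N.
by rewrite iterSr; apply: IH => //; exact: rsmooth_derive.
Qed.

Lemma iter_rsmooth f :
  (forall n (x : R), 0 < x -> derivable (iter n (@derive1 R R) f) x 1) -> rsmooth f.
Proof.
move=> H n; elim: n f H => // n IH f H; split; first exact: (H 0%N).
by apply: IH => k x x0; rewrite -iterSr; exact: H.
Qed.

(** Real test functions of (0,oo), in the shape of the real and imaginary parts
    of the complex ones. *)
Definition rtest f := rsmooth f /\
  exists a b : R, 0 < a /\ forall x, ~ (a <= x <= b) -> f x = 0.

Lemma rtest0 : rtest (fun=> 0).
Proof. by split; [move=> n; exact: Cn_cst|exists 1, 1]. Qed.

Lemma rtest_lin c f g : rtest f -> rtest g -> rtest (fun x => c * f x + g x).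
Proof.
move=> [sf [a [b [a0 f0]]]] [sg [a' [b' [a0' g0]]]]; split.
  by apply: rsmoothD => //; exact: rsmoothZ.
exists (Num.min a a'), (Num.max b b'); split; first by rewrite lt_min a0.
move=> x; rewrite ge_min le_max => H.
rewrite f0 ?g0 ?mulr0 ?addr0// => /andP[H1 H2]; apply: H; rewrite H1 H2 ?orbT//.
Qed.

Lemma rtest_meas f : rtest f -> measurable_fun (hl : set (measurableTypeR R)) f.
Proof. by move=> [/rsmooth_cont/cont_meas]. Qed.

Lemma integ_supp (p : R -> R) (a b : R) : 0 < a -> locint p ->
  measurable_fun (hl : set (measurableTypeR R)) p ->
  (forall x, 0 < x -> ~ (a <= x <= b) -> p x = 0) -> integ hl p.
Proof.
move=> a0 pl mp p0.
have sub : `[a, b]%classic `<=` hl.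
  by move=> x; rewrite halflineE /= in_itv/= => /andP[ax _]; lra.
have mI : measurable ([set` `[a, b]] : set (measurableTypeR R)) by exact: measurable_itv.
have := pl a b a0 => /(integ_patch mI) /(@integS _ setT hl) => /(_ measurableT (@measurable_halfline R) (@subsetT _ _)).
apply: eq_integ => // x; rewrite halflineE => x0; rewrite patchE; case: ifPn => // /negP xI.
by rewrite p0//; move=> H; apply: xI; rewrite inE/= in_itv.
Qed.

Lemma Rint_supp (p : R -> R) (a b : R) : 0 < a ->
  (forall x, 0 < x -> ~ (a <= x <= b) -> p x = 0) ->
  \int[mu]_(x in hl) p x = \int[mu]_(x in `[a, b]) p x.
Proof.
move=> a0 p0; rewrite Rintegral_mkcond [RHS]Rintegral_mkcond.
apply: eq_Rint => x _; rewrite !patchE.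
case: ifPn => [|/negP xh]; first rewrite in_setE halflineE.
  move=> x0; case: ifPn => // /negP xI; apply: p0 => // H; apply: xI.
  by rewrite inE/= in_itv.
case: ifPn => //; rewrite inE/= in_itv/= => /andP[ax _]; exfalso; apply: xh.
by rewrite in_setE halflineE; lra.
Qed.

Lemma rtest_L2 f : rtest f -> L2r f.
Proof.
move=> tf; have [sf [a [b [a0 f0]]]] := tf; split; first exact: rtest_meas.
apply: (@integ_supp _ a b) => //.
- by apply: cont_locint; apply: rsmooth_cont => n; apply: CnM; exact: sf.
- by apply: measurable_funX; exact: rtest_meas.
- by move=> x _ /f0 ->; rewrite expr0n.
Qed.

Section CalcVar.
Variable s : R -> R.
Hypothesis s_smooth : rsmooth s.
Hypothesis s1 : forall x, 0 < x <= 1 -> s x = 1.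
Hypothesis s2 : forall x, 2 <= x -> s x = 0.

Lemma cutoff_bounded : exists2 C : R, 1 <= C & forall x, 0 < x -> `|s x| <= C.
Proof.
have [M M0 sM] := cont_bounded 2 ltr01 (rsmooth_cont s_smooth).
exists (M + 1); first by rewrite lerDr.
move=> x x0; have [x1|/ltW x1] := leP x 1.
  by rewrite s1 ?x0// normr1 lerDr.
have [x2|/ltW x2] := leP x 2; last by rewrite s2// normr0 addr_ge0.
by apply: (le_trans (sM _ _)); [rewrite x1|rewrite lerDl].
Qed.

(** A smooth approximation of the indicator of (a,b], made from powers of the
    argument of one given cutoff s so that no other smooth function has to be
    constructed. *)
Definition bump (a b : R) (n : nat) (x : R) :=
  if 0 < x then s ((x / b) ^+ n.+1) - s ((x / a) ^+ n.+1) else 0.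

Lemma pow_le1 (y : R) n : 0 < y <= 1 -> s (y ^+ n) = 1.
Proof.
by move=> /andP[y0 y1]; rewrite s1// exprn_gt0//= exprn_ile1// ltW.
Qed.

Lemma bump_out (a b x : R) n : 0 < a -> a < b -> ~ (a <= x <= 2 * b) -> bump a b n x = 0.
Proof.
move=> a0 ab H; rewrite /bump; case: ifPn => // x0.
have b0 : 0 < b by lra.
have [xa|ax] := ltP x a.
  have xb : x <= b by lra.
  by rewrite !pow_le1 ?subrr// divr_gt0//= ler_pdivrMr// mul1r// ltW.
have bx : 2 * b < x by rewrite ltNge; apply/negP => xb; apply: H; rewrite ax.
rewrite !s2 ?subrr//.
  have h : 2 <= x / a by rewrite ler_pdivlMr//; lra.
  by apply: (le_trans h); rewrite -[leLHS]expr1 ler_weXn2l//; lra.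
have h : 2 <= x / b by rewrite ler_pdivlMr//; lra.
by apply: (le_trans h); rewrite -[leLHS]expr1 ler_weXn2l//; lra.
Qed.

Lemma bump_rtest (a b : R) n : 0 < a -> a < b -> rtest (bump a b n).
Proof.
move=> a0 ab; split; last first.
  by exists a, (2 * b); split=> // x; exact: bump_out.
apply: (@eq_rsmooth (fun x => s ((x / b) ^+ n.+1) - s ((x / a) ^+ n.+1))).
  by move=> x x0; rewrite /bump x0.
have H (c : R) : 0 < c -> rsmooth (fun x => s ((x / c) ^+ n.+1)).
  move=> c0 k; apply: (@Cn_comp k s (fun x => (x / c) ^+ n.+1)) => //.
    by move=> x x0; rewrite exprn_gt0// divr_gt0.
  apply: (@Cn_comp k (fun x => x ^+ n.+1) (fun x => x / c)).
  - by move=> x x0; rewrite divr_gt0.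
  - exact: Cn_X.
  - apply: (@eq_Cn _ (fun x => c^-1 * x)); first by move=> x _; rewrite mulrC.
    by apply: CnZ; exact: Cn_id.
by apply: rsmoothB; apply: H; lra.
Qed.

(** If x <= c all powers of x/c stay in (0,1], where s is 1; otherwise they
    leave (0,2), beyond which s is 0. *)
Lemma pow_cvg (x c : R) : 0 < x -> 0 < c ->
  \forall n \near \oo, s ((x / c) ^+ n.+1) = if x <= c then 1 else 0.
Proof.
move=> x0 c0; have [xc|cx] := leP x c.
  by apply: nearW => n; rewrite pow_le1// divr_gt0//= ler_pdivrMr// mul1r.
have h : `|c / x| < 1 by rewrite ger0_norm ?divr_ge0 ?ltW// ltr_pdivrMr// mul1r.
have H : \forall n \near \oo, (c / x) ^+ n < 2^-1.
  by apply: cvgr_lt (cvg_expr h) _ _; rewrite invr_gt0.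
apply: filterS H => n H; rewrite s2// exprS.
have E : x / c = (c / x)^-1 by rewrite invf_div.
have h1 : 1 <= x / c by rewrite ler_pdivlMr// mul1r ltW.
have h2 : 2 <= (x / c) ^+ n.
  rewrite E exprVn -[leLHS]invrK lef_pV2 ?posrE ?invr_gt0//; first exact: ltW.
  by rewrite exprn_gt0// divr_gt0.
by rewrite -[leLHS]mul1r ler_pM.
Qed.

(** Dominated convergence along the bumps, which tend pointwise to the
    indicator of (a,b]. *)
Lemma integral_itv0_of_test k (a b : R) : locint k ->
  measurable_fun (hl : set (measurableTypeR R)) k ->
  (forall psi, rtest psi -> \int[mu]_(x in hl) (k x * psi x) = 0) ->
  0 < a -> a < b -> \int[mu]_(x in `[a, b]) k x = 0.
Proof.
move=> kl mk H a0 ab.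
have b0 : 0 < b by lra.
have [C C1 sC] := cutoff_bounded.
pose I : set R := [set` `[a, 2 * b]].
have mI : measurable (I : set (measurableTypeR R)) by exact: measurable_itv.
have Ihl : I `<=` hl by move=> x; rewrite halflineE /I /= in_itv/= => /andP[ax _]; lra.
have mkI : measurable_fun (I : set (measurableTypeR R)) k by exact: measurable_funS mk.
have [] := @dominated_convergence _ _ _ mu I mI
  (fun n x => (k x * bump a b n x)%:E) (fun x => (k x * \1_[set` `]a, b]] x)%:E)
  (fun x => (2 * C * `|k x|)%:E).
- move=> n; apply/measurable_EFinP/measurable_funM => //.
  by apply: measurable_funS (rtest_meas (bump_rtest n a0 ab)).
- apply/measurable_EFinP/measurable_funM => //.
- apply: aeW => x Ix; apply: cvg_near_cst.
  have x0 : 0 < x by have := Ihl _ Ix; rewrite halflineE.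
  apply: filterS2 (pow_cvg x0 b0) (pow_cvg x0 a0) => n Hb Ha.
  rewrite /bump x0 Hb Ha indicE mem_setE in_itv/=; congr (_ * _)%:E.
  by case: (leP x b) => xb; case: (leP x a) => xa; rewrite ?subrr ?subr0//; lra.
- by apply: (integZ (2 * C)) => //; apply: integ_norm => //; exact: kl.
- apply: aeW => x n Ix /=; rewrite lee_fin normrM mulrC ler_wpM2r//.
  have x0 : 0 < x by have := Ihl _ Ix; rewrite halflineE.
  rewrite /bump x0 (le_trans (ler_normB _ _))// mulr_natl mulr2n lerD// sC// exprn_gt0 ?divr_gt0//.
move=> _ _ Hc.
have E0 n : (\int[mu]_(x in I) (k x * bump a b n x)%:E)%E = 0%E.
  have <- : (\int[mu]_(x in I) (k x * bump a b n x))%:E = 0%E.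
    rewrite -(@Rint_supp (fun x => k x * bump a b n x) a (2 * b))//.
      by rewrite H//; exact: bump_rtest.
    by move=> x x0 Hx; rewrite bump_out// mulr0.
  rewrite /Rintegral fineK//; apply: integrable_fin_num => //.
  apply: (@eq_integ _ _ (fun x => bump a b n x * k x)) => //.
    by move=> x _; rewrite mulrC.
  by apply: locintM => //; apply: rsmooth_cont; case: (bump_rtest n a0 ab).
have : (\int[mu]_(x in I) (k x * \1_[set` `]a, b]] x)%:E)%E = 0%E.
  rewrite -(cvg_lim _ Hc)//; under eq_fun do rewrite E0.
  by apply: cvg_lim => //; exact: cvg_cst.
rewrite -Rintegral_itv_obnd_cbnd; last first.
  by apply: integS (kl a b a0) => //; apply: subset_itvr; rewrite bnd_simp.
move=> HI; rewrite -[RHS]/(fine 0%E) -HI -/(Rintegral _ _ _).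
rewrite Rintegral_mkcond [RHS]Rintegral_mkcond.
apply: eq_Rint => x _; rewrite !patchE indicE mem_setE in_itv/=.
case: (boolP (a < x <= b)) => [/andP[ax xb]|_]; last by rewrite mulr0 if_same.
have -> : x \in I by rewrite in_setE /I /= in_itv/=; apply/andP; split; lra.
by rewrite mulr1.
Qed.

(** Lebesgue differentiation of the vanishing primitive, on an exhaustion of
    (0,oo) by compact intervals. *)
Lemma ae0_of_intervals k : locint k ->
  (forall a b : R, 0 < a -> a < b -> \int[mu]_(x in `[a, b]) k x = 0) ->
  {ae mu, forall x, hl x -> k x = 0}.
Proof.
move=> kl k0.
have HN (n : nat) : {ae mu, forall x, (n.+1%:R^-1 < x < n.+1%:R -> k x = 0)}.
  pose e : R := n.+1%:R^-1; pose N : R := n.+1%:R.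
  have e0 : 0 < e by rewrite invr_gt0.
  pose I : set R := [set` `[e, N]].
  have mI : measurable (I : set (measurableTypeR R)) by exact: measurable_itv.
  pose kI := k \_ I.
  have kIi : integ setT kI by apply: integ_patch => //; exact: kl.
  have kI0 y : \int[mu]_(x in `]-oo, y]) kI x = 0.
    rewrite /kI -Rintegral_mkcondr.
    have -> : [set` `]-oo, y]] `&` I = [set` `[e, Num.min y N]].
      apply/seteqP; split => x; rewrite /I /= !in_itv/= le_min.
        by move=> [-> /andP[-> ->]].
      by move=> /and3P[-> -> ->].
    have [h|h|<-] := ltgtP e (Num.min y N); first exact: k0.
      by rewrite set_itv_ge ?Rintegral_set0// bnd_simp -ltNge.
    by rewrite set_itv1 Rintegral_set1.
  have := @FTC1Ny R kI (fun y => integS measurableT (measurable_itv _) (@subsetT _ _) kIi)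
    (integrable_locally mI (kl e N e0)).
  apply: ae_imp => x [_ Hx] /andP[ex xN].
  have kIx : kI x = k x by rewrite /kI patchE mem_set// /I /= in_itv/= !ltW.
  rewrite -kIx -Hx derive1E.
  have -> : (fun x : R => \int[mu]_(t in `]-oo, x]) kI t) = cst 0.
    by apply/funext => y; rewrite kI0.
  exact: derive_cst.
have := ae_foralln HN; apply: ae_imp => x H; rewrite halflineE => x0.
have [n1 _ n1P] := near_infty_natSinv_lt (PosNum x0).
pose n := maxn n1 (Num.truncn x).
apply: (H n); apply/andP; split; first exact: (n1P n (leq_maxl _ _)).
apply: (lt_le_trans (Num.Theory.truncnS_gt x)).
by rewrite ler_nat ltnS leq_maxr.
Qed.

Lemma fundamental_lemma k : locint k ->
  measurable_fun (hl : set (measurableTypeR R)) k ->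
  (forall psi, rtest psi -> \int[mu]_(x in hl) (k x * psi x) = 0) ->
  eqae k (fun=> 0).
Proof.
by move=> kl mk H; apply: ae0_of_intervals => // a b; exact: integral_itv0_of_test.
Qed.

End CalcVar.
End Smooth.

(** * The differential expression and its weak solutions *)

Section ODE.
Variable R : realType.
Local Notation mu := (@lebesgue_measure R).
Local Notation hl := (@halfline R).
Implicit Types (f g h F G u : R -> R).

Lemma locintN p : locint p -> locint (fun x : R => - p x).
Proof. by move=> pl; apply: eq_locint (locintZ (-1) pl) => x _; rewrite mulN1r. Qed.

(** A primitive does not see a change of the derivative on a null set. *)
Lemma abscont_ae P (p p' : R -> R) : measurable_fun (hl : set (measurableTypeR R)) p' ->
  eqae p p' -> abscont P p -> abscont P p'.
Proof.
move=> mp' pp [pl PE].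
have sub (a b : R) : 0 < a -> `[a, b]%classic `<=` hl.
  by move=> a0 x; rewrite halflineE /= in_itv/= => /andP[ax _]; lra.
have mp'ab (a b : R) : 0 < a -> measurable_fun (`[a, b]%classic : set (measurableTypeR R)) p'.
  by move=> a0; apply: measurable_funS mp' => //; exact: sub.
have aeab (a b : R) : 0 < a -> {ae mu, forall x, `[a, b]%classic x -> p x = p' x}.
  by move=> a0; apply: ae_imp pp => x H /(sub _ _ a0); exact: H.
split.
  move=> a b a0; apply/integrableP; split; first by apply/measurable_EFinP; exact: mp'ab.
  rewrite (@ae_eq_integral _ _ _ mu _ (fun x => `|p x|%:E)%E)//.
  - by case/integrableP: (pl a b a0).
  - by apply/measurable_EFinP; apply: measurableT_comp => //; exact: mp'ab.
  - by apply/measurable_EFinP; apply: measurableT_comp => //; apply: integ_meas; exact: pl.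
  - by apply: ae_imp (aeab a b a0) => x H hx /=; rewrite H.
move=> a b a0 ab; rewrite PE//; apply: ae_Rint => //.
- apply: integ_meas; exact: pl.
- exact: mp'ab.
- exact: aeab.
Qed.

(** The zero function is a primitive of F - G, and a primitive of a continuous
    function is differentiable at every point. *)
Lemma eqae_cont F G : cont F -> cont G -> eqae F G -> forall x, 0 < x -> F x = G x.
Proof.
move=> cF cG FG x x0.
have ck : cont (fun x => F x - G x) by move=> y y0; apply: cvgB; [exact: cF|exact: cG].
have A0 : abscont (fun=> 0) (fun x => F x - G x).
  apply: abscont_ae (abscont_cst 0); first exact: cont_meas.
  by apply: ae_imp FG => y H hy; rewrite H// subrr.
have := abscont_derive A0 x0 (ck x x0).
move=> [_]; rewrite derive_cst => /esym/eqP; rewrite subr_eq0 => /eqP//.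
Qed.

Variable kappa : R.
(** The potential of L_m, with kappa = m^2. *)
Definition V (x : R) : R := (kappa - 4^-1) * x ^- 2.
Definition Lr f (x : R) := - derive1 (derive1 f) x + (kappa - 4^-1) * x ^- 2 * f x.

Lemma V_smooth : rsmooth V.
Proof.
move=> n; apply: CnZ; apply: (@eq_Cn _ _ (fun x => x^-1 * x^-1)).
  by move=> x _; rewrite -invfM.
by apply: CnM; exact: Cn_V.
Qed.

Lemma V_cont : cont V. Proof. exact: rsmooth_cont V_smooth. Qed.

(** L F = g as a first order system for (F, F'), with F' absolutely continuous.
    *)
Definition sol F F1 g := abscont F F1 /\ abscont F1 (fun x => V x * F x - g x).

Lemma sol_lin c F F1 g G G1 h : sol F F1 g -> sol G G1 h ->
  sol (fun x => c * F x + G x) (fun x => c * F1 x + G1 x)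
      (fun x => c * g x + h x).
Proof.
move=> [F_ F1_] [G_ G1_]; split; first by apply: abscontD => //; exact: abscontZ.
apply: eq_abscont (abscontD (abscontZ c F1_) G1_) => // x _ /=; ring.
Qed.

Lemma sol_cont F F1 g : sol F F1 g -> cont F /\ cont F1.
Proof. by move=> [/abscont_cont ? /abscont_cont]. Qed.

Lemma sol_is_derive F F1 g (x : R) : sol F F1 g -> 0 < x -> is_derive x 1 F (F1 x).
Proof. by move=> [AF /abscont_cont cF1] x0; apply: abscont_derive => //; exact: cF1. Qed.

(** The Wronskian, with the derivatives passed explicitly. *)
Definition wr (F F1 G G1 : R -> R) (x : R) := F x * G1 x - F1 x * G x.

(** The potential cancels in the derivative of the Wronskian. *)
Lemma lagrange_identity F F1 g G G1 h : sol F F1 g -> sol G G1 h ->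
  abscont (wr F F1 G G1) (fun x => g x * G x - h x * F x).
Proof.
move=> [F_ F1_] [G_ G1_].
apply: eq_abscont (abscontB (abscontM F_ G1_) (abscontM F1_ G_)) => // x _ /=; ring.
Qed.

Lemma smooth_sol f : rsmooth f -> sol f (derive1 f) (Lr f).
Proof.
move=> sf; have sf1 := rsmooth_derive sf; have sf2 := rsmooth_derive sf1.
split; first by apply: derive_abscont; [move=> x; exact: rsmooth_is_derive|exact: rsmooth_cont].
apply: (@eq_abscont _ (derive1 f) (derive1 (derive1 f))) => //.
  by move=> x _; rewrite /Lr /V; ring.
by apply: derive_abscont; [move=> x; exact: rsmooth_is_derive|exact: rsmooth_cont].
Qed.

Lemma derive1_supp f (a b : R) : (forall x, ~ (a <= x <= b) -> f x = 0) ->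
  forall x, ~ (a <= x <= b) -> derive1 f x = 0.
Proof.
move=> f0 x xab; rewrite derive1E.
rewrite (@near_eq_derive _ _ _ f (cst 0)); first exact: derive_cst.
have [xa|ax] := ltP x a.
  near=> y; rewrite f0//= => /andP[ay _].
  have : y < a by near: y; exact: lt_nbhsl.
  by rewrite ltNge ay.
have bx : b < x by rewrite ltNge; apply/negP => xb; apply: xab; rewrite ax.
near=> y; rewrite f0//= => /andP[_ yb].
have : b < y by near: y; exact: lt_nbhsr.
by rewrite ltNge yb.
Unshelve. all: by end_near. Qed.

Lemma rtest_derive f : rtest f -> rtest (derive1 f).
Proof.
move=> [sf [a [b [a0 f0]]]]; split; first exact: rsmooth_derive.
by exists a, b; split=> //; exact: derive1_supp.
Qed.

Lemma rtest_mul f g : rsmooth f -> rtest g -> rtest (fun x => f x * g x).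
Proof.
move=> sf [sg [a [b [a0 g0]]]]; split; first exact: rsmoothM.
by exists a, b; split=> // x /g0 ->; rewrite mulr0.
Qed.

Lemma rtest_Lr f : rtest f -> rtest (Lr f).
Proof.
move=> tf; have t2 := rtest_derive (rtest_derive tf).
have := rtest_lin (-1) t2 (rtest_mul V_smooth tf).
by congr rtest; apply/funext => x; rewrite /Lr /V mulN1r.
Qed.

Lemma rtest_bound f : rtest f -> exists a b : R, [/\ 0 < a, a <= b,
  forall x, ~ (a < x < b) -> f x = 0 & forall x, ~ (a < x < b) -> derive1 f x = 0].
Proof.
move=> [sf [a [b [a0 f0]]]]; exists (a / 2), (Num.max a b + 1).
have ab : a <= Num.max a b by rewrite le_max lexx.
split; [lra|lra|move=> x H..].
  apply: f0 => /andP[ax xb]; apply: H.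
  have : x <= Num.max a b by rewrite le_max xb orbT.
  by lra.
apply: (derive1_supp f0) => /andP[ax xb]; apply: H.
have : x <= Num.max a b by rewrite le_max xb orbT.
by lra.
Qed.

(** Integrate the Lagrange identity over an interval at whose ends the test
    function and its derivative vanish. *)
Lemma sol_test F F1 g phi : sol F F1 g -> rtest phi ->
  \int[mu]_(x in hl) (F x * Lr phi x) = \int[mu]_(x in hl) (g x * phi x).
Proof.
move=> sF tphi; have [a [b [a0 ab f0 f1]]] := rtest_bound tphi.
have sphi := smooth_sol tphi.1.
have [gl gE] := lagrange_identity sF sphi.
have := gE a b a0 ab; rewrite /wr !f0 ?f1 ?ltxx ?andbF//.
rewrite !mulr0 !subr0 => /esym E.
have Lphi := rtest_Lr tphi.
have f2 x : 0 < x -> ~ (a <= x <= b) -> Lr phi x = 0.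
  have [t2 f2] : (forall x, ~ (a <= x <= b) -> derive1 phi x = 0) /\
      (forall x, ~ (a <= x <= b) -> phi x = 0).
    split=> y H; [apply: f1|apply: f0] => /andP[H1 H2]; apply: H; lra.
  by move=> x0 H; rewrite /Lr (derive1_supp t2)// f2// mulr0 oppr0 addr0.
have c1 := rsmooth_cont Lphi.1; have c0 := rsmooth_cont tphi.1.
have l1 : locint (fun x => F x * Lr phi x).
  by apply: cont_locint => x x0; apply: cvgM; [exact: (sol_cont sF).1|exact: c1].
have l2 : locint (fun x => g x * phi x).
  apply: eq_locint (locintD gl l1) => x x0; ring.
rewrite (@Rint_supp _ _ a b)//; last first.
  by move=> x x0 H; rewrite f2// mulr0.
rewrite (@Rint_supp _ (fun x => g x * phi x) a b)//; last first.
  move=> x x0 H; rewrite f0 ?mulr0// => /andP[H1 H2]; apply: H; lra.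
apply/esym/eqP; rewrite -subr_eq0 -RintegralB//; [|exact: l2|exact: l1].
rewrite -E; apply/eqP; apply: eq_Rint => x _; ring.
Qed.

(** The graph of the maximal operator on real functions. *)
Definition rLmax f g := [/\ L2r f, L2r g &
  forall phi, rtest phi -> ip f (Lr phi) = ip g phi].

Lemma rLmax_lin c f g f' g' : rLmax f g -> rLmax f' g' ->
  rLmax (fun x => c * f x + f' x) (fun x => c * g x + g' x).
Proof.
move=> [Lf Lg E] [Lf' Lg' E']; split; [by apply: L2rD => //; apply: L2rZ..|].
move=> phi tphi; have Lp := rtest_L2 tphi; have Lq := rtest_L2 (rtest_Lr tphi).
by rewrite !ipDl ?ipZl//; [rewrite E// E'|exact: L2rZ|exact: L2rZ].
Qed.

Lemma rLmax_eqae f g f' g' : rLmax f g -> eqae f f' -> eqae g g' ->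
  L2r f' -> L2r g' -> rLmax f' g'.
Proof.
move=> [Lf Lg E] ff gg Lf' Lg'; split=> // phi tphi.
have Lp := rtest_L2 tphi; have Lq := rtest_L2 (rtest_Lr tphi).
rewrite -(eq_ip ff (eqae_refl _))// -(eq_ip gg (eqae_refl _))//; exact: E.
Qed.

Lemma sol_rLmax F F1 g : sol F F1 g -> L2r F -> L2r g -> rLmax F g.
Proof. by move=> sF LF Lg; split=> // phi; exact: sol_test sF. Qed.

Lemma rLmax0 : rLmax (fun=> 0) (fun=> 0).
Proof.
split; [exact: L2r0|exact: L2r0|move=> phi tphi].
by rewrite /ip; apply: eq_Rint => x _; rewrite !mul0r.
Qed.

Lemma rLmax_test phi : rtest phi -> rLmax phi (Lr phi).
Proof.
move=> tphi; apply: sol_rLmax (smooth_sol tphi.1) _ _; first exact: rtest_L2.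
exact/rtest_L2/rtest_Lr.
Qed.

End ODE.

(** * Fundamental systems and regularity of distributional solutions *)

Section Fund.
Variable R : realType.
Local Notation mu := (@lebesgue_measure R).
Local Notation hl := (@halfline R).
Implicit Types (f g h F G u v : R -> R).

(** A classical solution u of the homogeneous equation and its derivative v. *)
Definition hsol kappa u v := forall x : R, 0 < x ->
  is_derive x 1 u (v x) /\ is_derive x 1 v (V kappa x * u x).

Lemma hsol_smooth kappa u v : hsol kappa u v -> rsmooth u /\ rsmooth v.
Proof.
move=> H; suff HH n : Cn n u /\ Cn n v by split=> n; case: (HH n).
elim: n => // n [Cu Cv]; split;
  [apply: (@is_derive_Cn _ n u v)|apply: (@is_derive_Cn _ n v (fun x => V kappa x * u x))].
- by move=> x x0; case: (H x x0).
- exact: Cv.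
- by move=> x x0; case: (H x x0).
- by apply: CnM => //; exact: V_smooth.
Qed.

Lemma hsol_sol kappa u v : hsol kappa u v -> sol kappa u v (fun=> 0).
Proof.
move=> H; have [su sv] := hsol_smooth H; have cu := rsmooth_cont su; split.
  by apply: derive_abscont; [move=> x /H[]|exact: rsmooth_cont].
apply: (@eq_abscont _ v (fun x => V kappa x * u x)) => //.
  by move=> x _; rewrite subr0.
apply: derive_abscont; first by move=> x /H[].
by move=> x x0; apply: cvgM; [exact: V_cont|exact: cu].
Qed.

(** The height c is kept free because the real part of a complex cutoff is a
    step of height 1 and its imaginary part one of height 0. *)
Definition step (s : R -> R) (c : R) :=
  [/\ rsmooth s, forall x, 0 < x <= 1 -> s x = c & forall x, 2 <= x -> s x = 0].

Lemma step_derive s c (x : R) : step s c -> 0 < x -> ~ (1 <= x <= 2) ->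
  derive1 s x = 0 /\ derive1 (derive1 s) x = 0.
Proof.
move=> [_ s1 s2]; suff H y : 0 < y -> ~ (1 <= y <= 2) -> derive1 s y = 0.
  move=> x0 x12; split; first exact: H.
  rewrite derive1E (@near_eq_derive _ _ _ _ (cst 0)); first exact: derive_cst.
  have [xa|ax] := ltP x 1.
    near=> y; apply: H; first by near: y; exact: lt_nbhsr.
    move=> /andP[ay _]; have : y < 1 by near: y; exact: lt_nbhsl.
    by rewrite ltNge ay.
  have bx : 2 < x by rewrite ltNge; apply/negP => xb; apply: x12; rewrite ax.
  near=> y; apply: H; first by near: y; exact: lt_nbhsr.
  move=> /andP[_ yb]; have : 2 < y by near: y; exact: lt_nbhsr.
  by rewrite ltNge yb.
move=> y0 y12; rewrite derive1E.
have [xa|ax] := ltP y 1.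
  rewrite (@near_eq_derive _ _ _ _ (cst c)); first exact: derive_cst.
  near=> z; apply: s1; apply/andP; split; near: z; first exact: lt_nbhsr.
  exact: lt_le_nbhsl.
rewrite (@near_eq_derive _ _ _ _ (cst 0)); first exact: derive_cst.
have bx : 2 < y by rewrite ltNge; apply/negP => xb; apply: y12; rewrite ax.
near=> z; apply: s2; near: z; exact: lt_le_nbhsr.
Unshelve. all: by end_near. Qed.

Section Cut.
Variables (kappa : R) (u v s : R -> R) (c : R).
Hypothesis hu : hsol kappa u v.
Hypothesis hs : step s c.

(** The solution u cut off near infinity; [cutv] is its derivative and [cutL]
    the result of applying L to it, which involves only derivatives of s and so
    vanishes off [1,2]. *)
Definition cutu (x : R) := s x * u x.
Definition cutv (x : R) := derive1 s x * u x + s x * v x.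
Definition cutL (x : R) := - (derive1 (derive1 s) x * u x + 2 * (derive1 s x * v x)).

Lemma cut_sol : sol kappa cutu cutv cutL.
Proof.
have [ss _ _] := hs; have [AF AG] := hsol_sol hu.
have ds : abscont s (derive1 s).
  apply: derive_abscont; first by move=> x; exact: rsmooth_is_derive.
  exact/rsmooth_cont/rsmooth_derive.
have dds : abscont (derive1 s) (derive1 (derive1 s)).
  apply: derive_abscont; first by move=> x; exact/rsmooth_is_derive/rsmooth_derive.
  exact/rsmooth_cont/rsmooth_derive/rsmooth_derive.
split.
  by apply: eq_abscont (abscontM ds AF) => // x _; rewrite /cutv; ring.
apply: eq_abscont (abscontD (abscontM dds AF) (abscontM ds AG)) => // x _ /=.
by rewrite /cutL /cutu; ring.
Qed.

Lemma cutL_smooth : rsmooth cutL.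
Proof.
have [ss _ _] := hs; have [su sv] := hsol_smooth hu.
have s1 := rsmooth_derive ss; have s2 := rsmooth_derive s1.
apply: (@eq_rsmooth _ (fun x => -1 * (derive1 (derive1 s) x * u x + 2 * (derive1 s x * v x)))).
  by move=> x _; rewrite mulN1r.
by apply: rsmoothZ; apply: rsmoothD; [exact: rsmoothM|apply: rsmoothZ; exact: rsmoothM].
Qed.

Lemma cutL_supp (x : R) : 0 < x -> ~ (1 <= x <= 2) -> cutL x = 0.
Proof.
by move=> x0 x12; have [d1 d2] := step_derive hs x0 x12; rewrite /cutL d1 d2 !mul0r mulr0 addr0 oppr0.
Qed.

Lemma cut_small (x : R) : 0 < x < 1 -> cutu x = c * u x /\ cutv x = c * v x.
Proof.
move=> /andP[x0 x1]; have [d1 _] : derive1 s x = 0 /\ derive1 (derive1 s) x = 0.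
  by apply: (step_derive hs) => // /andP[]; rewrite leNgt x1.
have [_ s1 _] := hs.
by rewrite /cutu /cutv d1 s1 ?x0 ?ltW// mul0r add0r.
Qed.

Lemma cut_large (x : R) : 2 < x -> cutu x = 0 /\ cutv x = 0.
Proof.
move=> x2; have [d1 _] : derive1 s x = 0 /\ derive1 (derive1 s) x = 0.
  by apply: (step_derive hs); [lra|move=> /andP[_]; rewrite leNgt x2].
have [_ _ s2] := hs.
by rewrite /cutu /cutv d1 s2 ?ltW// !mul0r addr0.
Qed.

(** [cutL] made to vanish on the negative axis too, which turns it into a test
    function. *)
Definition cutpsi (x : R) := if 0 < x then cutL x else 0.

Lemma cutpsi_test : rtest cutpsi.
Proof.
split; first by apply: eq_rsmooth cutL_smooth => x x0; rewrite /cutpsi x0.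
exists 1, 2; split=> // x x12; rewrite /cutpsi; case: ifPn => // x0.
exact: cutL_supp.
Qed.

Lemma cutL_L2 : L2r cutL.
Proof.
apply: eq_L2r (rtest_L2 cutpsi_test) => x x0; by rewrite /cutpsi x0.
Qed.

Lemma cutu_L2 : L2r (fun x => \1_[set` `]0, 1]] x * u x) -> L2r cutu.
Proof.
move=> H; have [ss s1 s2] := hs; have [su sv] := hsol_smooth hu.
have cc : cont cutu by exact: rsmooth_cont (rsmoothM ss su).
have mI : measurable ([set` `]1, 2%:R]] : set (measurableTypeR R)) by exact: measurable_itv.
have I12 : L2r (\1_[set` `]1, 2%:R]] : R -> R).
  apply: L2r_indic => //; first exact: mu_itvoc_lty.
  by move=> x; rewrite halflineE /= in_itv/= => /andP[x1 _]; lra.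
have [M M0 uM] := cont_bounded 2 ltr01 cc.
apply: (@L2r_le _ _ (fun x => `|c| * `|\1_[set` `]0, 1]] x * u x| + M * \1_[set` `]1, 2%:R]] x)).
- exact: cont_meas.
- move=> x x0; rewrite [leRHS]ger0_norm; last first.
    by rewrite addr_ge0// mulr_ge0.
  rewrite !indicE !mem_setE !in_itv/= x0/=.
  have [x1|x1] := leP x 1.
    by rewrite mul1r mulr0 addr0 /cutu s1 ?x0// normrM.
  have [x2|x2] := leP x 2; last first.
    by rewrite /cutu s2 ?mul0r ?normr0 ?mulr0 ?addr0// ltW.
  by rewrite mul0r normr0 mulr0 add0r mulr1 uM// (ltW x1).
- apply: L2rD; apply: L2rZ => //.
  by apply: (L2r_le _ _ H) => [|x _]; [apply: measurableT_comp => //; exact: H.1|rewrite normr_id].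
Qed.

Lemma cut_moment F F1 g : sol kappa F F1 g ->
  \int[mu]_(x in `[2^-1, 3]) (g x * cutu x - cutL x * F x) =
  c * wr u v F F1 2^-1.
Proof.
move=> sF; have [_ E] := lagrange_identity sF cut_sol.
rewrite -E; [|lra|lra].
have [a1 a2] := @cut_small 2^-1 ltac:(lra); have [b1 b2] := @cut_large 3 ltac:(lra).
rewrite /wr a1 a2 b1 b2; ring.
Qed.

(** These moments show that the two functions [cutpsi] of a fundamental system
    are dual, up to the Wronskian, to the space of solutions. *)
Lemma cut_moment0 u' v' : hsol kappa u' v' ->
  \int[mu]_(x in hl) (u' x * cutpsi x) = c * wr u' v' u v 2^-1.
Proof.
move=> /hsol_sol hu'; have := cut_moment hu'.
have -> : wr u' v' u v 2^-1 = - wr u v u' v' 2^-1 by rewrite /wr; ring.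
rewrite mulrN => <-.
rewrite (@Rint_supp _ _ 2^-1 3); [|lra|]; last first.
  move=> x x0 H; rewrite /cutpsi x0 cutL_supp ?mulr0// => /andP[? ?]; apply: H; lra.
rewrite -mulN1r -RintegralZl//; last first.
  apply: cont_locint; last lra.
  move=> x x0; apply: cvgB.
    by under eq_fun do rewrite mul0r; rewrite mul0r; exact: cvg_cst.
  apply: cvgM; first exact: (rsmooth_cont cutL_smooth).
  exact: (sol_cont hu').1.
apply: eq_Rint => x /=; rewrite in_itv/= => /andP[x0 _].
have -> : cutpsi x = cutL x by rewrite /cutpsi ifT//; lra.
ring.
Qed.

End Cut.

Section System.
Variables (kappa : R) (u1 v1 u2 v2 s : R -> R) (w : R).
Hypothesis h1 : hsol kappa u1 v1.
Hypothesis h2 : hsol kappa u2 v2.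
Hypothesis hw : forall x, 0 < x -> wr u1 v1 u2 v2 x = w.
Hypothesis w0 : w != 0.
Hypothesis hs : step s 1.

(** The Plucker relation of the 2 x 4 matrix with columns (u1,v1), (u2,v2),
    (F,F'), (G,G'). *)
Lemma plucker F F1 G G1 (x : R) : 0 < x ->
  wr u1 v1 F F1 x * wr u2 v2 G G1 x - wr u1 v1 G G1 x * wr u2 v2 F F1 x =
  w * wr F F1 G G1 x.
Proof. by move=> x0; rewrite -(hw x0) /wr; ring. Qed.

Lemma recover F F1 (x : R) : 0 < x ->
  w * F x = u2 x * wr u1 v1 F F1 x - u1 x * wr u2 v2 F F1 x.
Proof. by move=> x0; rewrite -(hw x0) /wr; ring. Qed.

Lemma wr_abscont u v F F1 g : hsol kappa u v -> sol kappa F F1 g ->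
  abscont (wr u v F F1) (fun x => - (u x * g x)).
Proof.
move=> hu sF; apply: eq_abscont (lagrange_identity (hsol_sol hu) sF) => // x _; ring.
Qed.

(** Lagrange's formula; P1 and P2 are the Wronskians of u1 and u2 with the
    solution. *)
Lemma variation_of_constants P1 P2 g :
  abscont P1 (fun x => - (u1 x * g x)) -> abscont P2 (fun x => - (u2 x * g x)) ->
  sol kappa (fun x => w^-1 * (u2 x * P1 x - u1 x * P2 x))
            (fun x => w^-1 * (v2 x * P1 x - v1 x * P2 x)) g.
Proof.
move=> A1 A2; have [U1 W1] := hsol_sol h1; have [U2 W2] := hsol_sol h2; split.
  by apply: eq_abscont (abscontZ w^-1 (abscontB (abscontM U2 A1) (abscontM U1 A2))) => // x _; ring.
apply: eq_abscont (abscontZ w^-1 (abscontB (abscontM W2 A1) (abscontM W1 A2))) => // x x0 /=.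
rewrite !subr0; have E : w^-1 * (u1 x * v2 x - v1 x * u2 x) = 1.
  by have := hw x0; rewrite /wr => ->; rewrite mulVf.
rewrite -[X in _ = _ - X](mul1r (g x)) -E; ring.
Qed.

Lemma sol_ex g : locint g -> exists F F1, sol kappa F F1 g.
Proof.
move=> gl.
have [su1 _] := hsol_smooth h1; have [su2 _] := hsol_smooth h2.
have [P1 A1] := abscont_ex (locintN (locintM (rsmooth_cont su1) gl)).
have [P2 A2] := abscont_ex (locintN (locintM (rsmooth_cont su2) gl)).
by do 2 eexists; exact: variation_of_constants A1 A2.
Qed.

(** The variation of constants started at the left end of the support solves L
    phi = psi and vanishes to the left of it; the two moment conditions make it
    vanish to the right as well. *)
Lemma test_preimage psi : rtest psi ->
  \int[mu]_(x in hl) (u1 x * psi x) = 0 -> \int[mu]_(x in hl) (u2 x * psi x) = 0 ->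
  exists2 phi, rtest phi & forall x, 0 < x -> Lr kappa phi x = psi x.
Proof.
move=> tpsi m1 m2; have [a [b [a0 ab p0 _]]] := rtest_bound tpsi.
have [su1 _] := hsol_smooth h1; have [su2 _] := hsol_smooth h2.
have prim u : rsmooth u -> \int[mu]_(x in hl) (u x * psi x) = 0 ->
  exists P, [/\ abscont P (fun x => - (u x * psi x)), rsmooth P &
    forall x, 0 < x -> ~ (a < x < b) -> P x = 0].
  move=> su m0.
  have sp : rsmooth (fun x => - (u x * psi x)).
    apply: (@eq_rsmooth _ (fun x => -1 * (u x * psi x))); first by move=> x _; rewrite mulN1r.
    by apply: rsmoothZ; apply: rsmoothM => //; case: tpsi.
  have cp := rsmooth_cont sp.
  have [P AP] := abscont_ex (cont_locint cp).
  have AP' : abscont (fun x => P x - P a) (fun x => - (u x * psi x)).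
    by apply: eq_abscont (abscontB AP (abscont_cst (P a))) => // x _; rewrite subr0.
  exists (fun x => P x - P a); split.
  - exact: AP'.
  - apply: is_derive_rsmooth sp => x x0.
    by apply: (abscont_derive AP' x0); exact: cp.
  - move=> x x0 H; apply/eqP; rewrite subr_eq0; apply/eqP.
    have Z (y z : R) : 0 < y -> y <= z -> z <= a \/ b <= y -> P z = P y.
      move=> y0 yz yzab; apply/eqP; rewrite -subr_eq0 AP.2//.
      rewrite (@eq_Rint _ _ _ (fun=> 0)); first by rewrite Rintegral_cst// mul0r.
      move=> t /=; rewrite in_itv/= => /andP[yt tz]; rewrite p0 ?mulr0 ?oppr0//.
      by move=> /andP[at_ tb]; case: yzab; lra.
    have Pab : P b = P a.
      apply/eqP; rewrite -subr_eq0 AP.2//.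
      have := m0; rewrite (@Rint_supp _ _ a b)//; last first.
        by move=> y y0 Hy; rewrite p0 ?mulr0// => /andP[? ?]; apply: Hy; lra.
      move=> m0'; rewrite (@eq_Rint _ _ _ (fun x => -1 * (u x * psi x))); last first.
        by move=> y _; rewrite mulN1r.
      rewrite RintegralZl ?m0' ?mulr0//.
      apply: cont_locint => //; apply: rsmooth_cont; apply: rsmoothM => //; by case: tpsi.
    have [xa|ax] := leP x a; first by rewrite (Z x a)//; left.
    have bx : b <= x by rewrite leNgt; apply/negP => xb; apply: H; rewrite ax.
    by rewrite -Pab; apply: Z; [lra|lra|right].
have [P1 [A1 sP1 P10]] := prim _ su1 m1.
have [P2 [A2 sP2 P20]] := prim _ su2 m2.
have := variation_of_constants A1 A2; set F := fun x => _; set F1 := fun x => _ => sF.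
have smF : rsmooth F.
  by apply: rsmoothZ; apply: rsmoothB; exact: rsmoothM.
have dF x : 0 < x -> derive1 F x = F1 x.
  by move=> x0; rewrite derive1E; have [_ ->] := sol_is_derive sF x0.
exists (fun x => if 0 < x then F x else 0).
  split; first by apply: eq_rsmooth smF => x ->.
  exists a, b; split=> // x H; case: ifP => // x0.
  by rewrite /F P10 ?P20 ?mulr0 ?subrr ?mulr0// => /andP[? ?]; apply: H; lra.
move=> x x0; rewrite /Lr x0.
have e1 y : 0 < y -> derive1 (fun x => if 0 < x then F x else 0) y = F1 y.
  by move=> y0; rewrite -dF//; apply: eq_derive1 => // z ->.
rewrite (eq_derive1 x0 e1).
have cF2 : {for x, continuous (fun x => V kappa x * F x - psi x)}.
  apply: cvgB; last by apply: rsmooth_cont => //; case: tpsi.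
  by apply: cvgM; [exact: V_cont|exact: (rsmooth_cont smF)].
rewrite derive1E; have [_ ->] := abscont_derive sF.2 x0 cF2.
by rewrite /V; ring.
Qed.

(** Weyl's lemma.  If F0 is some solution of L F0 = g, then k = f - F0
    annihilates L phi for every test function phi.  Any test function becomes
    such an L phi once its components along the solutions are removed by
    [cutpsi], so k is a combination of u1 and u2. *)
Lemma regularity f g : rLmax kappa f g -> exists F F1, sol kappa F F1 g /\ eqae f F.
Proof.
move=> [Lf Lg H].
have [F0 [F01 sF0]] := sol_ex (L2r_locint Lg).
pose k x := f x - F0 x.
have cF0 := (sol_cont sF0).1.
have kl : locint k by apply: locintB; [exact: L2r_locint|exact: cont_locint].
have mk : measurable_fun (hl : set (measurableTypeR R)) k.
  by apply: measurable_funB; [case: Lf|exact: cont_meas].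
have kpsi_int psi : rtest psi -> integ hl (fun x => k x * psi x).
  move=> tpsi; have [a [b [a0 ab p0 _]]] := rtest_bound tpsi.
  apply: (@integ_supp _ _ a b) => //.
  - apply: (@eq_locint _ (fun x => psi x * k x)); first by move=> x _; rewrite mulrC.
    by apply: locintM => //; apply: rsmooth_cont; case: tpsi.
  - by apply: measurable_funM => //; exact: rtest_meas.
  - by move=> x x0 Hx; rewrite p0 ?mulr0// => /andP[? ?]; apply: Hx; lra.
have upsi_int u psi : rsmooth u -> rtest psi -> integ hl (fun x => u x * psi x).
  move=> su tpsi; have [a [b [a0 ab p0 _]]] := rtest_bound tpsi.
  have sp : rsmooth (fun x => u x * psi x) by apply: rsmoothM => //; case: tpsi.
  apply: (@integ_supp _ _ a b) => //.
  - by apply: cont_locint; exact: rsmooth_cont.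
  - by apply: cont_meas; exact: rsmooth_cont.
  - by move=> x x0 Hx; rewrite p0 ?mulr0// => /andP[? ?]; apply: Hx; lra.
have kL phi : rtest phi -> \int[mu]_(x in hl) (k x * Lr kappa phi x) = 0.
  move=> tphi; have tL := rtest_Lr kappa tphi.
  have Lp := rtest_L2 tL.
  have i1 := L2rM Lf Lp; have i0 := kpsi_int _ tL.
  have i2 : integ hl (fun x => F0 x * Lr kappa phi x).
    by apply: eq_integ (integB (@measurable_halfline R) i1 i0) => // x _; rewrite /k; ring.
  rewrite (@eq_Rint _ _ _ (fun x => f x * Lr kappa phi x - F0 x * Lr kappa phi x)); last first.
    by move=> x _; rewrite /k mulrBl.
  rewrite RintegralB// (sol_test sF0 tphi); have := H phi tphi; rewrite /ip => ->.
  by rewrite subrr.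
have [su1 _] := hsol_smooth h1; have [su2 _] := hsol_smooth h2.
pose psi1 := cutpsi u1 v1 s; pose psi2 := cutpsi u2 v2 s.
have t1 : rtest psi1 by exact: cutpsi_test h1 hs.
have t2 : rtest psi2 by exact: cutpsi_test h2 hs.
have half0 : 0 < 2^-1 :> R by rewrite invr_gt0.
have m11 : \int[mu]_(x in hl) (u1 x * psi1 x) = 0.
  by rewrite (cut_moment0 h1 hs h1) /wr; ring.
have m22 : \int[mu]_(x in hl) (u2 x * psi2 x) = 0.
  by rewrite (cut_moment0 h2 hs h2) /wr; ring.
have m12 : \int[mu]_(x in hl) (u1 x * psi2 x) = w.
  by rewrite (cut_moment0 h2 hs h1) hw// mul1r.
have m21 : \int[mu]_(x in hl) (u2 x * psi1 x) = - w.
  by rewrite (cut_moment0 h1 hs h2) -(hw half0) /wr; ring.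
pose K1 := \int[mu]_(x in hl) (k x * psi1 x).
pose K2 := \int[mu]_(x in hl) (k x * psi2 x).
pose k' x := k x - ((K2 / w) * u1 x + (- K1 / w) * u2 x).
have k'0 : eqae k' (fun=> 0).
  have cu : cont (fun x => (K2 / w) * u1 x + (- K1 / w) * u2 x).
    by apply: rsmooth_cont; apply: rsmoothD; apply: rsmoothZ.
  apply: (@fundamental_lemma _ s) => //.
  - by case: hs.
  - by case: hs.
  - by case: hs.
  - by apply: locintB => //; exact: cont_locint.
  - by apply: measurable_funB => //; exact: cont_meas.
  move=> psi tpsi.
  pose a1 := \int[mu]_(x in hl) (u1 x * psi x).
  pose a2 := \int[mu]_(x in hl) (u2 x * psi x).
  (* The corrected test function is orthogonal to u1 and u2, because the
     moments of psi1, psi2 are (0, -w) and (w, 0). *)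
  have tq : rtest (fun x => (- (a1 / w)) * psi2 x + ((a2 / w) * psi1 x + psi x)).
    by apply: rtest_lin => //; exact: rtest_lin.
  have lin (u : R -> R) : (forall psi, rtest psi -> integ hl (fun x => u x * psi x)) ->
     \int[mu]_(x in hl) (u x * ((- (a1 / w)) * psi2 x + ((a2 / w) * psi1 x + psi x))) =
     - (a1 / w) * \int[mu]_(x in hl) (u x * psi2 x) +
     ((a2 / w) * \int[mu]_(x in hl) (u x * psi1 x) + \int[mu]_(x in hl) (u x * psi x)).
    move=> ui.
    rewrite (@eq_Rint _ _ _ (fun x => - (a1 / w) * (u x * psi2 x) +
      ((a2 / w) * (u x * psi1 x) + u x * psi x))); last by move=> x _; ring.
    have i1 := integZ (a2 / w) (@measurable_halfline R) (ui _ t1).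
    have i2 := integZ (- (a1 / w)) (@measurable_halfline R) (ui _ t2).
    have i3 := ui _ tpsi.
    rewrite RintegralD//; last exact: integD.
    by rewrite RintegralD// !RintegralZl//; exact: ui.
  have [|| phi tphi phiE] := test_preimage tq.
  - rewrite lin; last by move=> q; exact: upsi_int.
    by rewrite m12 m11 -/a1; field.
  - rewrite lin; last by move=> q; exact: upsi_int.
    by rewrite m22 m21 -/a2; field.
  have := kL _ tphi; rewrite (@eq_Rint _ _ _ (fun x => k x * ((- (a1 / w)) * psi2 x + ((a2 / w) * psi1 x + psi x)))); last first.
    by move=> x; rewrite halflineE => x0; rewrite phiE.
  rewrite lin// -/K1 -/K2 => E.
  rewrite (@eq_Rint _ _ _ (fun x => k x * psi x - ((K2 / w) * (u1 x * psi x) + (- K1 / w) * (u2 x * psi x)))); last first.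
    by move=> x _; rewrite /k'; ring.
  have i1 := integZ (K2 / w) (@measurable_halfline R) (upsi_int _ _ su1 tpsi).
  have i2 := integZ (- K1 / w) (@measurable_halfline R) (upsi_int _ _ su2 tpsi).
  rewrite RintegralB//; [|exact: kpsi_int|exact: integD].
  rewrite RintegralD// !RintegralZl//; [|exact: upsi_int|exact: upsi_int].
  rewrite -/a1 -/a2 -E; ring.
exists (fun x => (K2 / w) * u1 x + ((- K1 / w) * u2 x + F0 x)).
exists (fun x => (K2 / w) * v1 x + ((- K1 / w) * v2 x + F01 x)).
split.
  have := sol_lin (K2 / w) (hsol_sol h1) (sol_lin (- K1 / w) (hsol_sol h2) sF0).
  by congr sol; apply/funext => x; ring.
apply: ae_imp k'0 => x Hx hx; have := Hx hx; rewrite /k' /k => E.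
by apply/eqP; rewrite -subr_eq0 -E; apply/eqP; ring.
Qed.

End System.
End Fund.

(** * Behaviour at infinity and boundary values at zero *)

Section Bnd.
Variable R : realType.
Local Notation mu := (@lebesgue_measure R).
Local Notation hl := (@halfline R).
Implicit Types (f g h F G u v : R -> R).

(** Young's inequality with weight e on [x,x+1], where the integral of f^2 is
    below e^2 for large x. *)
Lemma tail_abs f : L2r f ->
  (\int[mu]_(t in `[x, x + 1]) `|f t|) @[x --> +oo] --> (0 : R).
Proof.
move=> Lf; have Lfi := L2rM Lf Lf.
have fl := L2r_locint Lf.
have f2l : locint (fun x => f x * f x).
  move=> a b a0; apply: integS Lfi => //.
  by move=> x; rewrite halflineE /= in_itv/= => /andP[ax _]; lra.
have [P AP] := abscont_ex f2l.
have := abscont_cvgy AP (((integ_halfline _).1 Lfi).2).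
set l := (P 1 + _) => Pl.
apply/cvgr0Pnorm_le => e e0.
have /cvgrPdist_le/(_ (e ^+ 2 / 2)) := Pl; rewrite divr_gt0 ?exprn_gt0// => /(_ isT)[M [Mr HM]].
have H1 : \forall x \near +oo, (M : R) < x by exact: nbhs_pinfty_gt.
have H2 : \forall x \near +oo, (0 : R) < x by exact: nbhs_pinfty_gt.
near=> x.
have Mx : M < x by near: x.
have x0 : 0 < x by near: x.
rewrite ger0_norm; last exact: Rintegral_ge0.
have := HM _ Mx; have := HM (x + 1) ltac:(lra).
rewrite !ler_norml => /andP[b1 b2] /andP[b3 b4].
have E := AP.2 x (x + 1) x0 ltac:(lra).
have i1 := fl x (x + 1) x0; have i2 := f2l x (x + 1) x0.
have eV : e^-1 * e = 1 by rewrite mulVf// gt_eqF.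
have ei0 : 0 < e^-1 by rewrite invr_gt0.
apply: (@le_trans _ _ (\int[mu]_(t in `[x, x + 1]) (e / 2 + (e^-1 / 2) * (f t * f t)))).
  apply: le_Rintegral => //.
  - exact: integ_norm.
  - apply: (integD _ _ (integZ _ _ i2)) => //.
    apply: (@integS _ _ _ _ _ _ _ (cont_locint (fun y _ => cvg_cst (e/2)) (x + 1) x0)) => //.
  - move=> t _.
    have : 0 <= e^-1 / 2 * (`|f t| - e) ^+ 2 by rewrite mulr_ge0 ?sqr_ge0// divr_ge0// ltW.
    have -> : f t * f t = `|f t| ^+ 2 by rewrite real_normK ?num_real// expr2.
    have -> : e^-1 / 2 * (`|f t| - e) ^+ 2 = e^-1 / 2 * `|f t| ^+ 2 - (e^-1 * e) * `|f t| + (e^-1 * e) * e / 2 by field; rewrite gt_eqF.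
    by rewrite eV; lra.
rewrite RintegralD//; last 2 first.
- by apply: (cont_locint (fun y _ => cvg_cst (e/2)) (x + 1) x0).
- exact: integZ.
rewrite [X in _ + X]RintegralZl// -E Rintegral_cst//.
have -> : fine (mu `[x, x + 1]) = 1.
  have := @lebesgue_measure_itv R `[x, x + 1]; rewrite /= lte_fin ltrDl ltr01 -EFinD.
  by move=> H; rewrite [mu _]H /=; ring.
have : e^-1 / 2 * (P (x + 1) - P x) <= e^-1 / 2 * (e ^+ 2).
  by rewrite ler_pM2l ?divr_gt0//; lra.
have -> : e^-1 / 2 * e ^+ 2 = (e^-1 * e) * e / 2 by field; rewrite gt_eqF.
by rewrite eV; lra.
Unshelve. all: by end_near. Qed.

Section Tail.
Variables (kappa : R) (F F1 g : R -> R).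
Hypothesis sF : sol kappa F F1 g.

Lemma abscont_id : abscont (fun y : R => y) (fun=> 1).
Proof. by apply: derive_abscont => // x x0; exact: cvg_cst. Qed.

(** Green's formula on [x,x+1] against the cubic q(y-x) with coefficients a, b,
    c, d.  The two equations say that q and q' vanish at 1, so only boundary
    terms at x remain. *)
Lemma tail_weight (a b c d x : R) : 1 <= x ->
  a + b + c + d = 0 -> b + 2 * c + 3 * d = 0 ->
  (forall t, 0 <= t <= 1 -> `|a + b * t + c * t ^+ 2 + d * t ^+ 3| <= 1) ->
  (forall t, 0 <= t <= 1 -> `|2 * c + 6 * d * t| <= 6) ->
  L2r F -> L2r g ->
  `|F x * b - F1 x * a| <= (6 + `|kappa - 4^-1|) *
     (\int[mu]_(t in `[x, x + 1]) `|F t| + \int[mu]_(t in `[x, x + 1]) `|g t|).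
Proof.
move=> x1 q1 q2 bq bq2 LF Lg.
have x0 : 0 < x by lra.
pose t (y : R) := y - x.
have At : abscont t (fun=> 1) by apply: eq_abscont (abscontB abscont_id (abscont_cst x)) => // y _; ring.
pose Q y := a + b * t y + c * t y ^+ 2 + d * t y ^+ 3.
pose Q1 y := b + 2 * c * t y + 3 * d * t y ^+ 2.
pose Q2 y := 2 * c + 6 * d * t y.
have At2 := abscontM At At; have At3 := abscontM At At2.
have AQ : abscont Q Q1.
  apply: eq_abscont (abscontD (abscontD (abscontD (abscont_cst a) (abscontZ b At)) (abscontZ c At2)) (abscontZ d At3)) => y _;
    rewrite /Q /Q1; ring.
have AQ1 : abscont Q1 Q2.
  apply: eq_abscont (abscontD (abscontD (abscont_cst b) (abscontZ (2 * c) At)) (abscontZ (3 * d) At2)) => y _;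
    rewrite /Q1 /Q2; ring.
have [AF AF1] := sF.
have [Il IE] := abscontB (abscontM AF AQ1) (abscontM AF1 AQ).
have := IE x (x + 1) x0 ltac:(lra).
(* The boundary terms at x + 1 vanish. *)
have -> : Q (x + 1) = 0 by rewrite /Q /t -q1; ring.
have -> : Q1 (x + 1) = 0 by rewrite /Q1 /t -q2; ring.
have -> : Q x = a by rewrite /Q /t; ring.
have -> : Q1 x = b by rewrite /Q1 /t; ring.
move=> E; rewrite -normrN.
have -> : - (F x * b - F1 x * a) = F (x + 1) * 0 - F1 (x + 1) * 0 - (F x * b - F1 x * a) by ring.
rewrite E; have Fl := L2r_locint LF; have gl := L2r_locint Lg.
apply: (le_trans (le_normr_Rintegral _ (Il x (x + 1) x0))) => //.
have iF := integ_norm (measurable_itv _) (Fl x (x + 1) x0).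
have ig := integ_norm (measurable_itv _) (gl x (x + 1) x0).
rewrite -RintegralD// -RintegralZl//; last exact: integD.
apply: le_Rintegral => //.
- exact: (integ_norm _ (Il x (x + 1) x0)).
- by apply: integZ => //; exact: integD.
move=> y /=; rewrite in_itv/= => /andP[xy yx].
have -> : F y * Q2 y + Q1 y * F1 y - (F1 y * Q1 y + Q y * (V kappa y * F y - g y)) =
  F y * (Q2 y - Q y * V kappa y) + Q y * g y by ring.
have t01 : 0 <= t y <= 1 by rewrite /t; lra.
have B1 := bq _ t01; have B2 := bq2 _ t01.
have Vb : `|V kappa y| <= `|kappa - 4^-1|.
  rewrite /V normrM -[leRHS]mulr1 ler_wpM2l// ger0_norm.
    by rewrite invf_le1 ?exprn_ege1 ?exprn_gt0//; lra.
  by rewrite invr_ge0 exprn_ge0//; lra.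
apply: (le_trans (ler_normD _ _)); rewrite !normrM mulrDr lerD//.
  rewrite mulrC ler_wpM2r// (le_trans (ler_normB _ _))// lerD// normrM.
  by rewrite -[leRHS]mul1r ler_pM.
rewrite ler_wpM2r// (le_trans B1)//.
by have := normr_ge0 (kappa - 4^-1); lra.
Qed.

(** The cubics t - 2t^2 + t^3 and 1 - 3t^2 + 2t^3 isolate F(x) and F'(x) in
    [tail_weight]. *)
Lemma sol_tail : L2r F -> L2r g ->
  F x @[x --> +oo] --> (0:R) /\ F1 x @[x --> +oo] --> (0:R).
Proof.
move=> LF Lg.
have T : (6 + `|kappa - 4^-1|) *
     (\int[mu]_(t in `[x, x + 1]) `|F t| + \int[mu]_(t in `[x, x + 1]) `|g t|) @[x --> +oo] --> (0 : R).
  rewrite -[X in _ --> X](mulr0 (6 + `|kappa - 4^-1|)); apply: cvgM; first exact: cvg_cst.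
  by rewrite -[X in _ --> X](addr0 0); apply: cvgD; exact: tail_abs.
have H1 : \forall x \near +oo, (1 : R) < x by exact: nbhs_pinfty_gt.
split; apply/cvgr0Pnorm_le => e e0; have /cvgr0Pnorm_le/(_ e e0) He := T;
  apply: filterS2 He H1 => x He x1.
  apply: (le_trans _ (le_trans (ler_norm _) He)).
  have := @tail_weight 0 1 (-2) 1 x (ltW x1) ltac:(ring) ltac:(ring) _ _ LF Lg.
  have -> : F x * 1 - F1 x * 0 = F x by ring.
  apply.
    move=> t /andP[t0 t1]; rewrite ler_norml; apply/andP; split; nra.
  by move=> t /andP[t0 t1]; rewrite ler_norml; apply/andP; split; lra.
apply: (le_trans _ (le_trans (ler_norm _) He)).
have := @tail_weight 1 0 (-3) 2 x (ltW x1) ltac:(ring) ltac:(ring) _ _ LF Lg.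
have -> : F x * 0 - F1 x * 1 = - F1 x by ring.
rewrite normrN; apply.
  move=> t /andP[t0 t1]; rewrite ler_norml; apply/andP; split; nra.
by move=> t /andP[t0 t1]; rewrite ler_norml; apply/andP; split; lra.
Qed.

End Tail.

(** The Lagrange identity integrated over (0,oo); there is no contribution from
    infinity. *)
Lemma green_lim kappa F F1 g G G1 h (l : R) :
  sol kappa F F1 g -> sol kappa G G1 h -> L2r F -> L2r g -> L2r G -> L2r h ->
  wr F F1 G G1 x @[x --> 0^'+] --> l -> ip g G - ip F h = - l.
Proof.
move=> sF sG LF Lg LG Lh wl.
have [F0 F10] := sol_tail sF LF Lg; have [G0 G10] := sol_tail sG LG Lh.
have wy : wr F F1 G G1 x @[x --> +oo] --> (0 : R).
  have : wr F F1 G G1 x @[x --> +oo] --> (0 * 0 - 0 * 0 : R) by apply: cvgB; apply: cvgM.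
  by rewrite !mul0r subr0.
have i1 := L2rM Lg LG; have i2 := L2rM Lh LF.
have := abscont_Rint_halfline (lagrange_identity sF sG) (integB (@measurable_halfline R) i1 i2) wl wy.
rewrite sub0r => <-; rewrite RintegralB// /ip; congr (_ - _).
by apply: eq_Rint => x _; rewrite mulrC.
Qed.

(** Square integrability near 0, the limit circle condition for a solution. *)
Definition L2zero u := L2r (fun x => \1_[set` `]0, 1]] x * u x).

Lemma L2zero_integ u g : L2zero u -> L2r g -> integ `]0, 1] (fun x => u x * g x).
Proof.
move=> Lu Lg; have := L2rM Lu Lg.
have sub : [set` `]0, 1]] `<=` hl by move=> x; rewrite halflineE /= in_itv/= => /andP[].
move=> /(@integS _ _ [set` `]0, 1]] _ (@measurable_halfline R) (measurable_itv _) sub).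
apply: eq_integ => // x /=; rewrite indicE mem_setE in_itv/= => ->.
by rewrite mul1r.
Qed.

(** The derivative of the Wronskian is -u g, which is integrable near 0. *)
Lemma wr_cvg kappa u v F F1 g : hsol kappa u v -> L2zero u -> sol kappa F F1 g -> L2r g ->
  exists l : R, wr u v F F1 x @[x --> 0^'+] --> l.
Proof.
move=> hu Lu sF Lg; eexists; apply: abscont_cvg0 (wr_abscont hu sF) _.
by apply: integN => //; exact: L2zero_integ.
Qed.

Lemma cut_L2 kappa u v s c : hsol kappa u v -> step s c -> L2zero u ->
  L2r (cutu u s) /\ L2r (cutL u v s).
Proof. by move=> hu hs Lu; split; [exact: cutu_L2 hu hs Lu|exact: cutL_L2 hu hs]. Qed.

Lemma near_small_eq (f g : R -> R) (l : R) : (forall x, 0 < x < 1 -> f x = g x) ->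
  f x @[x --> 0^'+] --> l -> g x @[x --> 0^'+] --> l.
Proof.
move=> fg; apply: cvg_trans; apply: near_eq_cvg; near=> x.
by apply/fg/andP; split; near: x; [exact: nbhs_right_gt|exact: nbhs_right_lt].
Unshelve. all: by end_near. Qed.

(** The boundary value of (f, g) at u, written as an integral so that it is
    defined and continuous on all of L^2 x L^2; [bv_lim] identifies it with c
    lim W(u,F). *)
Definition bv u v s f g := ip g (cutu u s) - ip f (cutL u v s).

Lemma bv_lim kappa u v s c F F1 g (l : R) : hsol kappa u v -> step s c -> L2zero u ->
  sol kappa F F1 g -> L2r F -> L2r g -> wr u v F F1 x @[x --> 0^'+] --> l ->
  bv u v s F g = c * l.
Proof.
move=> hu hs Lu sF LF Lg wl; have [L1 L2] := cut_L2 hu hs Lu.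
rewrite /bv (@green_lim kappa F F1 g (cutu u s) (cutv u v s) (cutL u v s) (- (c * l)))// ?opprK//.
  exact: cut_sol hu hs.
have : - (c * wr u v F F1 x) @[x --> 0^'+] --> - (c * l).
  by apply: cvgN; apply: cvgM wl; exact: cvg_cst.
apply: near_small_eq => x x01; rewrite /wr.
by have [-> ->] := cut_small u v hs x01; ring.
Qed.

Lemma bv_lin kappa u v s c0 c f g f' g' : hsol kappa u v -> step s c0 -> L2zero u ->
  L2r f -> L2r g -> L2r f' -> L2r g' ->
  bv u v s (fun x => c * f x + f' x) (fun x => c * g x + g' x) =
  c * bv u v s f g + bv u v s f' g'.
Proof.
move=> hu hs Lu Lf Lg Lf' Lg'; have [L1 L2] := cut_L2 hu hs Lu.
have Z1 := L2rZ c Lf; have Z2 := L2rZ c Lg.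
by rewrite /bv !ipDl// !ipZl//; ring.
Qed.

Lemma bv_eqae kappa u v s c0 f g f' g' : hsol kappa u v -> step s c0 -> L2zero u ->
  L2r f -> L2r g -> L2r f' -> L2r g' -> eqae f f' -> eqae g g' ->
  bv u v s f g = bv u v s f' g'.
Proof.
move=> hu hs Lu Lf Lg Lf' Lg' ff gg; have [L1 L2] := cut_L2 hu hs Lu.
by rewrite /bv (eq_ip ff (eqae_refl _))// (eq_ip gg (eqae_refl _)).
Qed.

Lemma bv_test kappa u v s c0 phi : hsol kappa u v -> step s c0 -> L2zero u -> rtest phi ->
  bv u v s phi (Lr kappa phi) = 0.
Proof.
move=> hu hs Lu tphi; have := sol_test (cut_sol hu hs) tphi.
rewrite /bv ipC /ip => ->; rewrite [X in X - _](@eq_Rint _ _ _ (fun x => cutL u v s x * phi x))// ?subrr//.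
rewrite [X in _ - X](@eq_Rint _ _ _ (fun x => cutL u v s x * phi x)) ?subrr// => x _.
by rewrite mulrC.
Qed.

End Bnd.

(** * The real minimal operator *)

Section Min.
Variable R : realType.
Local Notation mu := (@lebesgue_measure R).
Local Notation hl := (@halfline R).
Implicit Types (f g h F G u v : R -> R).

Lemma nsq_tri f g h : L2r f -> L2r g -> L2r h ->
  nsq (fun x => f x - h x) <=
  2 * nsq (fun x => f x - g x) + 2 * nsq (fun x => g x - h x).
Proof.
move=> Lf Lg Lh; apply: le_trans (nsqD_le (L2rB Lf Lg) (L2rB Lg Lh)).
rewrite le_eqVlt; apply/orP; left; apply/eqP.
by apply: eq_Rint => x _; ring.
Qed.

(** An identity between inner products that holds on approximants holds in the
    limit. *)
Lemma ip_closed f g p q : L2r f -> L2r g -> L2r p -> L2r q ->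
  (forall e, 0 < e -> exists a b, [/\ L2r a /\ L2r b, nsq (fun x => f x - a x) < e,
     nsq (fun x => g x - b x) < e & ip a p - ip b q = 0]) ->
  ip f p - ip g q = 0.
Proof.
move=> Lf Lg Lp Lq H.
have key n : `|ip f p - ip g q| <= 2^-1 ^+ n * (1 + (nsq p + nsq q) / 2).
  have b0 : 0 < 2 ^+ n :> R by rewrite exprn_gt0.
  have [|a [b [[La Lb] fa gb E]]] := H (4^-1 ^+ n); first by rewrite exprn_gt0.
  have -> : ip f p - ip g q = ip (fun x => f x - a x) p - ip (fun x => g x - b x) q.
    by rewrite !ipBl//; rewrite -[LHS]subr0 -E; ring.
  have Y1 := ip_young b0 (L2rB Lf La) Lp.
  have Y2 := ip_young b0 (L2rB Lg Lb) Lq.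
  have bE : 2 ^+ n * 4^-1 ^+ n = 2^-1 ^+ n :> R.
    by rewrite -exprMn; congr (_ ^+ _); field.
  have bV : (2 ^+ n)^-1 = 2^-1 ^+ n :> R by rewrite exprVn.
  have Z1 : 2 ^+ n * nsq (fun x => f x - a x) <= 2^-1 ^+ n by rewrite -bE ler_pM2l// ltW.
  have Z2 : 2 ^+ n * nsq (fun x => g x - b x) <= 2^-1 ^+ n by rewrite -bE ler_pM2l// ltW.
  apply: (le_trans (ler_normB _ _)); rewrite bV in Y1 Y2; lra.
by apply/eqP; rewrite -normr_le0; apply: le0_geom key.
Qed.

(** Graph closures of subspaces are subspaces. *)
Lemma approx_lin c f g p q d : L2r f -> L2r g -> L2r p -> L2r q ->
  nsq (fun x => f x - p x) < d -> nsq (fun x => g x - q x) < d ->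
  nsq (fun x => c * f x + g x - (c * p x + q x)) < 4 * ((c ^+ 2 + 1) * d).
Proof.
move=> Lf Lg Lp Lq fp gq.
have -> : (fun x => c * f x + g x - (c * p x + q x)) =
  (fun x => c * (f x - p x) + (g x - q x)) by apply/funext => x; ring.
have LB := L2rB Lf Lp; have LB' := L2rB Lg Lq.
apply: (le_lt_trans (nsqD_le (L2rZ c LB) LB')); rewrite nsqZ//.
have d0 : 0 <= d := le_trans (nsq_ge0 _) (ltW fp).
have : c ^+ 2 * nsq (fun x => f x - p x) <= c ^+ 2 * d by rewrite ler_wpM2l ?sqr_ge0// ltW.
have : 0 <= c ^+ 2 * d by rewrite mulr_ge0 ?sqr_ge0.
by rewrite mulrDl mul1r; lra.
Qed.

Section Lmin.
Variable kappa : R.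

(** The closure of L on test functions. *)
Definition rLmin f g := [/\ L2r f, L2r g & forall e, 0 < e -> exists phi,
  [/\ rtest phi, nsq (fun x => f x - phi x) < e & nsq (fun x => g x - Lr kappa phi x) < e]].

Lemma rLmax_closed f g : L2r f -> L2r g -> (forall e, 0 < e -> exists a b,
    [/\ rLmax kappa a b, nsq (fun x => f x - a x) < e & nsq (fun x => g x - b x) < e]) ->
  rLmax kappa f g.
Proof.
move=> Lf Lg H; split=> // phi tphi; apply/eqP; rewrite -subr_eq0; apply/eqP.
apply: ip_closed => //; [exact/rtest_L2/rtest_Lr|exact: rtest_L2|move=> e e0].
have [a [b [[La Lb E] fa gb]]] := H e e0.
by exists a, b; split=> //; rewrite E// subrr.
Qed.

Lemma rLmin_max f g : rLmin f g -> rLmax kappa f g.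
Proof.
move=> [Lf Lg H]; apply: rLmax_closed => // e /H[phi [tphi fp gp]].
by exists phi, (Lr kappa phi); split=> //; exact: rLmax_test.
Qed.

Lemma rLmin_test phi : rtest phi -> rLmin phi (Lr kappa phi).
Proof.
move=> tphi; split; [exact: rtest_L2|exact/rtest_L2/rtest_Lr|move=> e e0].
exists phi; split=> //.
  by rewrite /nsq /ip (@eq_Rint _ _ _ (fun=> 0)) ?Rintegral_cst ?mul0r// => x _; rewrite subrr mul0r.
by rewrite /nsq /ip (@eq_Rint _ _ _ (fun=> 0)) ?Rintegral_cst ?mul0r// => x _; rewrite subrr mul0r.
Qed.

Lemma rLmin_closed f g : L2r f -> L2r g -> (forall e, 0 < e -> exists a b,
    [/\ rLmin a b, nsq (fun x => f x - a x) < e & nsq (fun x => g x - b x) < e]) ->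
  rLmin f g.
Proof.
move=> Lf Lg H; split=> // e e0.
have [|a [b [[La Lb Hab] fa gb]]] := H (e / 4); first by rewrite divr_gt0.
have [|phi [tphi ap bp]] := Hab (e / 4); first by rewrite divr_gt0.
exists phi; split=> //.
  by apply: (le_lt_trans (nsq_tri Lf La (rtest_L2 tphi))); lra.
by apply: (le_lt_trans (nsq_tri Lg Lb (rtest_L2 (rtest_Lr kappa tphi)))); lra.
Qed.

Lemma nsq0 f : (forall x, 0 < x -> f x = 0) -> nsq f = 0.
Proof.
move=> H; rewrite /nsq /ip (@eq_Rint _ _ _ (fun=> 0)) ?Rintegral_cst ?mul0r// => x.
by rewrite halflineE => /H ->; rewrite mul0r.
Qed.

Lemma ip0l g : ip (fun=> 0) g = 0.
Proof.
rewrite /ip (@eq_Rint _ _ _ (fun=> 0)) ?Rintegral_cst ?mul0r// => x _.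
by rewrite mul0r.
Qed.

Lemma nsq_ae0 f : L2r f -> eqae f (fun=> 0) -> nsq f = 0.
Proof.
by move=> Lf f0; rewrite /nsq (eq_ip f0 f0)//; [exact: ip0l|exact: L2r0..].
Qed.

Lemma derive1_lin c f g (x : R) : rsmooth f -> rsmooth g -> 0 < x ->
  derive1 (fun x => c * f x + g x) x = c * derive1 f x + derive1 g x.
Proof.
move=> sf sg x0; rewrite derive1E.
by have [_ ->] := is_deriveD (is_deriveZ c (rsmooth_is_derive sf x0)) (rsmooth_is_derive sg x0).
Qed.

Lemma Lr_lin c f g (x : R) : rsmooth f -> rsmooth g -> 0 < x ->
  Lr kappa (fun x => c * f x + g x) x = c * Lr kappa f x + Lr kappa g x.
Proof.
move=> sf sg x0; rewrite /Lr (eq_derive1 x0 (fun y => @derive1_lin c f g y sf sg)).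
rewrite (derive1_lin c (rsmooth_derive sf) (rsmooth_derive sg) x0).
move: (derive1 _ x) (derive1 _ x) (x ^- 2) (f x) (g x) => a b d e1 e2; ring.
Qed.

Lemma rLmin_lin c f g f' g' : rLmin f g -> rLmin f' g' ->
  rLmin (fun x => c * f x + f' x) (fun x => c * g x + g' x).
Proof.
move=> [Lf Lg H] [Lf' Lg' H']; split; [by apply: L2rD => //; exact: L2rZ..|].
move=> e e0; pose d := e / (4 * (c ^+ 2 + 1)).
have c1 : 0 < c ^+ 2 + 1 by rewrite ltr_wpDl ?sqr_ge0.
have d0 : 0 < d by rewrite divr_gt0// mulr_gt0.
have dE : 4 * ((c ^+ 2 + 1) * d) = e by rewrite /d; field; rewrite gt_eqF.
have [phi [tphi fp gp]] := H d d0; have [phi' [tphi' fp' gp']] := H' d d0.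
exists (fun x => c * phi x + phi' x); split; first exact: rtest_lin.
  by rewrite -dE; apply: approx_lin => //; exact: rtest_L2.
rewrite (_ : nsq _ = nsq (fun x => c * g x + g' x - (c * Lr kappa phi x + Lr kappa phi' x))).
  by rewrite -dE; apply: approx_lin => //; exact/rtest_L2/rtest_Lr.
by apply: eq_Rint => x; rewrite halflineE => x0; rewrite Lr_lin//; [case: tphi|case: tphi'].
Qed.

Lemma rLmin0 : rLmin (fun=> 0) (fun=> 0).
Proof.
apply: rLmin_closed; [exact: L2r0|exact: L2r0|move=> e e0].
exists (fun=> 0), (Lr kappa (fun=> 0)); split; first exact/rLmin_test/rtest0.
  by rewrite nsq0// => x _; rewrite subrr.
rewrite nsq0// => x x0; rewrite /Lr.
have -> : derive1 (fun=> 0) = (fun=> 0) :> (R -> R).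
  by apply/funext => y; rewrite derive1_cst.
by rewrite derive1_cst mulr0 addr0 oppr0 subrr.
Qed.

Lemma rLmin_eqae f g f' g' : rLmin f g -> eqae f f' -> eqae g g' ->
  L2r f' -> L2r g' -> rLmin f' g'.
Proof.
move=> m ff gg Lf' Lg'; have [Lf Lg _] := m.
apply: rLmin_closed => // e e0; exists f, g; split=> //.
  rewrite nsq_ae0//; first exact: L2rB.
  by apply: ae_imp ff => x H hx; rewrite H// subrr.
rewrite nsq_ae0//; first exact: L2rB.
by apply: ae_imp gg => x H hx; rewrite H// subrr.
Qed.

(** The orthogonal complement of the graph of L on test functions, rotated by a
    quarter turn, is the graph of the maximal operator. *)
Lemma rLmax_perp f g : L2r f -> L2r g ->
  (forall phi, rtest phi -> ip f phi + ip g (Lr kappa phi) = 0) ->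
  rLmax kappa g (fun x => - f x).
Proof.
move=> Lf Lg H; split=> //; first exact: L2rN.
move=> phi tphi; rewrite ipNl//; last exact: rtest_L2.
by apply/eqP; rewrite -addr_eq0 addrC H.
Qed.

(** The minimal operator is its own double adjoint.  Project (f,g) in T onto
    the closed graph of the minimal operator; the remainder (r1,r2) is still in
    T, and (r2,-r1) is in the maximal operator because it is orthogonal to L on
    test functions.  The pairing of these two vanishes by hypothesis, and it is
    |r1|^2 + |r2|^2. *)
Lemma rLmin_intro (T : (R -> R) -> (R -> R) -> Prop) :
  (forall f g, T f g -> rLmax kappa f g) ->
  (forall f g f0 g0, T f g -> rLmin f0 g0 ->
     T (fun x => f x - f0 x) (fun x => g x - g0 x)) ->
  (forall f g f' g', T f g -> rLmax kappa f' g' -> ip g f' - ip f g' = 0) ->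
  forall f g, T f g -> rLmin f g.
Proof.
move=> Tmax TB green f g Tfg; have [Lf Lg _] := Tmax _ _ Tfg.
have [] := @real_projection R [set p | rLmin p.1 p.2] _ rLmin0 _ _ f g Lf Lg.
- by move=> p [].
- by move=> c p q; exact: rLmin_lin.
- move=> a b La Lb H; apply: rLmin_closed => // e /H[[a' b'] [m ? ?]].
  by exists a', b'.
move=> [f0 g0] /= m0 perp; have [Lf0 Lg0 _] := m0.
have Lr1 := L2rB Lf Lf0; have Lr2 := L2rB Lg Lg0.
have rm := rLmax_perp Lr1 Lr2 (fun phi tphi => perp (phi, Lr kappa phi) (rLmin_test tphi)).
have := green _ _ _ _ (TB _ _ _ _ Tfg m0) rm.
rewrite ipNr// opprK -!/(nsq _) => E.
have n1 := nsq_ge0 (fun x => f x - f0 x); have n2 := nsq_ge0 (fun x => g x - g0 x).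
apply: rLmin_eqae m0 _ _ Lf Lg; apply/eqae_sym/eqae_sub/nsq_eq0 => //; lra.
Qed.

End Lmin.

(** * Boundary values in the limit circle case *)

Section LimitCircle.
Variables (kappa : R) (u1 v1 u2 v2 s : R -> R) (w : R).
Hypothesis h1 : hsol kappa u1 v1.
Hypothesis h2 : hsol kappa u2 v2.
Hypothesis hw : forall x, 0 < x -> wr u1 v1 u2 v2 x = w.
Hypothesis w0 : w != 0.
Hypothesis hs : step s 1.
Hypothesis L1 : L2zero u1.
Hypothesis L2 : L2zero u2.

Local Notation A1 := (bv u1 v1 s).
Local Notation A2 := (bv u2 v2 s).
Local Notation rLmin := (rLmin kappa).
Local Notation rLmax := (rLmax kappa).

Lemma rLmax_rep f g : rLmax f g -> exists F F1,
  [/\ sol kappa F F1 g, eqae f F, L2r F,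
   wr u1 v1 F F1 x @[x --> 0^'+] --> A1 f g &
   wr u2 v2 F F1 x @[x --> 0^'+] --> A2 f g].
Proof.
move=> m; have [F [F1 [sF fF]]] := regularity h1 h2 hw w0 hs m.
have [Lf Lg _] := m.
have LF : L2r F by apply: eqae_L2r fF Lf; exact: cont_meas (sol_cont sF).1.
have [l1 E1] := wr_cvg h1 L1 sF Lg; have [l2 E2] := wr_cvg h2 L2 sF Lg.
exists F, F1; split=> //.
  rewrite (bv_eqae h1 hs L1 Lf Lg LF Lg fF (eqae_refl g)).
  by rewrite (bv_lim h1 hs L1 sF LF Lg E1) mul1r.
rewrite (bv_eqae h2 hs L2 Lf Lg LF Lg fF (eqae_refl g)).
by rewrite (bv_lim h2 hs L2 sF LF Lg E2) mul1r.
Qed.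

Lemma green f g f' g' : rLmax f g -> rLmax f' g' ->
  ip g f' - ip f g' = - (w^-1 * (A1 f g * A2 f' g' - A1 f' g' * A2 f g)).
Proof.
move=> m m'; have [Lf Lg _] := m; have [Lf' Lg' _] := m'.
have [F [F1 [sF fF LF c1 c2]]] := rLmax_rep m.
have [F' [F1' [sF' fF' LF' c1' c2']]] := rLmax_rep m'.
rewrite (eq_ip (eqae_refl g) fF')// (eq_ip fF (eqae_refl g'))//.
apply: (green_lim sF sF') => //.
have : w^-1 * (wr u1 v1 F F1 x * wr u2 v2 F' F1' x - wr u1 v1 F' F1' x * wr u2 v2 F F1 x) @[x --> 0^'+] --> w^-1 * (A1 f g * A2 f' g' - A1 f' g' * A2 f g).
  by apply: cvgM; [exact: cvg_cst|apply: cvgB; exact: cvgM].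
apply: near_small_eq => x /andP[x0 _]; rewrite (plucker hw)//.
by rewrite mulrA mulVf// mul1r.
Qed.

(** The boundary values are continuous and vanish on test functions. *)
Lemma bv_rLmin f g : rLmin f g -> A1 f g = 0 /\ A2 f g = 0.
Proof.
move=> [Lf Lg H].
have [Lc1 Lc1'] := cut_L2 h1 hs L1; have [Lc2 Lc2'] := cut_L2 h2 hs L2.
split; apply: ip_closed => // e /H[phi [tphi fp gp]]; exists (Lr kappa phi), phi;
  (split=> //; first by split; [exact/rtest_L2/rtest_Lr|exact: rtest_L2]).
  exact: (bv_test h1 hs L1 tphi).
exact: (bv_test h2 hs L2 tphi).
Qed.

Lemma bv_sub f g f' g' : rLmax f g -> rLmax f' g' ->
  A1 (fun x => f x - f' x) (fun x => g x - g' x) = A1 f g - A1 f' g' /\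
  A2 (fun x => f x - f' x) (fun x => g x - g' x) = A2 f g - A2 f' g'.
Proof.
move=> [Lf Lg _] [Lf' Lg' _].
have E (p q : R -> R) : (fun x => p x - q x) = (fun x => -1 * q x + p x).
  by apply/funext => x; ring.
rewrite !E (bv_lin _ h1 hs L1)// (bv_lin _ h2 hs L2)//; split; ring.
Qed.

Lemma rLmax_sub f g f' g' : rLmax f g -> rLmax f' g' ->
  rLmax (fun x => f x - f' x) (fun x => g x - g' x).
Proof.
move=> m m'; have := rLmax_lin (-1) m' m.
by congr (rLmax _ _); apply/funext => x; ring.
Qed.

(** Green's formula makes the space A1 = A2 = 0 orthogonal to the maximal
    operator, so [rLmin_intro] applies to it. *)
Lemma rLminP f g : rLmin f g <-> [/\ rLmax f g, A1 f g = 0 & A2 f g = 0].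
Proof.
split; first by move=> m; have [? ?] := bv_rLmin m; split=> //; exact: rLmin_max.
apply: (@rLmin_intro kappa (fun f g => [/\ rLmax f g, A1 f g = 0 & A2 f g = 0])).
- by move=> p q [].
- move=> p q p0 q0 [m a1 a2] m0; have [b1 b2] := bv_rLmin m0.
  have m0' := rLmin_max m0; have [-> ->] := bv_sub m m0'.
  by rewrite a1 a2 b1 b2 subrr; split=> //; exact: rLmax_sub.
- by move=> p q p' q' [m a1 a2] m'; rewrite green// a1 a2; ring.
Qed.

Lemma cut_rLmax u v s' c : hsol kappa u v -> step s' c -> L2zero u ->
  rLmax (cutu u s') (cutL u v s').
Proof.
by move=> hu hs' Lu; have [? ?] := cut_L2 hu hs' Lu; exact: sol_rLmax (cut_sol hu hs') _ _.
Qed.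

Lemma bv_cut u v u' v' s' c (W : R) : hsol kappa u v -> L2zero u ->
  hsol kappa u' v' -> L2zero u' -> step s' c ->
  (forall x, 0 < x -> wr u v u' v' x = W) ->
  bv u v s (cutu u' s') (cutL u' v' s') = c * W.
Proof.
move=> hu Lu hu' Lu' hs' wW; have [? ?] := cut_L2 hu' hs' Lu'.
rewrite (bv_lim hu hs Lu (cut_sol hu' hs') _ _ (l := c * W))// ?mul1r//.
apply: (@near_small_eq _ (fun=> c * W)); last exact: cvg_cst.
move=> x x01; rewrite /wr; have [-> ->] := cut_small u' v' hs' x01.
by rewrite -(wW x) /wr; [ring|case/andP: x01].
Qed.

(** The real form of (H - i)(f0 + i g1) = h for the extension H given by A1 =
    0.  Project (0,h) onto the graph of H; with g1 = h - H f0 the orthogonality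
    says that (g1, f0) is in the adjoint of H, and testing with the cut-off u1
    gives A1 = 0 for it. *)
Lemma von_neumann h : L2r h -> exists f0 g1,
  [/\ rLmax f0 (fun x => h x - g1 x), A1 f0 (fun x => h x - g1 x) = 0,
      rLmax g1 f0 & A1 g1 f0 = 0].
Proof.
move=> Lh; pose H f g := rLmax f g /\ A1 f g = 0.
have [Lc1 Lc1'] := cut_L2 h1 hs L1.
have Hlin c f g f' g' : H f g -> H f' g' -> H (fun x => c * f x + f' x) (fun x => c * g x + g' x).
  move=> [m a] [m' a']; split; first exact: rLmax_lin.
  have [? ? _] := m; have [? ? _] := m'.
  by rewrite (bv_lin _ h1 hs L1)// a a' mulr0 addr0.
have [] := @real_projection R [set p | H p.1 p.2] _ _ _ _ _ _ (@L2r0 R) Lh.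
- by move=> p [[]].
- split; first exact: rLmax0.
  by rewrite /bv /= !ip0l subrr.
- by move=> c p q; exact: Hlin.
- move=> a b La Lb HH; split.
    by apply: rLmax_closed => // e /HH[[a' b'] [[m ?] ? ?]]; exists a', b'.
  apply: ip_closed => // e /HH[[a' b'] [[m E] ? ?]]; exists b', a'.
  by have [? ? _] := m; split.
move=> [f0 g0] /= [m0 a0] perp; have [Lf0 Lg0 _] := m0.
pose r x := h x - g0 x; have Lr_ : L2r r by exact: L2rB.
have E0 : (fun x => 0 - f0 x) = (fun x => - f0 x) by apply/funext => x; rewrite sub0r.
rewrite E0 in perp.
have mr : rLmax r f0.
  have perp' phi : rtest phi -> ip (fun x => - f0 x) phi + ip r (Lr kappa phi) = 0.
    move=> tphi; have m := rLmin_test kappa tphi.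
    by apply: (perp (phi, Lr kappa phi)); split=> /=; [exact: rLmin_max|have [] := bv_rLmin m].
  have := rLmax_perp (L2rN Lf0) Lr_ perp'.
  by rewrite (_ : (fun x => - - f0 x) = f0)//; apply/funext => x; rewrite opprK.
exists f0, r; split=> //.
- by rewrite (_ : (fun x => h x - r x) = g0)//; apply/funext => x; rewrite /r; ring.
- by rewrite (_ : (fun x => h x - r x) = g0)//; apply/funext => x; rewrite /r; ring.
have mc := cut_rLmax h1 hs L1.
have b11 : A1 (cutu u1 s) (cutL u1 v1 s) = 0.
  by rewrite (bv_cut h1 L1 h1 L1 hs (W := 0)) ?mulr0// => x _; rewrite /wr; ring.
have b21 : A2 (cutu u1 s) (cutL u1 v1 s) = - w.
  rewrite (bv_cut h2 L2 h1 L1 hs (W := - w)) ?mul1r// => x x0; rewrite -(hw x0) /wr; ring.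
have := perp (cutu u1 s, cutL u1 v1 s) (conj mc b11).
rewrite ipNl// /= => E.
have := green mr mc; rewrite b11 b21 mul0r subr0.
have -> : ip f0 (cutu u1 s) - ip r (cutL u1 v1 s) = 0 by lra.
move=> /esym/eqP; rewrite oppr_eq0 mulf_eq0 invr_eq0 (negbTE w0)/= mulf_eq0 oppr_eq0 (negbTE w0) orbF.
by move/eqP.
Qed.

End LimitCircle.
End Min.

(** * Explicit solutions *)

Section Concrete.
Variable R : realType.
Local Notation mu := (@lebesgue_measure R).
Local Notation hl := (@halfline R).
Implicit Types (f g h F G u v phi : R -> R).

Lemma is_derive_conv f (d d' x : R) : is_derive x 1 f d -> d = d' -> is_derive x 1 f d'.
Proof. by move=> H <-. Qed.

Lemma is_derive_mulc (a x : R) : is_derive x 1 (fun t => a * t) a.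
Proof. by have := is_deriveZ a (is_derive_id x (1:R)); rewrite [_ *: _]mulr1. Qed.

(** The power x^a for x > 0, without the case distinction at 0 of [powR]. *)
Definition pw (a x : R) : R := expR (a * ln x).

Lemma pw_gt0 a x : 0 < pw a x. Proof. exact: expR_gt0. Qed.

Lemma pwD a b x : pw (a + b) x = pw a x * pw b x.
Proof. by rewrite /pw mulrDl expRD. Qed.

Lemma pw1 x : 0 < x -> pw 1 x = x.
Proof. by move=> x0; rewrite /pw mul1r lnK// posrE. Qed.

Lemma pwN1 x : 0 < x -> pw (-1) x = x^-1.
Proof. by move=> x0; rewrite /pw mulN1r expRN lnK// posrE. Qed.

Lemma pw_sq x : 0 < x -> pw 2^-1 x * pw 2^-1 x = x.
Proof. by move=> x0; rewrite -pwD -[RHS]pw1// (_ : 2^-1 + 2^-1 = 1 :> R)//; lra. Qed.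

Lemma is_derive_comp_ln phi (d x : R) : 0 < x -> is_derive (ln x) 1 phi d ->
  is_derive x 1 (fun y => phi (ln y)) (x^-1 * d).
Proof.
by move=> x0 dp; rewrite mulrC; exact: (is_derive1_comp dp (is_derive1_ln x0)).
Qed.

Lemma is_derive_pw a (x : R) : 0 < x -> is_derive x 1 (pw a) (x^-1 * (a * pw a x)).
Proof.
move=> x0; apply: (@is_derive_comp_ln (fun t => expR (a * t))) => //.
rewrite mulrC; exact: (is_derive1_comp (is_derive_expR _) (is_derive_mulc a _)).
Qed.

(** The equation of phi when u(x) = x^(1/2) phi(ln x) solves L u = 0. *)
Definition expsol kappa phi phi1 := forall t : R,
  is_derive t 1 phi (phi1 t) /\ is_derive t 1 phi1 (kappa * phi t).

(** The substitution t = ln x turns Euler's equation into one with constant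
    coefficients; [vof] is the derivative. *)
Definition uof phi (x : R) := pw 2^-1 x * phi (ln x).
Definition vof phi phi1 (x : R) := x^-1 * (pw 2^-1 x * (2^-1 * phi (ln x) + phi1 (ln x))).

Lemma uof_hsol kappa phi phi1 : expsol kappa phi phi1 -> hsol kappa (uof phi) (vof phi phi1).
Proof.
move=> H x x0; have x1 : x != 0 by rewrite gt_eqF.
have dp := is_derive_pw 2^-1 x0.
have [d0 d1] := H (ln x).
have e0 := is_derive_comp_ln x0 d0; have e1 := is_derive_comp_ln x0 d1.
split.
  apply: (is_derive_conv (is_deriveM dp e0)).
  by rewrite /vof /GRing.scale /=; move: (pw _ _) (phi _) (phi1 _) => a b c; ring.
have dV : is_derive x 1 (fun y : R => y^-1) (- (x^-1 * x^-1)).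
  have := @is_deriveV R id x 1 1 x1 (is_derive_id x 1).
  by rewrite /= -invfM -expr2 [_ *: _]mulr1.
have dl : is_derive x 1 (fun y => 2^-1 * phi (ln y) + phi1 (ln y)) _ :=
  is_deriveD (is_deriveZ 2^-1 e0) e1.
have dm : is_derive x 1 (fun y => pw 2^-1 y * (2^-1 * phi (ln y) + phi1 (ln y))) _ :=
  is_deriveM dp dl.
apply: (is_derive_conv (is_deriveM dV dm)).
rewrite /V /uof /GRing.scale /= /GRing.scale /=.
have -> : x ^- 2 = x^-1 * x^-1 by rewrite -invfM.
by move: (pw _ _) (phi _) (phi1 _) (x^-1) => a b c d; field.
Qed.

Lemma wr_uof phi phi1 psi psi1 (x : R) : 0 < x ->
  wr (uof phi) (vof phi phi1) (uof psi) (vof psi psi1) x =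
  phi (ln x) * psi1 (ln x) - phi1 (ln x) * psi (ln x).
Proof.
move=> x0; have x1 : x != 0 by rewrite gt_eqF.
have -> : wr (uof phi) (vof phi phi1) (uof psi) (vof psi psi1) x =
   (pw 2^-1 x * pw 2^-1 x) * x^-1 * (phi (ln x) * psi1 (ln x) - phi1 (ln x) * psi (ln x)).
  by rewrite /wr /uof /vof; move: (pw _ _) (phi _) (phi1 _) (psi _) (psi1 _) (x^-1) => *; ring.
by rewrite pw_sq// divff// mul1r.
Qed.

Lemma uof_smooth kappa phi phi1 : expsol kappa phi phi1 -> cont (uof phi).
Proof. by move=> /uof_hsol/hsol_smooth[/rsmooth_cont]. Qed.

Lemma pw_integ01 a : -1 < a -> integ `]0, 1] (pw a).
Proof.
move=> a1; have ap : 0 < a + 1 by lra.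
have cpw b : cont (pw b) by apply: is_derive_cont => x x0; exact: is_derive_pw.
have AP : abscont (fun x => (a + 1)^-1 * pw (a + 1) x) (pw a).
  have := @abscontZ _ (a + 1)^-1 _ _ (@derive_abscont R (pw (a+1)) (fun x => (a + 1) * pw a x) _ _).
  move=> /(_ _ _)/eq_abscont; apply=> //.
  - by move=> x x0; rewrite mulrA mulVf ?mul1r// gt_eqF.
  - move=> x x0; apply: (is_derive_conv (is_derive_pw (a + 1) x0)).
    have -> : pw a x = x^-1 * pw (a + 1) x.
      by rewrite pwD pw1// mulrCA mulVf ?mulr1// gt_eqF.
    ring.
  - by move=> x x0; apply: cvgM; [exact: cvg_cst|exact: cpw].
apply: (@abscont_ge0_integ01 _ _ _ 0 AP) => x x0; first exact/ltW/pw_gt0.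
by rewrite oppr0 mulr_ge0 ?invr_ge0// ltW// pw_gt0.
Qed.

(** Near 0 the square of x^(1/2) phi(ln x) is at most C^2 x^(1-2b), and 1 - 2b
    > -1. *)
Lemma uof_L2zero kappa phi phi1 C b : expsol kappa phi phi1 -> 0 <= C -> b < 1 ->
  (forall t, t <= 0 -> `|phi t| <= C * expR (- (b * t))) -> L2zero (uof phi).
Proof.
move=> H C0 b1 bnd.
have mI : measurable ([set` `]0, 1:R]] : set (measurableTypeR R)) by exact: measurable_itv.
have sub : [set` `]0, 1:R]] `<=` hl by move=> x; rewrite halflineE /= in_itv/= => /andP[].
have cu := uof_smooth H.
split.
  apply: measurable_funM; last exact: cont_meas.
  by apply: measurable_funTS; exact: measurable_indic.
have pi := integZ (C ^+ 2) (measurable_itv _) (@pw_integ01 (1 - 2 * b) ltac:(lra)).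
have mu2 : measurable_fun (hl : set (measurableTypeR R)) (fun x => uof phi x ^+ 2).
  by apply: measurable_funX; exact: cont_meas.
have : integ `]0, 1] (fun x => uof phi x ^+ 2).
  apply: (integ_le _ _ _ pi) => //; first exact: measurable_funS mu2.
  move=> x /=; rewrite in_itv/= => /andP[x0 x1].
  rewrite ger0_norm ?sqr_ge0// ger0_norm; last by rewrite mulr_ge0 ?sqr_ge0// ltW// pw_gt0.
  have lx : ln x <= 0 by rewrite ln_le0.
  have := bnd _ lx; set p := phi (ln x) => Hp.
  have -> : uof phi x ^+ 2 = x * `|p| ^+ 2.
    by rewrite /uof exprMn expr2 pw_sq// -/p real_normK ?num_real.
  have -> : pw (1 - 2 * b) x = x * expR (- (b * ln x)) ^+ 2.
    rewrite pwD pw1//; congr (_ * _); rewrite /pw expr2 -expRD; congr expR; ring.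
  rewrite [leRHS]mulrCA ler_pM2l// -exprMn lerXn2r// nnegrE//.
  by rewrite mulr_ge0// expR_ge0.
move=> /(integ_patch mI)/(@integS _ setT hl) => /(_ measurableT (@measurable_halfline R) (@subsetT _ _)).
apply: eq_integ => // x hx; rewrite patchE indicE.
by case: ifP => _; rewrite ?mul1r// mul0r expr0n.
Qed.

Lemma exp_expsol m : expsol (m ^+ 2) (fun t => expR (m * t)) (fun t => m * expR (m * t)).
Proof.
move=> t; have d : is_derive t 1 (fun t => expR (m * t)) (m * expR (m * t)).
  rewrite mulrC; exact: (is_derive1_comp (is_derive_expR _) (is_derive_mulc m t)).
split=> //; apply: (is_derive_conv (is_deriveZ m d)).
by rewrite /GRing.scale /=; ring.
Qed.

Lemma id_expsol : expsol 0 (fun t : R => t) (fun=> 1).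
Proof.
by move=> t; split; rewrite ?mul0r; [exact: is_derive_id|exact: is_derive_cst].
Qed.

Lemma cst_expsol : expsol 0 (fun _ : R => 1) (fun=> 0).
Proof. by move=> t; split; rewrite ?mul0r; exact: is_derive_cst. Qed.

Lemma cos_expsol (m : R) : expsol (- m ^+ 2) (fun t => cos (m * t)) (fun t => - (m * sin (m * t))).
Proof.
move=> t; have dm := is_derive_mulc m t; split.
  apply: (is_derive_conv (is_derive1_comp (is_derive_cos (m * t)) dm)); ring.
apply: (is_derive_conv (is_deriveN (is_deriveZ m (is_derive1_comp (is_derive_sin (m * t)) dm)))).
by rewrite /GRing.scale /=; ring.
Qed.

Lemma sin_expsol (m : R) : expsol (- m ^+ 2) (fun t => sin (m * t)) (fun t => m * cos (m * t)).
Proof.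
move=> t; have dm := is_derive_mulc m t; split.
  apply: (is_derive_conv (is_derive1_comp (is_derive_sin (m * t)) dm)); ring.
apply: (is_derive_conv (is_deriveZ m (is_derive1_comp (is_derive_cos (m * t)) dm))).
by rewrite /GRing.scale /=; ring.
Qed.

Lemma exp_L2zero m : -1 < m -> L2zero (uof (fun t => expR (m * t))).
Proof.
move=> m1; apply: (uof_L2zero (C := 1) (b := - m) (exp_expsol m)) => //; first by lra.
by move=> t _; rewrite ger0_norm ?expR_ge0// mul1r mulNr opprK.
Qed.

Lemma id_L2zero : L2zero (uof (fun t : R => t)).
Proof.
apply: (uof_L2zero (C := 2) (b := 2^-1) id_expsol) => //; first by lra.
move=> t t0; rewrite ler0_norm//; have := expR_ge1Dx (- (2^-1 * t)); lra.
Qed.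

Lemma cst_L2zero : L2zero (uof (fun t : R => 1)).
Proof.
apply: (uof_L2zero (C := 1) (b := 0) cst_expsol) => // t _.
by rewrite mul0r oppr0 expR0 normr1 mul1r.
Qed.

Lemma cos_L2zero (m : R) : L2zero (uof (fun t => cos (m * t))).
Proof.
apply: (uof_L2zero (C := 1) (b := 0) (cos_expsol m)) => // t _.
by rewrite mul0r oppr0 expR0 mul1r cos_max.
Qed.

Lemma sin_L2zero (m : R) : L2zero (uof (fun t => sin (m * t))).
Proof.
apply: (uof_L2zero (C := 1) (b := 0) (sin_expsol m)) => // t _.
by rewrite mul0r oppr0 expR0 mul1r sin_max.
Qed.
(** * The limit point case *)

Section LimitPoint.
Variables (kappa : R) (u1 v1 u2 v2 s : R -> R) (w : R).
Hypothesis h1 : hsol kappa u1 v1.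
Hypothesis h2 : hsol kappa u2 v2.
Hypothesis hw : forall x, 0 < x -> wr u1 v1 u2 v2 x = w.
Hypothesis w_gt0 : 0 < w.
Hypothesis hs : step s 1.
Hypothesis L2 : L2zero u2.
Hypothesis u12 : forall x, 0 < x -> u1 x * u2 x = x.
Hypothesis u1_decr : forall x y, 0 < x -> x <= y -> u1 y <= u1 x.
Hypothesis u2_incr : forall x y, 0 < x -> x <= y -> u2 x <= u2 y.
Hypothesis u1_gt0 : forall x, 0 < u1 x.
Hypothesis u2_gt0 : forall x, 0 < u2 x.
Hypothesis u11 : u1 1 = 1.
Hypothesis u1_sq : forall x, 0 < x <= 1 -> x^-1 <= u1 x ^+ 2.
Let w0 : w != 0. Proof. exact: lt0r_neq0. Qed.

Let int_bound u g (M a b : R) : cont u -> L2r g -> 0 < a -> a <= b -> b <= 1 ->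
  (forall t, a <= t <= b -> `|u t| <= M) ->
  `|\int[mu]_(t in `[a, b]) (- (u t * g t))| <= M * \int[mu]_(t in `]0, 1]) `|g t|.
Proof.
move=> cu Lg a0 ab b1 uM; have gl := L2r_locint Lg.
have i1 := locintN (locintM cu gl).
have M0 : 0 <= M by apply: le_trans (uM a _); rewrite ?lexx.
apply: (le_trans (le_normr_Rintegral _ (i1 a b a0))) => //.
apply: (@le_trans _ _ (\int[mu]_(t in `[a, b]) (M * `|g t|))).
  apply: le_Rintegral => //; first exact: (integ_norm _ (i1 a b a0)).
    by apply: integZ => //; apply: integ_norm => //; exact: gl.
  by move=> t /=; rewrite in_itv/= => /uM H; rewrite normrN normrM ler_wpM2r.
have ig : integ `[a, b] (fun t => `|g t|) by apply: integ_norm => //; exact: gl.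
rewrite RintegralZl// ler_wpM2l// Rintegral_mkcond [leRHS]Rintegral_mkcond.
have ig1 : integ `]0, 1] (fun t => `|g t|) by apply: integ_norm => //; exact: L2r_integ01.
apply: le_Rintegral => //; [exact: integ_patch|exact: integ_patch|].
move=> x _; rewrite !patchE !mem_setE !in_itv/=.
case: ifPn => [/andP[ax xb]|_]; last by case: ifP => // _; exact: normr_ge0.
by rewrite ifT//; apply/andP; split; lra.
Qed.

(** The integral of 1/t diverges logarithmically at 0. *)
Lemma not_integ_V (K d : R) : 0 < d ->
  (forall y, 0 < y < d -> \int[mu]_(t in `[y, d]) t^-1 <= K) -> False.
Proof.
(* The integral from y to d is ln d - ln y = |K| + 1. *)
move=> d0 H; pose y := expR (ln d - `|K| - 1).
have y0 : 0 < y by exact: expR_gt0.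
have lny : ln y = ln d - `|K| - 1 by rewrite /y expRK.
have lyd : ln y < ln d by rewrite lny; have := normr_ge0 K; lra.
have yd : y < d by rewrite -ltr_ln ?posrE.
have cV : cont (fun x : R => x^-1).
  by apply: rsmooth_cont => n; exact: Cn_V.
have [_ E] := @derive_abscont R (@ln R) (fun x => x^-1) (fun x x0 => is_derive1_ln x0) cV.
have := H y; rewrite y0 yd => /(_ isT); rewrite -(E _ _ y0 (ltW yd)) lny.
by have := ler_norm K; lra.
Qed.

(** Here u1 plays x^(1/2-m) and u2 plays x^(1/2+m).  Integrating the derivative
    of the Wronskians gives W(u1,F) = O(u1) and, with l = lim W(u2,F), W(u2,F)
    - l = O(u2).  If l were not 0, then w F = u2 W(u1,F) - u1 W(u2,F) would be
    as large as u1 near 0 and hence not in L^2.  So l = 0, and the Plucker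
    relation bounds W(F,G) by u1 u2 = x. *)
Lemma limit_point f g f' g' : rLmax kappa f g -> rLmax kappa f' g' ->
  ip g f' - ip f g' = 0.
Proof.
suff rep p q : rLmax kappa p q -> exists F F1 K, [/\ sol kappa F F1 q, eqae p F, L2r F,
   forall x, 0 < x <= 1 -> `|wr u1 v1 F F1 x| <= K * u1 x &
   forall x, 0 < x <= 1 -> `|wr u2 v2 F F1 x| <= K * u2 x].
  move=> mm mm'; have [Lf Lg _] := mm; have [Lf' Lg' _] := mm'.
  have [F [F1 [K [sF fF LF b1 b2]]]] := rep _ _ mm.
  have [F' [F1' [K' [sF' fF' LF' b1' b2']]]] := rep _ _ mm'.
  rewrite (eq_ip (eqae_refl _) fF')// (eq_ip fF (eqae_refl g'))//.
  rewrite -[RHS]oppr0; apply: (green_lim sF sF') => //.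
  have bnd x : 0 < x <= 1 -> `|wr F F1 F' F1' x| <= (2 * w^-1 * (K * K')) * x.
    move=> x01; have /andP[x0 x1] := x01; have := plucker hw F F1 F' F1' x0.
    move=> E; have B1 := b1 _ x01; have B2 := b2 _ x01; have B1' := b1' _ x01; have B2' := b2' _ x01.
    have : `|w * wr F F1 F' F1' x| <= 2 * (K * K') * x.
      have -> : 2 * (K * K') * x = (K * u1 x) * (K' * u2 x) + (K' * u1 x) * (K * u2 x).
        by rewrite -[X in _ * X](u12 x0); ring.
      rewrite -E; apply: (le_trans (ler_normB _ _)); rewrite !normrM.
      have := ler_pM (normr_ge0 _) (normr_ge0 _) B1 B2'.
      have := ler_pM (normr_ge0 _) (normr_ge0 _) B1' B2.
      by move=> H1 H2; apply: lerD.
    rewrite normrM gtr0_norm// => H.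
    have -> : 2 * w^-1 * (K * K') * x = w^-1 * (2 * (K * K') * x) by ring.
    by rewrite ler_pdivlMl.
  have lin : (2 * w^-1 * (K * K')) * x @[x --> 0^'+] --> (0 : R).
    rewrite -[X in _ --> X](mulr0 (2 * w^-1 * (K * K'))); apply: cvgM; first exact: cvg_cst.
    exact: cvg_at_right_filter cvg_id.
  apply/cvgr0Pnorm_le => e e0; have /cvgr0Pnorm_le/(_ e e0) He := lin.
  near=> x; apply: (le_trans (bnd x _)).
    by apply/andP; split; near: x; [exact: nbhs_right_gt|exact: nbhs_right_le].
  by apply: (le_trans (ler_norm _)); near: x.
move=> mm; have [Lp Lq _] := mm.
have [F [F1 [sF fF]]] := regularity h1 h2 hw w0 hs mm.
have LF : L2r F by apply: eqae_L2r fF Lp; exact: cont_meas (sol_cont sF).1.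
have [l E2] := wr_cvg h2 L2 sF Lq.
have [_ AC1] := wr_abscont h1 sF; have [_ AC2] := wr_abscont h2 sF.
have cu1 := rsmooth_cont (hsol_smooth h1).1; have cu2 := rsmooth_cont (hsol_smooth h2).1.
pose Gq := \int[mu]_(t in `]0, 1]) `|q t|.
have Gq0 : 0 <= Gq by exact: Rintegral_ge0.
pose K := `|wr u1 v1 F F1 1| + Gq.
have K0 : 0 <= K by rewrite addr_ge0.
have b1 x : 0 < x <= 1 -> `|wr u1 v1 F F1 x| <= K * u1 x.
  move=> /andP[x0 x1].
  have -> : wr u1 v1 F F1 x = wr u1 v1 F F1 1 - \int[mu]_(t in `[x, 1]) (- (u1 t * q t)).
    by rewrite -AC1//; ring.
  apply: (le_trans (ler_normB _ _)); rewrite mulrDl; apply: lerD.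
    by rewrite ler_peMr// -u11; exact: u1_decr.
  rewrite mulrC; apply: int_bound => // t /andP[xt t1].
  by rewrite gtr0_norm//; exact: u1_decr.
have b2' x : 0 < x <= 1 -> `|wr u2 v2 F F1 x - l| <= Gq * u2 x.
  move=> /andP[x0 x1].
  have c : `|wr u2 v2 F F1 x - wr u2 v2 F F1 y| @[y --> 0^'+] --> `|wr u2 v2 F F1 x - l|.
    by apply: cvg_norm; apply: cvgB => //; exact: cvg_cst.
  apply: (@cvgr_to_le _ _ _ _ _ _ _ c); near=> y.
  have y0 : 0 < y by near: y; exact: nbhs_right_gt.
  have yx : y <= x by near: y; exact: nbhs_right_le.
  rewrite AC2// mulrC; apply: int_bound => // t /andP[yt tx].
  by rewrite gtr0_norm//; apply: u2_incr => //; lra.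
have l0 : l = 0.
  apply/eqP; rewrite -normr_le0 leNgt; apply/negP => l0.
  have : \forall y \near 0^'+, `|l| / 2 < `|wr u2 v2 F F1 y|.
    apply: cvgr_gt; [exact: (cvg_norm E2)|lra].
  move=> [e /= e0 He].
  pose d := Num.min (e / 2) 1.
  have d0 : 0 < d by rewrite lt_min ltr01 andbT divr_gt0.
  have d1 : d <= 1 by rewrite ge_min lexx orbT.
  have de : d < e by rewrite gt_min; apply/orP; left; lra.
  pose C := 2 / `|l|; have C0 : 0 < C by rewrite divr_gt0.
  (* As |W(u2,F)| > |l| / 2 near 0, the solution formula bounds u1 by F and a
     constant. *)
  have bF x : 0 < x <= d -> u1 x <= C * (w * `|F x| + K).
    move=> /andP[x0 xd]; have x01 : 0 < x <= 1 by rewrite x0; lra.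
    have Hx : `|l| / 2 < `|wr u2 v2 F F1 x|.
      by apply: He => //=; rewrite sub0r normrN ger0_norm ?ltW//; lra.
    have rec := recover hw F F1 x0.
    have : u1 x * `|wr u2 v2 F F1 x| <= w * `|F x| + K.
      rewrite -(gtr0_norm (u1_gt0 x)) -normrM.
      have -> : u1 x * wr u2 v2 F F1 x = u2 x * wr u1 v1 F F1 x - w * F x by rewrite rec; ring.
      apply: (le_trans (ler_normB _ _)); rewrite addrC lerD//.
        by rewrite normrM gtr0_norm.
      rewrite normrM gtr0_norm//; apply: (@le_trans _ _ (u2 x * (K * u1 x))).
        by rewrite ler_pM2l// b1.
      rewrite mulrCA [u2 x * _]mulrC u12// -[leRHS]mulr1 ler_wpM2l//; lra.
    have : u1 x * (`|l| / 2) <= u1 x * `|wr u2 v2 F F1 x| by rewrite ler_pM2l// ltW.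
    have uC : C * (u1 x * (`|l| / 2)) = u1 x by rewrite /C; field; rewrite gt_eqF.
    by move=> Z1 Z2; rewrite -uC ler_pM2l//; apply: le_trans Z2.
  apply: (@not_integ_V (2 * C ^+ 2 * (w ^+ 2 * nsq F + K ^+ 2)) d d0) => y /andP[y0 yd].
  have cV : cont (fun x : R => x^-1) by apply: rsmooth_cont => n; exact: Cn_V.
  have FF : integ `[y, d] (fun x => F x * F x).
    apply: (integS _ _ _ (L2rM LF LF)) => // x; rewrite halflineE /= in_itv/= => /andP[]; lra.
  have iK : integ `[y, d] (fun=> K ^+ 2).
    by apply: (cont_locint (fun y _ => cvg_cst (K ^+ 2)) d y0).
  apply: (@le_trans _ _ (\int[mu]_(t in `[y, d]) (2 * C ^+ 2 * (w ^+ 2 * (F t * F t) + K ^+ 2)))).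
    apply: le_Rintegral => //.
    - exact: cont_locint.
    - by apply: integZ => //; apply: integD => //; exact: integZ.
    move=> t /=; rewrite in_itv/= => /andP[yt td].
    have t0 : 0 < t by lra.
    have := bF t; rewrite t0 td => /(_ isT) B.
    apply: (@le_trans _ _ (u1 t ^+ 2)).
      by apply: u1_sq; rewrite t0; lra.
    have -> : F t * F t = `|F t| ^+ 2 by rewrite real_normK ?num_real// expr2.
    have := normr_ge0 (F t); move: `|F t| B => a B a0.
    have : u1 t ^+ 2 <= (C * (w * a + K)) ^+ 2.
      rewrite lerXn2r// nnegrE; first exact/ltW.
      by apply: le_trans B; exact/ltW.
    move=> /le_trans; apply.
    have : 0 <= C ^+ 2 * (w * a - K) ^+ 2 by rewrite mulr_ge0 ?sqr_ge0.
    lra.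
  rewrite RintegralZl//; last by apply: integD => //; exact: integZ.
  rewrite ler_wpM2l ?mulr_ge0 ?sqr_ge0// RintegralD//; last exact: integZ.
  rewrite RintegralZl// lerD//.
    apply: ler_wpM2l; first exact: sqr_ge0.
    rewrite /nsq /ip Rintegral_mkcond [leRHS]Rintegral_mkcond.
    apply: le_Rintegral => //; [exact: integ_patch|apply: integ_patch => //; exact: L2rM|].
    move=> x _; rewrite !patchE; case: ifPn => [|_]; last by case: ifP => // _; rewrite -expr2 sqr_ge0.
    rewrite mem_setE in_itv/= => /andP[yx xd]; rewrite ifT// in_setE halflineE; lra.
  rewrite Rintegral_cst// -[leRHS]mulr1 ler_wpM2l ?sqr_ge0//.
  have := @lebesgue_measure_itv R `[y, d]; rewrite /= lte_fin yd -EFinD => H.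
  by rewrite [mu _]H /=; lra.
exists F, F1, K; split=> // x x01.
apply: (@le_trans _ _ (Gq * u2 x)); first by have := b2' _ x01; rewrite l0 subr0.
by rewrite ler_pM2r// /K lerDr.
Unshelve. all: by end_near. Qed.

Lemma limit_point_min f g : rLmax kappa f g -> rLmin kappa f g.
Proof.
apply: (@rLmin_intro R kappa (rLmax kappa)) => [//|p q p0 q0 mm /rLmin_max mm0|].
  have := rLmax_lin (-1) mm0 mm.
  by congr (rLmax _ _); apply/funext => x; ring.
exact: limit_point.
Qed.

End LimitPoint.

Lemma pow_limit_point (m : R) (s : R -> R) f g : 1 <= m -> step s 1 ->
  rLmax (m ^+ 2) f g -> rLmin (m ^+ 2) f g.
Proof.
move=> m1 hs.
have h1 := uof_hsol (exp_expsol (- m)); rewrite sqrrN in h1.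
have h2 := uof_hsol (exp_expsol m).
have uE a x : uof (fun t => expR (a * t)) x = pw (2^-1 + a) x by rewrite /uof pwD.
apply: (limit_point_min h1 h2 (w := 2 * m) _ _ hs).
- move=> x x0; rewrite wr_uof//.
  have : expR (- m * ln x) * expR (m * ln x) = 1.
    by rewrite -expRD mulNr addNr expR0.
  move: (expR (- m * _)) (expR (m * _)) => a b ab.
  have -> : a * (m * b) - - m * a * b = 2 * m * (a * b) by ring.
  by rewrite ab mulr1.
- by lra.
- by apply: exp_L2zero; lra.
- by move=> x x0; rewrite !uE -pwD -[RHS]pw1// (_ : _ + _ + _ = 1)//; lra.
- move=> x y x0 xy; rewrite !uE /pw ler_expR ler_wnM2l//; first by lra.
  by rewrite ler_ln ?posrE//; lra.
- move=> x y x0 xy; rewrite !uE /pw ler_expR ler_wpM2l//; first by lra.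
  by rewrite ler_ln ?posrE//; lra.
- by move=> x; rewrite uE pw_gt0.
- by move=> x; rewrite uE pw_gt0.
- by rewrite uE /pw ln1 mulr0 expR0.
- move=> x /andP[x0 x1]; rewrite uE expr2 -pwD -pwN1// /pw ler_expR ler_wnM2r//; last lra.
  by rewrite ln_le0.
Qed.

End Concrete.

(** * Dilations *)

Section Dilation.
Variable R : realType.
Local Notation mu := (@lebesgue_measure R).
Local Notation hl := (@halfline R).
Implicit Types (f g h F G u v phi : R -> R).

Section Scaling.
Variable l : R.
Hypothesis l0 : 0 < l.

Definition scl (k : R) : measurableTypeR R -> measurableTypeR R := fun x => k * x.
Lemma measurable_scl k : measurable_fun setT (scl k).
Proof. exact: measurable_funM. Qed.
HB.instance Definition _ k := isMeasurableFun.Build _ _ _ _ (scl k) (measurable_scl k).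

Lemma scl_halfline : scl l @^-1` hl = hl.
Proof.
by apply/seteqP; split=> x; rewrite /preimage /= !halflineE /scl pmulr_rgt0.
Qed.

Definition push_scl : measure (measurableTypeR R) R :=
  measure_function_pushforward__canonical__measure_function_Measure mu (measurable_scl l).

(** Both measures agree on half-open intervals. *)
Lemma lebesgue_scl (A : set (measurableTypeR R)) : measurable A ->
  mu A = mscale (NngNum (ltW l0)) push_scl A.
Proof.
move=> mA; apply: lebesgue_measure_unique => //= _ [[a b]] _ <-.
rewrite /mscale /= /pushforward.
have -> : scl l @^-1` `]a, b] = [set` `]l^-1 * a, l^-1 * b]].
  by apply/seteqP; split=> x /=; rewrite !in_itv/= /scl ler_pdivlMl// ltr_pdivrMl.
have H := lebesgue_measure_itv `]a, b]; have H' := lebesgue_measure_itv `]l^-1 * a, l^-1 * b].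
rewrite [mu _]H [X in _ = (_ * X)%E]H' /= !lte_fin ltr_pM2l ?invr_gt0//.
case: ifP => _; last by rewrite mule0.
by rewrite -EFinB -EFinM -mulrBr mulrA divff ?mul1r// gt_eqF.
Qed.

Lemma ge0_integral_scl f : measurable_fun (hl : set (measurableTypeR R)) f ->
  (forall x, 0 <= f x) ->
  (\int[mu]_(x in hl) (f x)%:E = l%:E * \int[mu]_(x in hl) (f (l * x))%:E)%E.
Proof.
move=> mf f0.
rewrite (eq_measure_integral (mscale (NngNum (ltW l0)) push_scl)); last first.
  by move=> A mA _; exact: lebesgue_scl.
rewrite ge0_integral_mscale//; last by move=> x _; rewrite lee_fin.
  congr (_ * _)%E; rewrite ge0_integral_pushforward//.
  - by rewrite scl_halfline.
  - exact/measurable_EFinP.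
  - by move=> x _; rewrite lee_fin.
exact/measurable_EFinP.
Qed.

Lemma meas_scl f : measurable_fun (hl : set (measurableTypeR R)) f ->
  measurable_fun (hl : set (measurableTypeR R)) (fun x => f (l * x)).
Proof.
move=> mf; apply: (@measurable_comp _ _ _ _ _ _ hl f _ (scl l)) => //.
- exact: measurable_halfline.
- by move=> y [x hx <-]; move: hx; rewrite !halflineE /scl; exact: mulr_gt0.
- exact: measurable_funTS (measurable_scl l).
Qed.

Lemma L2r_scl f : L2r f -> L2r (fun x => f (l * x)) /\ nsq f = l * nsq (fun x => f (l * x)).
Proof.
move=> [mf /integrableP[m2 fin]].
have mfl := meas_scl mf.
have mf2 : measurable_fun (hl : set (measurableTypeR R)) (fun x => f x ^+ 2) by exact: measurable_funX.
have E := ge0_integral_scl mf2 (fun x => sqr_ge0 _).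
have Lfl : L2r (fun x => f (l * x)).
  split=> //; apply/integrableP; split; first by apply/measurable_EFinP; exact: measurable_funX.
  move: fin; under eq_integral do rewrite /= ger0_norm ?sqr_ge0//.
  rewrite E; under [X in _ -> (X < _)%E]eq_integral do rewrite /= ger0_norm ?sqr_ge0//.
  have : (0 <= \int[mu]_(x in hl) (f (l * x) ^+ 2)%:E)%E by apply: integral_ge0 => x _; rewrite lee_fin sqr_ge0.
  case: (integral _ _ _) => [r _ _||]//; first by rewrite ltry.
  by rewrite mulry gtr0_sg// mul1e.
split=> //.
have nE g : L2r g -> (nsq g)%:E = (\int[mu]_(x in hl) (g x ^+ 2)%:E)%E.
  move=> [_ g2]; rewrite /nsq /ip -(@eq_Rint _ _ (fun x => g x ^+ 2)); last by move=> x _; rewrite expr2.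
  by rewrite /Rintegral fineK//; exact: integrable_fin_num.
apply: EFin_inj; rewrite EFinM !nE//; split=> //; exact/integrableP.
Qed.

(** By polarisation only the nonnegative integrals of squares have to be
    transformed. *)
Lemma ip_scl f g : L2r f -> L2r g -> ip f g = l * ip (fun x => f (l * x)) (fun x => g (l * x)).
Proof.
move=> Lf Lg; have [Lf' _] := L2r_scl Lf; have [Lg' _] := L2r_scl Lg.
have pol a b : L2r a -> L2r b -> ip a b = 4^-1 * (nsq (fun x => a x + b x) - nsq (fun x => a x - b x)).
  by move=> La Lb; rewrite nsqD// nsqB//; field.
rewrite pol// pol//.
have [_ ->] := L2r_scl (L2rD Lf Lg); have [_ ->] := L2r_scl (L2rB Lf Lg); ring.
Qed.

Lemma eqae_scl f g : eqae f g -> eqae (fun x => f (l * x)) (fun x => g (l * x)).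
Proof.
move=> [A [mA A0 sub]].
exists (scl l @^-1` A); split; first by rewrite -(setTI (_ @^-1` _)); exact: measurable_scl.
  have := lebesgue_scl mA; rewrite A0 /mscale /push_scl /pushforward /= => /esym/eqP.
  by rewrite mule_eq0 eqe gt_eqF//= => /eqP.
move=> x /= H; apply: sub => /= H2; apply: H; rewrite halflineE => x0.
by apply: H2; rewrite halflineE mulr_gt0.
Qed.

End Scaling.
Section Dil.
Variable tau : R.
Definition rdil f (x : R) := expR (tau / 2) * f (expR tau * x).
Local Notation l := (expR tau).
Let l0 : 0 < l. Proof. exact: expR_gt0. Qed.
Let lsq : expR (tau / 2) * expR (tau / 2) = l.
Proof. by rewrite -expRD -splitr. Qed.

Lemma rdil_L2 f : L2r f -> L2r (rdil f).
Proof. by move=> /(L2r_scl l0)[Lf _]; exact: L2rZ. Qed.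

Lemma rdil_ip f g : L2r f -> L2r g -> ip (rdil f) (rdil g) = ip f g.
Proof.
move=> Lf Lg; have [Lf' _] := L2r_scl l0 Lf; have [Lg' _] := L2r_scl l0 Lg.
rewrite (ip_scl l0 Lf Lg) /rdil ipZl ?ipZr//; last exact: L2rZ.
by rewrite mulrA lsq.
Qed.

Lemma rdil_eqae f g : eqae f g -> eqae (rdil f) (rdil g).
Proof.
by move=> /(eqae_scl l0); apply: ae_imp => x H hx; rewrite /rdil H.
Qed.

Lemma rdil_is_derive f (d x : R) : is_derive (l * x) 1 f d ->
  is_derive x 1 (rdil f) (expR (tau / 2) * (l * d)).
Proof.
move=> H; have := is_deriveZ (expR (tau / 2)) (is_derive1_comp H (is_derive_mulc l x)).
by rewrite /GRing.scale /= [d * l]mulrC.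
Qed.

Lemma rdil_derive1 f : rsmooth f -> forall x, 0 < x -> derive1 (rdil f) x = l * rdil (derive1 f) x.
Proof.
move=> sf x x0; rewrite derive1E.
have lx : 0 < l * x by rewrite mulr_gt0.
have [_ ->] := rdil_is_derive (rsmooth_is_derive sf lx).
by rewrite /rdil mulrCA.
Qed.

Lemma rdil_smooth f : rsmooth f -> rsmooth (rdil f).
Proof.
move=> sf n; apply: CnZ; apply: Cn_comp => //; first by move=> x x0; rewrite mulr_gt0.
exact/CnZ/Cn_id.
Qed.

Lemma rdil_test f : rtest f -> rtest (rdil f).
Proof.
move=> [sf [a [b [a0 H]]]]; split; first exact: rdil_smooth.
exists (l^-1 * a), (l^-1 * b); split; first by rewrite mulr_gt0 ?invr_gt0.
move=> x Hx; rewrite /rdil H ?mulr0// => /andP[h1 h2]; apply: Hx.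
by rewrite ler_pdivrMl// h1 ler_pdivlMl.
Qed.

(** Both terms of L have degree -2. *)
Lemma rdil_Lr kappa f (x : R) : rsmooth f -> 0 < x ->
  Lr kappa (rdil f) x = l ^+ 2 * rdil (Lr kappa f) x.
Proof.
move=> sf x0; rewrite /Lr (eq_derive1 x0 (rdil_derive1 sf)).
have sf1 := rsmooth_derive sf.
have := derive1_lin l (rdil_smooth sf1) (fun n => @Cn_cst R n 0) x0.
under [X in derive1 X]eq_fun do rewrite addr0.
rewrite derive1_cst addr0 => ->; rewrite rdil_derive1// /rdil.
move: (derive1 _ _) (f _) => a b.
rewrite exprMn invfM; field; by rewrite !gt_eqF.
Qed.

End Dil.

Lemma rdilK tau f : rdil tau (rdil (- tau) f) = f.
Proof.
apply/funext => x; rewrite /rdil mulrA -expRD mulrA -expRD mulNr subrr addNr.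
by rewrite expR0 !mul1r.
Qed.

Lemma rdil_rLmax tau kappa f g : rLmax kappa f g ->
  rLmax kappa (rdil tau f) (fun x => expR tau ^+ 2 * rdil tau g x).
Proof.
move=> [Lf Lg E]; split; [exact: rdil_L2|exact/L2rZ/rdil_L2|move=> phi tphi].
have tp := rdil_test (- tau) tphi; have E1 := E _ tp.
rewrite -[in RHS](rdilK tau phi) ipZl; [|exact: rdil_L2|exact/rdil_L2/rtest_L2].
rewrite rdil_ip//; last exact: rtest_L2.
rewrite -E1 -(rdil_ip tau Lf); last exact/rtest_L2/rtest_Lr.
rewrite -ipZr//; try exact/rdil_L2/rtest_L2/rtest_Lr; try exact: rdil_L2.
apply: eq_Rint => x; rewrite halflineE => x0; congr (_ * _).
by rewrite -rdil_Lr//; [rewrite rdilK|case: tp].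
Qed.

Section DilBv.
Variables (kappa : R) (u1 v1 u2 v2 s : R -> R) (w : R).
Hypothesis h1 : hsol kappa u1 v1.
Hypothesis h2 : hsol kappa u2 v2.
Hypothesis hw : forall x, 0 < x -> wr u1 v1 u2 v2 x = w.
Hypothesis w0 : w != 0.
Hypothesis hs : step s 1.
Hypothesis L1 : L2zero u1.
Hypothesis L2 : L2zero u2.

(** Scaling of Wronskians.  The hypothesis says that u is the given combination
    of the dilated u1 and u2; the same holds for the derivatives with an
    additional factor e^tau. *)
Lemma bv_dil tau u v (a b : R) f g : hsol kappa u v -> L2zero u ->
  (forall x, 0 < x -> u x = a * u1 (expR tau * x) + b * u2 (expR tau * x)) ->
  rLmax kappa f g ->
  bv u v s (rdil tau f) (fun x => expR tau ^+ 2 * rdil tau g x) =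
  expR (tau / 2) * expR tau * (a * bv u1 v1 s f g + b * bv u2 v2 s f g).
Proof.
move=> hu Lu uE mm; have mm' := rdil_rLmax tau mm.
have [F [F1 [sF fF LF c1 c2]]] := rLmax_rep h1 h2 hw w0 hs L1 L2 mm.
have [G [G1 [sG fG]]] := regularity h1 h2 hw w0 hs mm'.
set l := expR tau; have l0 : 0 < l by exact: expR_gt0.
have lx x : 0 < x -> 0 < l * x by move=> x0; rewrite mulr_gt0.
have dF (x : R) : 0 < x -> is_derive x 1 (rdil tau F) (expR (tau / 2) * (l * F1 (l * x))).
  by move=> x0; apply/rdil_is_derive/(sol_is_derive sF)/lx.
have GF : forall x, 0 < x -> G x = rdil tau F x.
  apply: eqae_cont; first exact: (sol_cont sG).1.
    exact: is_derive_cont dF.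
  by apply: eqae_trans (eqae_sym fG) _; exact: rdil_eqae.
have G1F x : 0 < x -> G1 x = expR (tau / 2) * (l * F1 (l * x)).
  move=> x0; have [_ <-] := sol_is_derive sG x0; have [_ <-] := dF x x0.
  by rewrite -!derive1E; exact: eq_derive1.
have vE x : 0 < x -> v x = l * (a * v1 (l * x) + b * v2 (l * x)).
  move=> x0; have [[_ <-] _] := hu x x0.
  rewrite -derive1E (eq_derive1 x0 uE) derive1E.
  have c u' d : is_derive (l * x) 1 u' d -> is_derive x 1 (fun x => u' (l * x)) (d * l).
    by move=> H; exact: (is_derive1_comp H (is_derive_mulc l x)).
  have [[D1 _] [D2 _]] := (h1 (lx x x0), h2 (lx x x0)).
  have [_ ->] := is_deriveD (is_deriveZ a (c _ _ D1)) (is_deriveZ b (c _ _ D2)).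
  by rewrite /GRing.scale /=; ring.
have [Lf' Lg' _] := mm'.
have LG : L2r G by apply: eqae_L2r fG Lf'; exact: cont_meas (sol_cont sG).1.
rewrite (bv_eqae hu hs Lu Lf' Lg' LG Lg' fG (eqae_refl _)).
rewrite -[RHS]mul1r; apply: (bv_lim hu hs Lu sG LG Lg').
have sc (p : R -> R) q : p x @[x --> 0^'+] --> q -> p (l * x) @[x --> 0^'+] --> (q : R).
  move=> pq; apply: cvg_comp pq.
  have : l * x @[x --> 0^'+] --> (0 : R).
    rewrite -[X in _ --> X](mulr0 l); apply: cvgM; [exact: cvg_cst|exact: cvg_at_right_filter cvg_id].
  move=> H A [e /= e0 HA].
  have /cvgr0Pnorm_lt/(_ e e0) He := H.
  near=> x; apply: HA => /=; last by apply: lx; near: x; exact: nbhs_right_gt.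
  by rewrite sub0r normrN; near: x.
have : expR (tau / 2) * l * (a * wr u1 v1 F F1 (l * x) + b * wr u2 v2 F F1 (l * x)) @[x --> 0^'+] -->
   expR (tau / 2) * l * (a * bv u1 v1 s f g + b * bv u2 v2 s f g).
  apply: cvgM; first exact: cvg_cst.
  apply: cvgD; (apply: cvgM; first exact: cvg_cst); exact: (sc (wr _ _ F F1)).
apply: near_small_eq => x /andP[x0 _].
rewrite /wr uE// vE// GF// G1F// /rdil; ring.
Unshelve. all: by end_near. Qed.

End DilBv.
End Dilation.

(** * Reduction of the complex operators to real and imaginary parts *)

Section Components.
Variable R : realType.
Local Notation mu := (@lebesgue_measure R).
Local Notation hl := (@halfline R).
Local Notation C := R[i].
Implicit Types (f g h : R -> C) (p q : (R -> C) * (R -> C)) (phi : R -> R).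

Definition re f x := complex.Re (f x).
Definition im f x := complex.Im (f x).

Lemma cReM (z w : C) : complex.Re (z * w) = complex.Re z * complex.Re w - complex.Im z * complex.Im w.
Proof. by case: z w => a b [c d]. Qed.
Lemma cImM (z w : C) : complex.Im (z * w) = complex.Re z * complex.Im w + complex.Im z * complex.Re w.
Proof. by case: z w => a b [c d]. Qed.
Lemma cReD (z w : C) : complex.Re (z + w) = complex.Re z + complex.Re w.
Proof. by case: z w => a b [c d]. Qed.
Lemma cImD (z w : C) : complex.Im (z + w) = complex.Im z + complex.Im w.
Proof. by case: z w => a b [c d]. Qed.
Lemma cReN (z : C) : complex.Re (- z) = - complex.Re z.
Proof. by case: z. Qed.
Lemma cImN (z : C) : complex.Im (- z) = - complex.Im z.
Proof. by case: z. Qed.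
Lemma cplx_eq (z w : C) : complex.Re z = complex.Re w -> complex.Im z = complex.Im w -> z = w.
Proof. by case: z w => a b [c d] /= -> ->. Qed.
Lemma cplxE (z : C) : z = complex.Re z +i* complex.Im z.
Proof. by case: z. Qed.

Lemma re_lin (c : C) f g : re (fun x => c * f x + g x) =
  (fun x => complex.Re c * re f x + (- complex.Im c * im f x + re g x)).
Proof. by apply/funext => x; rewrite /re /im cReD cReM; ring. Qed.
Lemma im_lin (c : C) f g : im (fun x => c * f x + g x) =
  (fun x => complex.Re c * im f x + (complex.Im c * re f x + im g x)).
Proof. by apply/funext => x; rewrite /re /im cImD cImM; ring. Qed.
Lemma re_sub f g : re (fun x => f x - g x) = (fun x => re f x - re g x).
Proof. by apply/funext => x; rewrite /re cReD cReN. Qed.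
Lemma im_sub f g : im (fun x => f x - g x) = (fun x => im f x - im g x).
Proof. by apply/funext => x; rewrite /im cImD cImN. Qed.

Lemma normc_sq (z : C) : Normc.normc z ^+ 2 = complex.Re z ^+ 2 + complex.Im z ^+ 2.
Proof. by case: z => a b /=; rewrite sqr_sqrtr// addr_ge0// sqr_ge0. Qed.

Lemma sqnorm_split f : cmeasurable f -> sqnorm f =
  (\int[mu]_(x in hl) (re f x ^+ 2)%:E + \int[mu]_(x in hl) (im f x ^+ 2)%:E)%E.
Proof.
move=> [mr mi]; rewrite /sqnorm -ge0_integralD//.
- by apply: eq_integral => x _; rewrite normc_sq EFinD.
- by move=> x _; rewrite lee_fin sqr_ge0.
- by apply/measurable_EFinP; exact: measurable_funX.
- by move=> x _; rewrite lee_fin sqr_ge0.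
- by apply/measurable_EFinP; exact: measurable_funX.
Qed.

Lemma L2P f : L2 f <-> L2r (re f) /\ L2r (im f).
Proof.
have ge0 (a : R -> R) : (0 <= \int[mu]_(x in hl) (a x ^+ 2)%:E)%E.
  by apply: integral_ge0 => x _; rewrite lee_fin sqr_ge0.
split=> [[mf]|[Lr Li]].
  rewrite (sqnorm_split mf) => fin; have [mr mi] := mf.
  have E (a : R -> R) : (\int[mu]_(x in hl) `|(a x ^+ 2)%:E| = \int[mu]_(x in hl) (a x ^+ 2)%:E)%E.
    by apply: eq_integral => x _; rewrite /= ger0_norm// sqr_ge0.
  split; (split=> //; apply/integrableP; split;
    [by apply/measurable_EFinP; exact: measurable_funX | rewrite E]).
    by apply: le_lt_trans fin; rewrite leeDl.
  by apply: le_lt_trans fin; rewrite leeDr.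
have mf : cmeasurable f by split; [case: Lr|case: Li].
by split=> //; rewrite sqnorm_split// !nsqE// -EFinD ltry.
Qed.

Lemma sqnormE f : L2 f -> sqnorm f = (nsq (re f) + nsq (im f))%:E.
Proof. by move=> Lf; have [Lr Li] := (L2P f).1 Lf; rewrite sqnorm_split ?nsqE//; case: Lf. Qed.

Lemma aeqP f g : aeq f g <-> eqae (re f) (re g) /\ eqae (im f) (im g).
Proof.
split=> [fg|[r i]].
  by split; apply: ae_imp fg => x fg hx; rewrite /re /im fg.
by apply: ae_imp2 r i => x r i hx; apply: cplx_eq; [exact: r|exact: i].
Qed.

Lemma L2_lin c f g : L2 f -> L2 g -> L2 (fun x => c * f x + g x).
Proof.
move=> /L2P[a b] /L2P[a' b']; apply/L2P; rewrite re_lin im_lin.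
by split; apply: L2rD; try (apply: L2rD => //); exact: L2rZ.
Qed.

Lemma L2_sub f g : L2 f -> L2 g -> L2 (fun x => f x - g x).
Proof.
by move=> /L2P[a b] /L2P[a' b']; apply/L2P; rewrite re_sub im_sub; split; exact: L2rB.
Qed.

Lemma cintegralM f h : L2 f -> L2 h -> cintegral (fun x => f x * h x) =
  (ip (re f) (re h) - ip (im f) (im h)) +i* (ip (re f) (im h) + ip (im f) (re h)).
Proof.
move=> /L2P[a b] /L2P[a' b']; rewrite /cintegral /ip.
rewrite -RintegralB//; [|exact: L2rM..]; rewrite -RintegralD//; [|exact: L2rM..].
by congr (_ +i* _); apply: eq_Rint => x _; rewrite ?cReM ?cImM.
Qed.

Lemma innerE f h : L2 f -> L2 h -> inner f h =
  (ip (re f) (re h) + ip (im f) (im h)) +i* (ip (re f) (im h) - ip (im f) (re h)).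
Proof.
move=> Lf Lh; have [a b] := (L2P f).1 Lf; have [a' b'] := (L2P h).1 Lh.
have rE : re (fun x => (f x)^*) = re f by apply/funext => x; rewrite /re; case: (f x).
have iE : im (fun x => (f x)^*) = (fun x => - im f x).
  by apply/funext => x; rewrite /im; case: (f x).
rewrite /inner cintegralM//; last by apply/L2P; rewrite rE iE; split=> //; exact: L2rN.
by rewrite rE iE !ipNl// opprK.
Qed.

Lemma iter_cderive n f : re (iter n (@cderive R) f) = iter n (@derive1 R R) (re f) /\
  im (iter n (@cderive R) f) = iter n (@derive1 R R) (im f).
Proof. by elim: n => // n [IH1 IH2]; rewrite !iterS -IH1 -IH2. Qed.

Lemma smoothP f : smooth f <-> rsmooth (re f) /\ rsmooth (im f).
Proof.
split=> [sf|[sr si] n x x0].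
  split; apply: iter_rsmooth => n x x0; have [E1 E2] := iter_cderive n f;
    have [dr di] := sf n x x0; [rewrite -E1; exact: dr|rewrite -E2; exact: di].
have [E1 E2] := iter_cderive n f.
by split; [rewrite -[fun _ => _]/(re _) E1|rewrite -[fun _ => _]/(im _) E2]; exact: rsmooth_iter.
Qed.

Lemma test_functionP f : test_function f <-> rtest (re f) /\ rtest (im f).
Proof.
split=> [[/smoothP[sr si] [a [b [a0 H]]]]|[[sr [a [b [a0 H]]]] [si [a' [b' [a0' H']]]]]].
  by split; split=> //; exists a, b; split=> // x /H; rewrite /re /im => ->.
split; first exact/smoothP.
exists (Num.min a a'), (Num.max b b'); split; first by rewrite lt_min a0.
move=> x Hx; apply: cplx_eq; [apply: H|apply: H'] => /andP[h1 h2]; apply: Hx.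
  by rewrite ge_min h1/= le_max h2.
by rewrite ge_min h1 orbT/= le_max h2 orbT.
Qed.

(** A complex function from its real and imaginary parts. *)
Definition cx (a b : R -> R) : R -> C := fun x => a x +i* b x.

Lemma cx_eta f : f = cx (re f) (im f).
Proof. by apply/funext => x; rewrite /cx -cplxE. Qed.

Lemma re_cx (a b : R -> R) : re (cx a b) = a. Proof. by []. Qed.
Lemma im_cx (a b : R -> R) : im (cx a b) = b. Proof. by []. Qed.

Section Op.
Variables (m : C) (kappa : R).
Hypothesis m2 : m ^+ 2 = kappa%:C.

(** The coefficients of L_m are real. *)
Lemma LdiffE f : Ldiff m f = cx (Lr kappa (re f)) (Lr kappa (im f)).
Proof.
apply/funext => x; rewrite /Ldiff m2 /cx /Lr.
have -> : (kappa%:C - 4^-1) * x%:C ^- 2 = ((kappa - 4^-1) * x ^- 2)%:C.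
  by rewrite rmorphM/= rmorphB/= !fmorphV/= rmorphXn/= rmorph_nat.
by apply: cplx_eq; rewrite ?cReD ?cImD ?cReN ?cImN ?cReM ?cImM /= ?mul0r ?subr0 ?addr0.
Qed.

Lemma Lr0 : Lr kappa (fun=> 0) = fun=> 0.
Proof.
apply/funext => x; rewrite /Lr (_ : derive1 (fun=> 0) = fun=> 0); last first.
  by apply/funext => y; rewrite derive1_cst.
by rewrite derive1_cst mulr0 addr0 oppr0.
Qed.

Lemma LdiffEr phi : Ldiff m (cx phi (fun=> 0)) = cx (Lr kappa phi) (fun=> 0).
Proof. by rewrite LdiffE [Lr _ (im _)]Lr0. Qed.

Lemma L2_cx (a b : R -> R) : L2r a -> L2r b -> L2 (cx a b).
Proof. by move=> La Lb; apply/L2P. Qed.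

Lemma test_cx phi : rtest phi -> test_function (cx phi (fun=> 0)).
Proof. by move=> tphi; apply/test_functionP; split=> //; exact: rtest0. Qed.

Lemma L2_Ldiff f : test_function f -> L2 (Ldiff m f).
Proof.
move=> /test_functionP[t t']; rewrite LdiffE.
by apply: L2_cx; exact/rtest_L2/rtest_Lr.
Qed.

Lemma L2_test f : test_function f -> L2 f.
Proof. by move=> /test_functionP[t t']; apply/L2P; split; exact: rtest_L2. Qed.

Lemma ip0r (a : R -> R) : ip a (fun=> 0) = 0.
Proof. by rewrite ipC ip0l. Qed.

(** Real test functions already determine the distributional equation. *)
Lemma LmaxP f g : Lmax m (f, g) <-> rLmax kappa (re f) (re g) /\ rLmax kappa (im f) (im g).
Proof.
split=> [[/= Lf Lg H]|[[a a' E] [b b' E']]].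
  have [a b] := (L2P f).1 Lf; have [a' b'] := (L2P g).1 Lg.
  have key phi : rtest phi -> ip (re f) (Lr kappa phi) = ip (re g) phi /\
      ip (im f) (Lr kappa phi) = ip (im g) phi.
    move=> tphi; have tP := test_cx tphi.
    have := H _ tP; rewrite (cintegralM Lf (L2_Ldiff tP)) (cintegralM Lg (L2_test tP)).
    rewrite LdiffEr !re_cx !im_cx.
    by rewrite !ip0r !subr0 !add0r => -[-> ->].
  by split; split=> // phi /key[].
have Lf : L2 f by apply/L2P. have Lg : L2 g by apply/L2P.
split=> //= phi tphi; have [t t'] := (test_functionP phi).1 tphi.
rewrite (cintegralM Lf (L2_Ldiff tphi)) (cintegralM Lg (L2_test tphi)).
by rewrite LdiffE re_cx im_cx (E _ t) (E _ t') (E' _ t) (E' _ t').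
Qed.

Lemma sqnorm_lt f (e : R) : L2 f -> (sqnorm f < e%:E)%E ->
  nsq (re f) < e /\ nsq (im f) < e.
Proof.
move=> Lf; rewrite (sqnormE Lf) lte_fin.
have := nsq_ge0 (re f); have := nsq_ge0 (im f); move: (nsq _) (nsq _) => a b a0 b0 H.
split; lra.
Qed.

Lemma LminP f g : Lmin m (f, g) <-> rLmin kappa (re f) (re g) /\ rLmin kappa (im f) (im g).
Proof.
split=> [[/= Lf Lg H]|[[a a' E] [b b' E']]].
  have [a b] := (L2P f).1 Lf; have [a' b'] := (L2P g).1 Lg.
  suff key e : 0 < e -> exists phi : R -> C, [/\ test_function phi,
      nsq (re (fun x => f x - phi x)) < e /\ nsq (im (fun x => f x - phi x)) < e &
      nsq (re (fun x => g x - Ldiff m phi x)) < e /\ nsq (im (fun x => g x - Ldiff m phi x)) < e].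
    split; split=> // e /key[phi [/test_functionP[t t'] [r i] [r' i']]].
      exists (re phi); split=> //; first by rewrite -re_sub.
      by move: r'; rewrite LdiffE re_sub re_cx.
    exists (im phi); split=> //; first by rewrite -im_sub.
    by move: i'; rewrite LdiffE im_sub im_cx.
  move=> /H[_ [[phi tphi <-] /= H1 H2]]; exists phi; split=> //.
    by apply: (sqnorm_lt (L2_sub Lf (L2_test tphi)) H1).
  by apply: (sqnorm_lt (L2_sub Lg (L2_Ldiff tphi)) H2).
have Lf : L2 f by apply/L2P. have Lg : L2 g by apply/L2P.
split=> //= e e0; have e2 : 0 < e / 2 by rewrite divr_gt0.
have [phi [t fp gp]] := E _ e2; have [psi [t' fp' gp']] := E' _ e2.
have tP : test_function (cx phi psi) by apply/test_functionP.
exists (cx phi psi, Ldiff m (cx phi psi)); split; first by exists (cx phi psi).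
  by rewrite (sqnormE (L2_sub Lf (L2_test tP))) lte_fin re_sub im_sub /=; lra.
rewrite (sqnormE (L2_sub Lg (L2_Ldiff tP))) lte_fin re_sub im_sub /= LdiffE re_cx im_cx.
by rewrite [re _]/= [im _]/=; lra.
Qed.

Lemma Lmin_max p : Lmin m p -> Lmax m p.
Proof.
by case: p => f g /LminP[a b]; apply/LmaxP; split; exact: rLmin_max.
Qed.

Lemma Lmax_L2 p : Lmax m p -> L2 p.1 /\ L2 p.2.
Proof. by case. Qed.

Lemma rmin_max_ip (a b c d : R -> R) : rLmax kappa a b -> rLmin kappa c d -> ip a d = ip b c.
Proof.
move=> [La Lb E] [Lc Ld H].
apply/eqP; rewrite -subr_eq0 (ipC a) (ipC b); apply/eqP/ip_closed => // e /H[phi [t h1 h2]].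
exists (Lr kappa phi), phi; split=> //.
  by split; [exact/rtest_L2/rtest_Lr|exact: rtest_L2].
by rewrite ipC (ipC phi) E// subrr.
Qed.

(** Testing with real test functions puts the adjoint into the maximal
    operator; the converse is the continuity of inner products. *)
Lemma adjoint_Lmin : adjoint (Lmin m) = Lmax m.
Proof.
apply/seteqP; split=> -[f g].
  move=> [/= Lf Lg H].
  have [a b] := (L2P f).1 Lf; have [a' b'] := (L2P g).1 Lg.
  have key phi : rtest phi -> ip (re f) (Lr kappa phi) = ip (re g) phi /\
      ip (im f) (Lr kappa phi) = ip (im g) phi.
    move=> t; have LL := rtest_L2 (rtest_Lr kappa t); have Lp := rtest_L2 t.
    have L00 := @L2r0 R.
    have M : Lmin m (cx phi (fun=> 0), cx (Lr kappa phi) (fun=> 0)).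
      by apply/LminP; split; [exact: rLmin_test|exact: rLmin0].
    have := H _ M; rewrite /= (innerE Lf (L2_cx LL L00)) (innerE Lg (L2_cx Lp L00)) !re_cx !im_cx.
    by rewrite !ip0r !addr0 !sub0r => -[-> /eqP]; rewrite eqr_opp => /eqP ->.
  by apply/LmaxP; split; split=> // phi /key[].
move=> M; have [/= Lf Lg _] := M; have /LmaxP[r i] := M; split=> //= -[c d] N.
have [/= Lc Ld _] := N; have /LminP[r' i'] := N.
rewrite (innerE Lf Ld) (innerE Lg Lc).
by rewrite (rmin_max_ip r r') (rmin_max_ip r i') (rmin_max_ip i r') (rmin_max_ip i i').
Qed.

Lemma Lmax_lin c f g f' g' : Lmax m (f, g) -> Lmax m (f', g') ->
  Lmax m (fun x => c * f x + f' x, fun x => c * g x + g' x).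
Proof.
move=> /LmaxP[a b] /LmaxP[a' b']; apply/LmaxP; rewrite !re_lin !im_lin.
by split; (apply: rLmax_lin => //; apply: rLmax_lin).
Qed.

Lemma Lmin_lin c f g f' g' : Lmin m (f, g) -> Lmin m (f', g') ->
  Lmin m (fun x => c * f x + f' x, fun x => c * g x + g' x).
Proof.
move=> /LminP[a b] /LminP[a' b']; apply/LminP; rewrite !re_lin !im_lin.
by split; (apply: rLmin_lin => //; apply: rLmin_lin).
Qed.

Lemma Lmax_aeq f g f' g' : Lmax m (f, g) -> aeq f f' -> aeq g g' ->
  L2 f' -> L2 g' -> Lmax m (f', g').
Proof.
move=> /LmaxP[a b] /aeqP[ff fi] /aeqP[gg gi] /L2P[? ?] /L2P[? ?]; apply/LmaxP.
by split; [exact: rLmax_eqae a _ _ _ _|exact: rLmax_eqae b _ _ _ _].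
Qed.

Lemma Lmin_aeq f g f' g' : Lmin m (f, g) -> aeq f f' -> aeq g g' ->
  L2 f' -> L2 g' -> Lmin m (f', g').
Proof.
move=> /LminP[a b] /aeqP[ff fi] /aeqP[gg gi] /L2P[? ?] /L2P[? ?]; apply/LminP.
by split; [exact: rLmin_eqae a _ _ _ _|exact: rLmin_eqae b _ _ _ _].
Qed.

Lemma Lmin0 : Lmin m (fun=> 0, fun=> 0).
Proof. by apply/LminP; split; exact: rLmin0. Qed.

Section Cutoff.
Variable s : R -> R.
Hypothesis hs : step s 1.

(** If (0, g) is in the maximal operator, then g annihilates all test
    functions. *)
Lemma rLmax_functional (a b b' : R -> R) : rLmax kappa a b -> rLmax kappa a b' -> eqae b b'.
Proof.
have [ss s1 s2] := hs.
move=> [La Lb E] [_ Lb' E']; apply: eqae_sub; apply: (fundamental_lemma ss s1 s2).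
- exact/L2r_locint/L2rB.
- by case: (L2rB Lb Lb').
move=> psi t; have := E _ t; rewrite E'// -[\int[mu]_(x in _) _]/(ip _ _).
by rewrite ipBl//; [move=> ->; rewrite subrr|exact: rtest_L2].
Qed.

Lemma Lmax_functional f g g' : Lmax m (f, g) -> Lmax m (f, g') -> aeq g g'.
Proof.
move=> /LmaxP[a b] /LmaxP[a' b']; apply/aeqP.
by split; [exact: rLmax_functional a a'|exact: rLmax_functional b b'].
Qed.

(** Project onto the closure of the test functions; the remainder annihilates
    every test function. *)
Lemma rtest_dense (a : R -> R) e : L2r a -> 0 < e ->
  exists2 phi, rtest phi & nsq (fun x => a x - phi x) < e.
Proof.
have [ss s1 s2] := hs.
pose D (a : R -> R) := L2r a /\ forall e, 0 < e -> exists2 phi, rtest phi & nsq (fun x => a x - phi x) < e.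
move=> La e0; suff : D a by case=> _; apply.
have D0 : D (fun=> 0).
  split=> [|e' e'0]; [exact: L2r0|exists (fun=> 0); first exact: rtest0].
  by rewrite nsq0// => x _; rewrite subrr.
have [] := @real_projection R [set p | D p.1 /\ L2r p.2] _ _ _ _ _ _ La (@L2r0 R).
- by move=> p [[? _] ?].
- by split; [exact: D0|exact: L2r0].
- move=> c [f1 f2] [g1 g2] [/= [L1 H1] ?] [/= [L2 H2] ?].
  split; last by apply: L2rD => //; exact: L2rZ.
  split; first by apply: L2rD => //; exact: L2rZ.
  move=> e1 e10; pose d := e1 / (4 * (c ^+ 2 + 1)).
  have c1 : 0 < c ^+ 2 + 1 by rewrite ltr_wpDl ?sqr_ge0.
  have d0 : 0 < d by rewrite divr_gt0// mulr_gt0.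
  have dE : 4 * ((c ^+ 2 + 1) * d) = e1 by rewrite /d; field; rewrite gt_eqF.
  have [phi t fp] := H1 d d0; have [phi' t' fp'] := H2 d d0.
  exists (fun x => c * phi x + phi' x); first exact: rtest_lin.
  by rewrite -dE; apply: approx_lin => //; exact: rtest_L2.
- move=> f g Lf Lg H; split=> //=; split=> // e1 e10.
  have [|[q q'] [[[/= Lq Hq] _] fq _]] := H (e1 / 4); first by rewrite divr_gt0.
  have [|phi t qp] := Hq (e1 / 4); first by rewrite divr_gt0.
  by exists phi => //; apply: (le_lt_trans (nsq_tri Lf Lq (rtest_L2 t))); lra.
move=> [f0 g0] /= [[L0 H0] Lg0] perp.
have r0 : eqae (fun x => a x - f0 x) (fun=> 0).
  apply: (fundamental_lemma ss s1 s2).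
  - exact/L2r_locint/L2rB.
  - by case: (L2rB La L0).
  move=> psi t; have Lt := rtest_L2 t.
  have := perp (psi, fun=> 0); rewrite /= ip0r addr0; apply; split; last exact: L2r0.
  by split=> // e1 e10; exists psi => //; rewrite nsq0// => x _; rewrite subrr.
split=> // e1 /H0[phi t H]; exists phi => //.
have Lt := rtest_L2 t; have E := eqae_sub r0.
rewrite /nsq (eq_ip (f' := fun x => f0 x - phi x) (g' := fun x => f0 x - phi x))//; try exact: L2rB.
  by apply: ae_imp E => x E hx; rewrite E.
by apply: ae_imp E => x E hx; rewrite E.
Qed.

Lemma dense_Lmin : densely_defined (Lmin m).
Proof.
move=> f Lf e e0; have [a b] := (L2P f).1 Lf.
have e2 : 0 < e / 2 by rewrite divr_gt0.
have [phi t fp] := rtest_dense a e2; have [psi t' fp'] := rtest_dense b e2.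
have tP : test_function (cx phi psi) by apply/test_functionP.
exists (cx phi psi); last first.
  by rewrite (sqnormE (L2_sub Lf (L2_test tP))) lte_fin re_sub im_sub /=; lra.
exists (cx phi psi, Ldiff m (cx phi psi)) => //.
by apply/LminP; rewrite LdiffE; split; exact: rLmin_test.
Qed.

(** An intermediate space inherits functionality from the maximal operator and
    everything else from its own stability under sums, multiples and changes on
    null sets. *)
Lemma is_operator_sub (K : set ((R -> C) * (R -> C))) :
  Lmin m `<=` K -> K `<=` Lmax m ->
  (forall f g f' g', K (f, g) -> Lmax m (f', g') -> aeq f f' -> aeq g g' -> K (f', g')) ->
  (forall (c : C) f g f' g', K (f, g) -> K (f', g') ->
        K (fun x => c * f x + f' x, fun x => c * g x + g' x)) ->
  is_operator K.
Proof.
move=> mK KM Ka Kl; split.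
- by move=> p /KM/Lmax_L2.
- move=> f g f' g' k ff gg Lf Lg; apply: (Ka _ _ _ _ k _ ff gg).
  exact: (Lmax_aeq (KM _ k) ff gg Lf Lg).
- exact/mK/Lmin0.
- exact: Kl.
- by move=> f g g' /KM h /KM h'; exact: Lmax_functional h h'.
Qed.

Lemma dense_sub (K : set ((R -> C) * (R -> C))) : Lmin m `<=` K -> densely_defined K.
Proof.
move=> mK f Lf e e0; have [g [p mp pg] fg] := dense_Lmin Lf e0.
by exists g => //; exists p => //; exact: mK.
Qed.

Lemma symmetric_Lmin : symmetric_op (Lmin m).
Proof.
split; [|exact: dense_Lmin|by rewrite adjoint_Lmin => p; exact: Lmin_max].
apply: is_operator_sub => //; [by move=> p; exact: Lmin_max| |exact: Lmin_lin].
by move=> f g f' g' k /Lmax_L2[? ?] ff gg; exact: Lmin_aeq k ff gg _ _.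
Qed.

End Cutoff.

Lemma dilation_cx tau f : re (dilation tau f) = rdil tau (re f) /\
  im (dilation tau f) = rdil tau (im f).
Proof.
by split; apply/funext => x; rewrite /re /im /rdil /dilation ?cReM ?cImM /= mul0r ?subr0 ?addr0.
Qed.

(** The action on graphs that a homogeneous operator of degree -2 must
    preserve. *)
Definition dil tau p : (R -> C) * (R -> C) :=
  (dilation tau p.1, fun x => (expR tau ^+ 2)%:C * dilation tau p.2 x).

Lemma dil_cx tau f g : re (dil tau (f, g)).2 = (fun x => expR tau ^+ 2 * rdil tau (re g) x) /\
  im (dil tau (f, g)).2 = (fun x => expR tau ^+ 2 * rdil tau (im g) x).
Proof.
by split; apply/funext => x; rewrite /re /im /rdil /dil /dilation /= ?cReM ?cImM /= !mul0r ?subr0 ?addr0.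
Qed.

Lemma Lmax_dil tau p : Lmax m p -> Lmax m (dil tau p).
Proof.
case: p => f g /LmaxP[a b]; apply/LmaxP.
have [-> ->] := dilation_cx tau f; have [-> ->] := dil_cx tau f g.
by split; exact: rdil_rLmax.
Qed.

Lemma dilationK tau f : dilation tau (dilation (- tau) f) = f.
Proof.
rewrite [LHS]cx_eta [RHS]cx_eta; congr cx.
  by rewrite (dilation_cx _ _).1 (dilation_cx _ _).1 rdilK.
by rewrite (dilation_cx _ _).2 (dilation_cx _ _).2 rdilK.
Qed.

(** U_tau S U_tau^-1 = e^(-2 tau) S for all tau is a family of inclusions,
    since tau may be replaced by -tau. *)
Lemma homogeneousP (K : set ((R -> C) * (R -> C))) :
  homogeneous K <-> forall tau p, K p -> K (dil tau p).
Proof.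
have cE tau : (expR tau ^+ 2)%:C * (expR (- 2 * tau))%:C = 1 :> C.
  rewrite -rmorphM/= -expRM_natl -expRD; suff -> : 2 * tau + - 2 * tau = 0 by rewrite expR0.
  ring.
split=> [H tau p Kp|H tau].
  have : conj_dilation tau K (dilation tau p.1, dilation tau p.2) by exists p.
  rewrite H => -[[q1 q2] Kq [E1 E2]]; rewrite /dil -E1 -E2.
  suff -> : (fun x => (expR tau ^+ 2)%:C * ((expR (- 2 * tau))%:C * q2 x)) = q2 by [].
  by apply/funext => x; rewrite mulrA cE mul1r.
apply/seteqP; split.
  move=> _ [p Kp <-]; exists (dil tau p); first exact: H.
  congr (_, _); apply/funext => x; rewrite /= mulrA [X in X * _]mulrC cE mul1r//.
move=> _ [[p1 p2] Kp <-]; exists (dil (- tau) (p1, p2)); first exact: H.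
rewrite /dil /= dilationK; congr (_, _).
have -> : (fun x => (expR (- tau) ^+ 2)%:C * dilation (- tau) p2 x) =
  dilation (- tau) (fun x => (expR (- 2 * tau))%:C * p2 x); last exact: dilationK.
apply/funext => x; rewrite /dilation mulrCA.
by rewrite -expRM_natl mulrN mulNr.
Qed.

End Op.
End Components.

(** * Extensions as subspaces of the space of boundary values *)

Section Boundary.
Variable R : realType.
Local Notation C := R[i].
Local Notation pair := ((R -> C) * (R -> C))%type.
Implicit Types (f g h : R -> C) (p q r : pair) (H : set pair).

Lemma cutoff_step (xi : R -> C) : cutoff xi -> step (re xi) 1 /\ step (im xi) 0.
Proof.
move=> [/smoothP[sr si] x1 x2].
by split; split=> // x; rewrite /re /im; [move=> /x1 ->|move=> /x2 ->|move=> /x1 ->|move=> /x2 ->].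
Qed.

Lemma Ldiff_sqr (m m' : C) : m ^+ 2 = m' ^+ 2 -> Ldiff m = Ldiff m' :> ((R -> C) -> R -> C).
Proof. by move=> E; apply/funext => f; apply/funext => x; rewrite /Ldiff E. Qed.

Lemma Lmin_sqr (m m' : C) : m ^+ 2 = m' ^+ 2 -> Lmin m = Lmin m'.
Proof. by move=> E; rewrite /Lmin (Ldiff_sqr E). Qed.

Lemma Lmax_sqr (m m' : C) : m ^+ 2 = m' ^+ 2 -> Lmax m = Lmax m'.
Proof. by move=> E; rewrite /Lmax /Ldistr (Ldiff_sqr E). Qed.

(** Linear combination of elements of a graph. *)
Definition plin (c : C) p q : pair := (fun x => c * p.1 x + q.1 x, fun x => c * p.2 x + q.2 x).

Lemma conjcD (z z' : C) : conjc (z + z') = conjc z + conjc z'.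
Proof. exact: rmorphD. Qed.
Lemma conjcM (z z' : C) : conjc (z * z') = conjc z * conjc z'.
Proof. exact: rmorphM. Qed.

(** The hypothesis says that (a,b) is proportional to a real vector; theta is
    the direction orthogonal to it. *)
Lemma angle_of_line (a b : C) : conjc a * b = a * conjc b ->
  exists2 t : R, 0 <= t < pi & (cos t)%:C * a + (sin t)%:C * b = 0.
Proof.
move=> ab; have [a0|a0] := eqVneq a 0.
  by exists 0; rewrite ?lexx ?pi_gt0// a0 sin0 mulr0 mul0r addr0.
have [k kE] : exists k : R, b = k%:C * a.
  case: a b ab a0 => a1 a2 [b1 b2] /= [_ E].
  rewrite eq_complex /= negb_and => a0.
  have n0 : a1 ^+ 2 + a2 ^+ 2 != 0 by rewrite paddr_eq0 ?sqr_ge0// !sqrf_eq0 negb_and.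
  have E' : a1 * b2 = a2 * b1 by move: E; lra.
  exists ((a1 * b1 + a2 * b2) / (a1 ^+ 2 + a2 ^+ 2)); simpc; congr (_ +i* _).
    rewrite -[LHS]mulr1 -(divff n0) mulrA [RHS]mulrAC; congr (_ / _).
    apply/eqP; rewrite -subr_eq0 (_ : _ - _ = a2 * (a2 * b1 - a1 * b2)); last by ring.
    by rewrite E' subrr mulr0.
  rewrite -[LHS]mulr1 -(divff n0) mulrA [RHS]mulrAC; congr (_ / _).
  apply/eqP; rewrite -subr_eq0 (_ : _ - _ = a1 * (a1 * b2 - a2 * b1)); last by ring.
  by rewrite E' subrr mulr0.
exists (pi / 2 + atan k).
  by have := atan_gtNpi2 k; have := atan_ltpi2 k; move=> ? ?; apply/andP; split; lra.
rewrite kE mulrA -mulrDl -rmorphM/= -rmorphD/=.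
have -> : cos (pi / 2 + atan k) = - sin (atan k) by rewrite addrC cosDpihalf.
have -> : sin (pi / 2 + atan k) = cos (atan k) by rewrite addrC sinDpihalf.
have c0 : cos (atan k) != 0 by rewrite cos_atan invr_eq0 gt_eqF// sqrtr_gt0; have := sqr_ge0 k; lra.
have := atanK k; rewrite /tan => E; rewrite -{3}E mulrC mulrA.
by rewrite mulrAC divff// mul1r addNr mulr0.
Qed.

Section BoundarySpace.
Variables (m : C) (kappa : R) (u1 v1 u2 v2 : R -> R) (w : R) (xi : R -> C).
Hypothesis m2 : m ^+ 2 = kappa%:C.
Hypothesis h1 : hsol kappa u1 v1.
Hypothesis h2 : hsol kappa u2 v2.
Hypothesis hw : forall x, 0 < x -> wr u1 v1 u2 v2 x = w.
Hypothesis w0 : w != 0.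
Hypothesis L1 : L2zero u1.
Hypothesis L2' : L2zero u2.
Hypothesis xiP : cutoff xi.
Local Notation s := (re xi).
Let hs : step s 1 := (cutoff_step xiP).1.
Let hs0 : step (im xi) 0 := (cutoff_step xiP).2.
Local Notation Lmax := (Lmax m).
Local Notation Lmin := (Lmin m).

(** The boundary value, extended linearly to complex functions. *)
Definition bvc (u v : R -> R) p : C :=
  bv u v s (re p.1) (re p.2) +i* bv u v s (im p.1) (im p.2).
Local Notation A1 := (bvc u1 v1).
Local Notation A2 := (bvc u2 v2).

Lemma bvc_lin u v c p q : hsol kappa u v -> L2zero u -> Lmax p -> Lmax q ->
  bvc u v (plin c p q) = c * bvc u v p + bvc u v q.
Proof.
move=> hu Lu /Lmax_L2[/L2P[a b] /L2P[a' b']] /Lmax_L2[/L2P[d e] /L2P[d' e']].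
rewrite /bvc /plin /= !re_lin !im_lin.
rewrite !(bv_lin _ hu hs Lu) //; try by apply: L2rD => //; exact: L2rZ.
by rewrite [c in RHS]cplxE; simpc; congr (_ +i* _); ring.
Qed.

Lemma bvc_aeq p q u v : hsol kappa u v -> L2zero u -> Lmax p -> Lmax q -> aeq p.1 q.1 ->
  bvc u v p = bvc u v q.
Proof.
move=> hu Lu Mp Mq E.
have [/= Lf Lg] := Lmax_L2 Mp; have [/= Lf' Lg'] := Lmax_L2 Mq.
have E2 : aeq p.2 q.2.
  case: p q Mp Mq E Lf Lg Lf' Lg' => f g [f' g'] /= Mp Mq E Lf Lg Lf' Lg'.
  apply: (Lmax_functional m2 hs _ Mq); apply: (Lmax_aeq m2 Mp E) => //.
  by apply: aeW.
move/aeqP: E => [ra ia]; move/aeqP: E2 => [rb ib].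
move: Lf Lg Lf' Lg' => /L2P[a b] /L2P[a' b'] /L2P[d e] /L2P[d' e'].
rewrite /bvc.
rewrite (bv_eqae hu hs Lu a a' d d' ra rb).
by rewrite (bv_eqae hu hs Lu b b' e e' ia ib).
Qed.

(** The real Green formula, applied to real and imaginary parts. *)
Lemma Green p q : Lmax p -> Lmax q -> inner p.2 q.1 - inner p.1 q.2 =
  - ((w^-1)%:C * (conjc (A1 p) * A2 q - A1 q * conjc (A2 p))).
Proof.
case: p q => f g [f' g'] Mp Mq.
have [/= Lf Lg] := Lmax_L2 Mp; have [/= Lf' Lg'] := Lmax_L2 Mq.
have [r i] := (LmaxP m2 _ _).1 Mp; have [r' i'] := (LmaxP m2 _ _).1 Mq.
rewrite !innerE//.
have G a b c d (x : rLmax kappa a b) (y : rLmax kappa c d) :=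
  canRL (subrK _) (green h1 h2 hw w0 hs L1 L2' x y).
rewrite (G _ _ _ _ r r') (G _ _ _ _ r i') (G _ _ _ _ i r') (G _ _ _ _ i i').
by rewrite /bvc /=; simpc; congr (_ +i* _); ring.
Qed.

Lemma bvc_LminP p : Lmin p <-> [/\ Lmax p, A1 p = 0 & A2 p = 0].
Proof.
have Z (a b : R) : a +i* b = 0 :> C <-> a = 0 /\ b = 0 by split=> [[-> ->]|[-> ->]].
case: p => f g; split.
  move=> /(LminP m2)[/(rLminP h1 h2 hw w0 hs L1 L2')[a b c] /(rLminP h1 h2 hw w0 hs L1 L2')[a' b' c']].
  by split; [exact/(LmaxP m2)|exact/Z|exact/Z].
move=> [/(LmaxP m2)[a a'] /Z[b b'] /Z[c c']]; apply/(LminP m2).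
by split; apply/(rLminP h1 h2 hw w0 hs L1 L2').
Qed.

(** xi u as an element of the maximal operator. *)
Definition cutz (u v : R -> R) : pair :=
  (fun x => xi x * (u x)%:C, cx (cutL u v s) (cutL u v (im xi))).

Lemma cutzE u v : re (cutz u v).1 = cutu u s /\ im (cutz u v).1 = cutu u (im xi).
Proof.
by split; apply/funext => x; rewrite /cutu /re /im /cutz /=; case: (xi x) => a b /=;
  rewrite mulr0 ?subr0 ?add0r.
Qed.

Lemma cutz_Lmax u v : hsol kappa u v -> L2zero u -> Lmax (cutz u v).
Proof.
move=> hu Lu; apply/(LmaxP m2); have [-> ->] := cutzE u v.
by split; [exact: cut_rLmax hu hs Lu|exact: cut_rLmax hu hs0 Lu].
Qed.

Lemma bvc_cutz u v u' v' (W : R) : hsol kappa u v -> L2zero u ->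
  hsol kappa u' v' -> L2zero u' ->
  (forall x, 0 < x -> wr u v u' v' x = W) -> bvc u v (cutz u' v') = W%:C.
Proof.
move=> hu Lu hu' Lu' wW; rewrite /bvc; have [-> ->] := cutzE u' v'.
rewrite (bv_cut hs hu Lu hu' Lu' hs wW).
by rewrite (bv_cut hs hu Lu hu' Lu' hs0 wW) mul1r mul0r.
Qed.

Lemma bvc_cut12 : [/\ A1 (cutz u1 v1) = 0, A2 (cutz u1 v1) = - w%:C,
  A1 (cutz u2 v2) = w%:C & A2 (cutz u2 v2) = 0].
Proof.
split.
- by rewrite (@bvc_cutz _ _ _ _ 0)// => x _; rewrite /wr; ring.
- rewrite (@bvc_cutz _ _ _ _ (- w))//; first by rewrite rmorphN.
  by move=> x x0; rewrite -(hw x0) /wr; ring.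
- by rewrite (@bvc_cutz _ _ _ _ w).
- by rewrite (@bvc_cutz _ _ _ _ 0)// => x _; rewrite /wr; ring.
Qed.

Lemma plin_Lmax c p q : Lmax p -> Lmax q -> Lmax (plin c p q).
Proof. by case: p q => f g [f' g']; exact: (Lmax_lin m2). Qed.

Lemma wC0 : w%:C != 0 :> C.
Proof. by rewrite eq_complex /= negb_and w0. Qed.

(** The boundary values (0,-w) and (w,0) of xi u1 and xi u2 span C^2. *)
Lemma bvc_surj (a b : C) : exists p, [/\ Lmax p, A1 p = a & A2 p = b].
Proof.
have M1 := cutz_Lmax h1 L1; have M2 := cutz_Lmax h2 L2'.
have [a1 a2 b1 b2] := bvc_cut12.
have [M0 e1 e2] := (bvc_LminP _).1 (Lmin0 m2).
have M01 := plin_Lmax (- (b / w%:C)) M1 M0.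
exists (plin (a / w%:C) (cutz u2 v2) (plin (- (b / w%:C)) (cutz u1 v1) (fun=> 0, fun=> 0))).
split; first exact: plin_Lmax.
  by rewrite !bvc_lin// a1 b1 e1 mulr0 !addr0 divfK// wC0.
by rewrite !bvc_lin// a2 b2 e2 mulr0 add0r addr0 mulrNN divfK// wC0.
Qed.

(** The extension of the minimal operator with boundary condition a A1 + b A2 =
    0. *)
Definition bspace (a b : C) : set pair := [set p | Lmax p /\ a * A1 p + b * A2 p = 0].

Lemma Lmin_bspace a b : Lmin `<=` bspace a b.
Proof. by move=> p /bvc_LminP[Mp e1 e2]; split=> //; rewrite e1 e2 !mulr0 addr0. Qed.

Lemma bspace_operator a b : is_operator (bspace a b).
Proof.
apply: (is_operator_sub m2 hs (@Lmin_bspace a b)).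
- by move=> p [].
- move=> f g f' g' [Mp E] Mq ff _; split=> //.
  rewrite -(bvc_aeq h1 L1 Mp Mq ff) -(bvc_aeq h2 L2' Mp Mq ff); exact: E.
- move=> c f g f' g' [Mp E] [Mq F]; split; first exact: (plin_Lmax c Mp Mq).
  have l1 := bvc_lin c h1 L1 Mp Mq; have l2 := bvc_lin c h2 L2' Mp Mq.
  rewrite -/(plin c (f, g) (f', g')) l1 l2.
  rewrite (_ : _ + _ = c * (a * A1 (f, g) + b * A2 (f, g)) + (a * A1 (f', g') + b * A2 (f', g'))).
    by rewrite E F mulr0 addr0.
  by ring.
Qed.

Lemma op_plin H c p q : is_operator H -> H p -> H q -> H (plin c p q).
Proof. by move=> [_ _ _ lin _]; case: p q => f g [f' g']; exact: lin. Qed.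

(** The functional a A1 + b A2 is neither injective nor zero on C^2. *)
Lemma bspace_strict a b : (a != 0) || (b != 0) -> strict_extension m (bspace a b).
Proof.
move=> ab; split; first exact: bspace_operator.
  split=> [|sub]; first exact: Lmin_bspace.
  have [p [Mp e1 e2]] := bvc_surj (- b) a.
  have /bvc_LminP[_] : Lmin p by apply: sub; split=> //; rewrite e1 e2; ring.
  by move=> E1 E2; move: ab; rewrite -e2 E2 -[b]opprK -e1 E1 oppr0 eqxx.
split=> [p []//|sub].
have [p [Mp e1 e2]] := bvc_surj (conjc a) (conjc b).
have [_] := sub _ Mp; rewrite e1 e2 => /eqP.
have n0 (z : C) : 0 <= z * conjc z by exact: mulcJ_ge0.
by rewrite paddr_eq0// !mulf_eq0 !conjc_eq0 !orbb; apply/negP; rewrite negb_and.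
Qed.

(** Modulo the minimal operator, a strict extension is a proper nonzero
    subspace of C^2, hence the line spanned by any of its nonzero elements. *)
Lemma strict_bspace H p0 a b : is_operator H -> Lmin `<=` H -> H `<=` Lmax ->
  ~ (Lmax `<=` H) -> H p0 -> ~ Lmin p0 -> (a != 0) || (b != 0) ->
  a * A1 p0 + b * A2 p0 = 0 -> H = bspace a b.
Proof.
move=> opH mH HM nM Hp0 np0 ab E0; have M0 := HM _ Hp0.
have sub : bspace a b `<=` H.
  move=> q [Mq Eq].
  have [t [t1 t2]] : exists t, A1 q = t * A1 p0 /\ A2 q = t * A2 p0.
    have D : A1 q * A2 p0 = A1 p0 * A2 q.
      case/orP: ab => z0; apply: (mulfI z0).
        have Z1 : a * A1 q = - (b * A2 q) by apply/eqP; rewrite -addr_eq0 Eq.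
        have Z2 : a * A1 p0 = - (b * A2 p0) by apply/eqP; rewrite -addr_eq0 E0.
        by rewrite !mulrA Z1 Z2; ring.
      have Z1 : b * A2 q = - (a * A1 q) by apply/eqP; rewrite -addr_eq0 addrC Eq.
      have Z2 : b * A2 p0 = - (a * A1 p0) by apply/eqP; rewrite -addr_eq0 addrC E0.
      by rewrite mulrCA Z2 mulrCA Z1; ring.
    have [z1|z1] := eqVneq (A1 p0) 0; last first.
      by exists (A1 q / A1 p0); rewrite divfK// mulrAC D mulrAC divff// mul1r.
    have [z2|z2] := eqVneq (A2 p0) 0.
      by case: np0; apply/bvc_LminP.
    exists (A2 q / A2 p0); rewrite divfK// z1 mulr0; split=> //.
    by apply: (mulIf z2); rewrite D z1 !mul0r.
  have mr : Lmin (plin (- t) p0 q).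
    apply/bvc_LminP; split; first exact: plin_Lmax.
      by rewrite bvc_lin// t1 mulNr addNr.
    by rewrite bvc_lin// t2 mulNr addNr.
  have := op_plin t opH Hp0 (mH _ mr); congr H; case: q {Mq Eq t1 t2 mr} => q1 q2.
  by rewrite /plin /=; congr (_, _); apply/funext => x; rewrite mulNr addrA subrr add0r.
apply/seteqP; split=> // q Hq; split; first exact: HM.
apply/eqP/negP => /negP Bq; apply: nM => r Mr; have Mq := HM _ Hq.
pose t := (a * A1 r + b * A2 r) / (a * A1 q + b * A2 q).
have Kr : bspace a b (plin (- t) q r).
  split; first exact: plin_Lmax.
  rewrite !bvc_lin// (_ : _ + _ = a * A1 r + b * A2 r - t * (a * A1 q + b * A2 q)); last by ring.
  by rewrite divfK// subrr.
have := op_plin t opH Hq (sub _ Kr); congr H; case: (r) => r1 r2.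
by rewrite /plin /=; congr (_, _); apply/funext => x; rewrite mulNr addrA subrr add0r.
Qed.

(** A real line of C^2 is its own orthogonal complement for the form conj(A1 p)
    A2 q - A1 q conj(A2 p). *)
Lemma bspace_selfadjoint (a b : R) : (a != 0) || (b != 0) -> selfadjoint (bspace a%:C b%:C).
Proof.
move=> ab; have ab' : (a%:C != 0 :> C) || (b%:C != 0 :> C).
  by rewrite !eq_complex /= !eqxx !andbT.
split; [exact: bspace_operator|exact: (dense_sub m2 hs (@Lmin_bspace _ _))|].
have flip p q : Lmax p -> Lmax q ->
    conjc (A1 p) * A2 q = A1 q * conjc (A2 p) <-> inner p.1 q.2 = inner p.2 q.1.
  move=> Mp Mq; have E := Green Mp Mq; split=> [G|/esym/eqP].
    by apply/esym/eqP; rewrite -subr_eq0 E G subrr mulr0 oppr0.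
  rewrite -subr_eq0 E oppr_eq0 mulf_eq0 fmorph_eq0 invr_eq0 (negbTE w0)/=.
  by rewrite subr_eq0 => /eqP.
apply/seteqP; split=> p.
  move=> [Lp1 Lp2 adj].
  have Mp : Lmax p by rewrite -(adjoint_Lmin m2); split=> // q /(@Lmin_bspace a%:C b%:C)/adj.
  split=> //; have [q [Mq e1 e2]] := bvc_surj (- b%:C) a%:C.
  have Kq : bspace a%:C b%:C q by split=> //; rewrite e1 e2; ring.
  have /(flip _ _ Mp Mq) := adj _ Kq; rewrite e1 e2 => /eqP.
  rewrite mulNr -subr_eq0 opprK => /eqP/(congr1 (@conjc R)).
  by rewrite conjcD !conjcM !conjcK !conjc_real [_ * a%:C]mulrC => ->; apply: cplx_eq => /=; rewrite ?oppr0.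
move=> [Mp Ep]; have [Lp1 Lp2] := Lmax_L2 Mp; split=> // q [Mq Eq]; apply/(flip _ _ Mp Mq).
have Ep' : a%:C * conjc (A1 p) + b%:C * conjc (A2 p) = 0.
  by have := congr1 (@conjc R) Ep; rewrite conjcD !conjcM !conjc_real => ->; apply: cplx_eq => /=; rewrite ?oppr0.
case/orP: ab' => z0; apply: (mulfI z0).
  have Z1 : a%:C * A1 q = - (b%:C * A2 q) by apply/eqP; rewrite -addr_eq0 Eq.
  have Z2 : a%:C * conjc (A1 p) = - (b%:C * conjc (A2 p)) by apply/eqP; rewrite -addr_eq0 Ep'.
  by rewrite !mulrA Z1 Z2; ring.
have Z1 : b%:C * A2 q = - (a%:C * A1 q) by apply/eqP; rewrite -addr_eq0 addrC Eq.
have Z2 : b%:C * conjc (A2 p) = - (a%:C * conjc (A1 p)) by apply/eqP; rewrite -addr_eq0 addrC Ep'.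
by rewrite mulrCA Z1 mulrCA Z2; ring.
Qed.

(** Neither the minimal operator (whose adjoint is the maximal one) nor the
    maximal operator (which is not symmetric) is self-adjoint, so H is strict.
    The symmetry of H at one element outside the minimal operator makes its
    boundary values proportional to a real vector. *)
Lemma selfadjoint_bspace H : selfadjoint_extension m H ->
  exists2 t : R, 0 <= t < pi & H = bspace (cos t)%:C (sin t)%:C.
Proof.
move=> [[opH _ adj] mH].
have HM : H `<=` Lmax.
  rewrite -adj -(adjoint_Lmin m2) => p [? ? E]; split=> // q /mH; exact: E.
have sym p q : H p -> H q -> inner p.1 q.2 = inner p.2 q.1.
  by move=> Hp Hq; move: Hp; rewrite -adj => -[_ _]; exact.
have [p [Mp p1 p2]] := bvc_surj 1 0; have [q [Mq q1 q2]] := bvc_surj 0 1.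
have nM : ~ (Lmax `<=` H).
  move=> sub; have := Green Mp Mq; rewrite (sym _ _ (sub _ Mp) (sub _ Mq)) subrr.
  rewrite p1 p2 q1 q2 conjc1 mulr1 mul0r subr0 mulr1 => /esym/eqP.
  by rewrite oppr_eq0 fmorph_eq0 invr_eq0 (negbTE w0).
have [p0 Hp0 np0] : exists2 p0, H p0 & ~ Lmin p0.
  apply/existsPNP => sub; have HE : H = Lmin by apply/seteqP; split.
  have : Lmin p by rewrite -HE -adj HE (adjoint_Lmin m2).
  by move=> /bvc_LminP[_]; rewrite p1 => /eqP; rewrite oner_eq0.
have M0 := HM _ Hp0.
have [t tpi Et] : exists2 t : R, 0 <= t < pi & (cos t)%:C * A1 p0 + (sin t)%:C * A2 p0 = 0.
  apply: angle_of_line; have := Green M0 M0; rewrite (sym _ _ Hp0 Hp0) subrr => /esym/eqP.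
  rewrite oppr_eq0 mulf_eq0 fmorph_eq0 invr_eq0 (negbTE w0)/= subr_eq0.
  by move=> /eqP.
exists t => //; apply: (strict_bspace opH mH HM nM Hp0 np0 _ Et).
rewrite !eq_complex /= !eqxx !andbT -negb_and; apply/negP => /andP[/eqP c0 /eqP s0].
by have := cos2Dsin2 t; rewrite c0 s0 expr0n addr0 => /eqP; rewrite eq_sym oner_eq0.
Qed.

(** The boundary vector (-sin t, cos t) lies on the line of t only. *)
Lemma bspace_inj (t t' : R) : 0 <= t < pi -> 0 <= t' < pi ->
  bspace (cos t)%:C (sin t)%:C = bspace (cos t')%:C (sin t')%:C -> t = t'.
Proof.
move=> /andP[t0 tp] /andP[t0' tp'] E.
have [p [Mp p1 p2]] := bvc_surj (- (sin t)%:C) (cos t)%:C.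
have : bspace (cos t)%:C (sin t)%:C p by split=> //; rewrite p1 p2; ring.
rewrite E => -[_]; rewrite p1 p2 mulrN -!rmorphM/= -rmorphN/= -rmorphD/= => -[S].
have {}S : sin (t' - t) = 0 by rewrite sinB -S; ring.
have [tt|tt|//] := ltgtP t t'.
  have : 0 < sin (t' - t) by apply: sin_gt0_pi; apply/andP; split; lra.
  by rewrite S ltxx.
have : 0 < sin (t - t') by apply: sin_gt0_pi; apply/andP; split; lra.
by rewrite -opprB sinN S oppr0 ltxx.
Qed.

(** With z = i e and e = 1 or -1, the function f0 + z g1 of [von_neumann]
    solves (H - z) f = h for real h; complex h follow by linearity. *)
Lemma complex_von_neumann h (e : R) : e ^+ 2 = 1 -> L2 h -> exists f,
  Lmax (f, fun x => (0 +i* e) * f x + h x) /\ A1 (f, fun x => (0 +i* e) * f x + h x) = 0.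
Proof.
move=> e2 /L2P[ha hb].
have key (a : R -> R) : L2r a -> exists f, Lmax (f, fun x => (0 +i* e) * f x + (a x)%:C) /\
   A1 (f, fun x => (0 +i* e) * f x + (a x)%:C) = 0.
  move=> La; have [f0 [g1 [M0 B0 M1 B1]]] := von_neumann h1 h2 hw w0 hs L1 L2' La.
  exists (cx f0 (fun x => e * g1 x + 0)).
  have E : (fun x => (0 +i* e) * cx f0 (fun x => e * g1 x + 0) x + (a x)%:C) =
      cx (fun x => a x - g1 x) (fun x => e * f0 x + 0).
    apply/funext => x; rewrite /cx; simpc; congr (_ +i* _).
    by rewrite mulrA -expr2 e2; ring.
  have M00 := @rLmax0 R kappa; have [? ? _] := M1; have [? ? _] := M00.
  rewrite E; split; first by apply/(LmaxP m2); rewrite !re_cx !im_cx; split=> //; exact: rLmax_lin.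
  rewrite /bvc /= !re_cx !im_cx B0 (bv_lin e h1 hs L1)// B1.
  by rewrite /bv !ip0l subrr mulr0 addr0.
have [f [Mf Bf]] := key _ ha; have [f' [Mf' Bf']] := key _ hb.
exists (fun x => (0 +i* 1) * f' x + f x).
have -> : (fun x => (0 +i* e) * ((0 +i* 1) * f' x + f x) + h x) =
   (plin (0 +i* 1) (f', fun x => (0 +i* e) * f' x + (im h x)%:C) (f, fun x => (0 +i* e) * f x + (re h x)%:C)).2.
  apply/funext => x; rewrite /plin /= [X in _ + X](_ : _ = (0 +i* 1) * (im h x)%:C + (re h x)%:C).
    by ring.
  by rewrite [LHS]cplxE /re /im; simpc.
split; first exact: (plin_Lmax (0 +i* 1) Mf' Mf).
by have := bvc_lin (0 +i* 1) h1 L1 Mf' Mf; rewrite Bf Bf' mulr0 addr0.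
Qed.

Lemma aeq0_bvc u v f g : hsol kappa u v -> L2zero u -> Lmax (f, g) -> aeq f (fun=> 0) ->
  bvc u v (f, g) = 0.
Proof.
move=> hu Lu Mf f0; have [M0 _ _] := (bvc_LminP _).1 (Lmin0 m2).
rewrite (bvc_aeq hu Lu Mf M0 f0) /bvc /bv /= -[re (fun=> 0)]/(fun=> 0) -[im (fun=> 0)]/(fun=> 0).
by rewrite !ip0l subrr.
Qed.

(** For existence, correct xi u2 by the solution f of (H - z) f = (L - z)(xi
    u2) with A1 f = 0: the difference k is in the kernel and A1 k = w.  For
    uniqueness, a kernel element with A1 = 0 belongs to a symmetric operator
    and has the non-real eigenvalue z. *)
Lemma ker_dim1 (e : R) : e ^+ 2 = 1 -> has_dim (ker_shift Lmax (0 +i* e)) 1.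
Proof.
move=> e2; pose z : C := 0 +i* e.
have Mv := cutz_Lmax h2 L2'; have [_ _ A1v _] := bvc_cut12.
have [Lv Lv'] := Lmax_L2 Mv.
set v := cutz u2 v2 in Mv A1v Lv Lv'.
have Lh : L2 (fun x => - z * v.1 x + v.2 x) by exact: L2_lin.
have [f [Mf Bf]] := complex_von_neumann e2 Lh.
pose k x := - 1 * f x + v.1 x.
have Mk : Lmax (k, fun x => z * k x).
  have := plin_Lmax (- 1) Mf Mv; congr (Defs.Lmax _ (_, _)).
  by apply/funext => x; rewrite /k /= /z; ring.
have Bk : A1 (k, fun x => z * k x) != 0.
  have := bvc_lin (- 1) h1 L1 Mf Mv; rewrite Bf A1v mulr0 add0r => E.
  rewrite (_ : bvc u1 v1 _ = w%:C) ?wC0// -E; congr bvc.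
  by rewrite /plin /k /=; congr (_, _); apply/funext => x; rewrite /z; ring.
have sum1 (c : 'I_1 -> C) : (fun x => \sum_(i < 1) c i * k x) = (fun x => c ord0 * k x + 0).
  by apply/funext => x; rewrite big_ord1 addr0.
exists (fun=> k); split=> //.
  move=> c; rewrite sum1 => c0 i; rewrite (ord1 i); apply/eqP/negP => /negP n0.
  move: Bk; rewrite (aeq0_bvc h1 L1 Mk) ?eqxx//.
  apply: ae_imp c0 => x H hx; have /eqP := H hx.
  by rewrite addr0 mulf_eq0 (negbTE n0) => /eqP.
move=> d Md; rewrite /ker_shift /= in Md.
pose t := A1 (d, fun x => z * d x) / A1 (k, fun x => z * k x).
exists (fun=> t); rewrite sum1.
have Mr := plin_Lmax (- t) Mk Md.
have Br : A1 (plin (- t) (k, fun x => z * k x) (d, fun x => z * d x)) = 0.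
  by rewrite bvc_lin// mulNr /t divfK// addNr.
set r := plin _ _ _ in Mr Br.
have r2 : r.2 = fun x => z * r.1 x by apply/funext => x; rewrite /r /plin /= -/z; ring.
have [Lr1 Lr2] := Lmax_L2 Mr.
have : inner r.2 r.1 - inner r.1 r.2 = 0.
  by rewrite (Green Mr Mr) Br mul0r (_ : conjc 0 = 0) ?mul0r ?subrr ?mulr0 ?oppr0//; exact: conjc0.
rewrite !innerE// [ip (im r.2) (im r.1)]ipC [ip (re r.2) (re r.1)]ipC.
rewrite [ip (im r.2) (re r.1)]ipC [ip (re r.2) (im r.1)]ipC => -[_] Ei.
have [La Lb] := (L2P _).1 Lr1.
have rr : re r.2 = fun x => - e * im r.1 x.
  by rewrite r2; apply/funext => x; rewrite /re /im cReM /=; ring.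
have ri : im r.2 = fun x => e * re r.1 x.
  by rewrite r2; apply/funext => x; rewrite /re /im cImM /=; ring.
have e0 : e != 0 by apply/eqP => E; move: e2; rewrite E expr0n => /eqP; rewrite eq_sym oner_eq0.
move: Ei; rewrite rr ri !ipZr// -!/(nsq _) => Ei.
have n0 : nsq (re r.1) + nsq (im r.1) = 0.
  by apply: (mulfI e0); rewrite mulr0; lra.
have := nsq_ge0 (re r.1); have := nsq_ge0 (im r.1) => na nb.
have /aeqP : eqae (re r.1) (re (fun=> 0 : C)) /\ eqae (im r.1) (im (fun=> 0 : C)).
  by split; apply: nsq_eq0 => //; lra.
apply: ae_imp => x H hx; have := H hx; rewrite /r /plin /= mulNr addrC => /eqP.
by rewrite subr_eq0 addr0 => /eqP.
Qed.

Lemma deficiency11 : deficiency_indices Lmin 1 1.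
Proof.
split; first exact: (symmetric_Lmin m2 hs).
  by rewrite (adjoint_Lmin m2); apply: ker_dim1; rewrite expr1n.
rewrite (adjoint_Lmin m2) (_ : - _ = 0 +i* -1); last by simpc.
by apply: ker_dim1; rewrite sqrrN expr1n.
Qed.

(** The representative with a derivative is the continuous one, so the limit in
    the definition is the limit of a W(u1,F) + b W(u2,F) for the real and
    imaginary parts. *)
Lemma Lbc_bspace (a b : R) (u : R -> C) :
  (forall x, 0 < x -> u x = (a * u1 x + b * u2 x)%:C) -> Lbc m u = bspace a%:C b%:C.
Proof.
move=> uE; pose uu x := a * u1 x + b * u2 x; pose vv x := a * v1 x + b * v2 x.
have du (x : R) : 0 < x -> is_derive x 1 uu (vv x).
  move=> x0; have [[d1 _] [d2 _]] := (h1 x0, h2 x0).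
  exact: (is_deriveD (is_deriveZ a d1) (is_deriveZ b d2)).
have duc (x : R) : 0 < x -> cderive u x = (vv x)%:C.
  move=> x0; apply: cplx_eq => /=.
    rewrite (@eq_derive1 _ _ uu x x0); last by move=> y y0; rewrite uE.
    by rewrite derive1E; have [_ ->] := du x x0.
  rewrite (@eq_derive1 _ _ (fun=> 0) x x0); last by move=> y y0; rewrite uE.
  by rewrite derive1_cst.
have Bp f g F F1 G G1 : 
  wr u1 v1 F F1 x @[x --> 0^'+] --> complex.Re (A1 (f, g)) ->
  wr u2 v2 F F1 x @[x --> 0^'+] --> complex.Re (A2 (f, g)) ->
  wr u1 v1 G G1 x @[x --> 0^'+] --> complex.Im (A1 (f, g)) ->
  wr u2 v2 G G1 x @[x --> 0^'+] --> complex.Im (A2 (f, g)) ->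
  wr uu vv F F1 x @[x --> 0^'+] --> complex.Re (a%:C * A1 (f, g) + b%:C * A2 (f, g)) /\
  wr uu vv G G1 x @[x --> 0^'+] --> complex.Im (a%:C * A1 (f, g) + b%:C * A2 (f, g)).
  move=> c1 c2 c3 c4.
  have E P P1 x : wr uu vv P P1 x = a * wr u1 v1 P P1 x + b * wr u2 v2 P P1 x.
    by rewrite /wr /uu /vv; ring.
  rewrite cReD cImD !cReM !cImM /= !mul0r !subr0 !addr0.
  under eq_fun do rewrite E; under [X in _ /\ (X @ _ --> _)]eq_fun do rewrite E.
  by split; (apply: cvgD; (apply: cvgM; first exact: cvg_cst) => //).
have rep f g : Lmax (f, g) -> exists F F1 G G1,
  [/\ sol kappa F F1 (re g), sol kappa G G1 (im g), eqae (re f) F, eqae (im f) G &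
   wr uu vv F F1 x @[x --> 0^'+] --> complex.Re (a%:C * A1 (f, g) + b%:C * A2 (f, g)) /\
   wr uu vv G G1 x @[x --> 0^'+] --> complex.Im (a%:C * A1 (f, g) + b%:C * A2 (f, g))].
  move=> /(LmaxP m2)[r i].
  have [F [F1 [sF fF LF c1 c2]]] := rLmax_rep h1 h2 hw w0 hs L1 L2' r.
  have [G [G1 [sG fG LG c3 c4]]] := rLmax_rep h1 h2 hw w0 hs L1 L2' i.
  by exists F, F1, G, G1; split=> //; exact: Bp.
have E f0 (F F1 G G1 g g' : R -> R) : sol kappa F F1 g -> sol kappa G G1 g' ->
    (forall x, 0 < x -> re f0 x = F x) -> (forall x, 0 < x -> im f0 x = G x) ->
    forall x, 0 < x < 1 -> Normc.normc (u x * cderive f0 x - cderive u x * f0 x) =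
     Normc.normc (wr uu vv F F1 x +i* wr uu vv G G1 x).
  move=> sF sG cF cG x /andP[x0 _]; congr Normc.normc; rewrite uE// duc//.
  have -> : cderive f0 x = F1 x +i* G1 x.
    rewrite /cderive -[fun y => _ (f0 y)]/(re f0) -[X in _ +i* derive1 X _]/(im f0).
    rewrite (eq_derive1 x0 cF) (eq_derive1 x0 cG) !derive1E.
    by have [_ ->] := sol_is_derive sF x0; have [_ ->] := sol_is_derive sG x0.
  rewrite (cplxE (f0 x)) -/(re f0 x) -/(im f0 x) cF// cG// /wr -/(uu x); simpc.
  by congr (_ +i* _); ring.
have sq (p q : R -> R) (l l' : R) : p x @[x --> 0^'+] --> l -> q x @[x --> 0^'+] --> l' ->
    Normc.normc (p x +i* q x) @[x --> 0^'+] --> Num.sqrt (l ^+ 2 + l' ^+ 2).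
  move=> pl ql; apply: (@cvg_comp _ _ _ (fun x => p x ^+ 2 + q x ^+ 2) (@Num.sqrt R)); last exact: sqrt_continuous.
  by apply: cvgD; rewrite expr2; under eq_fun do rewrite expr2; exact: cvgM.
apply/seteqP; split=> -[f g] [Mf /= H]; split=> //=;
  have [F [F1 [G [G1 [sF sG fF fG [c1 c2]]]]]] := rep _ _ Mf.
  have [f0 [/aeqP[ra ia] df lim]] := H.
  have cF : forall x, 0 < x -> re f0 x = F x.
    apply: eqae_cont; [|exact: (sol_cont sF).1|exact: eqae_trans (eqae_sym ra) fF].
    by move=> x x0; apply/differentiable_continuous/derivable1_diffP; case: (df x x0).
  have cG : forall x, 0 < x -> im f0 x = G x.
    apply: eqae_cont; [|exact: (sol_cont sG).1|exact: eqae_trans (eqae_sym ia) fG].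
    by move=> x x0; apply/differentiable_continuous/derivable1_diffP; case: (df x x0).
  have lim' := near_small_eq (E f0 _ _ _ _ _ _ sF sG cF cG) lim.
  have PF : ProperFilter (0^'+ : set_system R) by exact: at_right_proper_filter.
  have l0 := @cvg_lim _ (@Rhausdorff R) _ _ PF _ _ lim'.
  have := @cvg_lim _ (@Rhausdorff R) _ _ PF _ _ (sq _ _ _ _ c1 c2).
  rewrite l0 => /esym/eqP; rewrite sqrtr_eq0 => B0.
  apply: cplx_eq; apply/eqP; rewrite -sqrf_eq0 eq_le sqr_ge0 andbT; apply: le_trans B0.
    by rewrite lerDl sqr_ge0.
  by rewrite lerDr sqr_ge0.
exists (cx F G); split.
- by apply/aeqP.
- move=> x x0; split; [have [d _] := sol_is_derive sF x0; exact: d|have [d _] := sol_is_derive sG x0; exact: d].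
have E' x : 0 < x < 1 -> Normc.normc (wr uu vv F F1 x +i* wr uu vv G G1 x) =
    Normc.normc (u x * cderive (cx F G) x - cderive u x * cx F G x).
  by move=> x01; rewrite (E _ _ _ _ _ _ _ sF sG).
apply: near_small_eq E' _; have := sq _ _ _ _ c1 c2.
by rewrite H /= expr0n addr0 sqrtr0.
Qed.

(** H_m is spanned over the minimal operator by xi zeta, whose boundary values
    are (b w, -a w); these are annihilated by a A1 + b A2. *)
Lemma Hop_bspace (m' a b : C) : m' ^+ 2 = m ^+ 2 -> (a != 0) || (b != 0) ->
  (forall x, 0 < x -> zeta m' x = a * (u1 x)%:C + b * (u2 x)%:C) ->
  Hop xi m' = bspace a b.
Proof.
move=> mm ab zE; rewrite /Hop (Lmax_sqr mm) (Lmin_sqr mm).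
have M1 := cutz_Lmax h1 L1; have M2 := cutz_Lmax h2 L2'.
have [a1 a2 b1 b2] := bvc_cut12.
have [M0 e1 e2] := (bvc_LminP _).1 (Lmin0 m2).
pose Z := plin a (cutz u1 v1) (plin b (cutz u2 v2) (fun=> 0, fun=> 0)).
have Z1 x : 0 < x -> Z.1 x = xi x * zeta m' x.
  by move=> x0; rewrite /Z /plin /= zE//; ring.
have M20 := plin_Lmax b M2 M0.
have MZ : Lmax Z by exact: plin_Lmax.
have A1Z : A1 Z = b * w%:C by rewrite !bvc_lin// a1 b1 e1 mulr0 addr0 add0r.
have A2Z : A2 Z = - (a * w%:C) by rewrite !bvc_lin// a2 b2 e2 mulr0 !addr0 mulrN.
have aeZ c f0 : aeq (fun x => f0 x + c * (xi x * zeta m' x)) (fun x => c * Z.1 x + f0 x).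
  by apply: aeW => x; rewrite halflineE => x0; rewrite Z1// addrC.
apply/seteqP; split=> -[f g] [Mf /= H]; split=> //=.
  have [f0 [c [[[f0' g0] m0 /= fE] ff]]] := H; rewrite {}fE in m0.
  have Mc := plin_Lmax c MZ (Lmin_max m2 m0).
  have ff' : aeq f (plin c Z (f0, g0)).1.
    by apply: ae_imp2 ff (aeZ c f0) => x E1 E2 hx; rewrite E1// E2.
  rewrite (bvc_aeq h1 L1 Mf Mc ff') (bvc_aeq h2 L2' Mf Mc ff').
  have [_ n1 n2] := (bvc_LminP _).1 m0; have Mm := Lmin_max m2 m0.
  by rewrite (bvc_lin c h1 L1 MZ Mm) (bvc_lin c h2 L2' MZ Mm) A1Z A2Z n1 n2; ring.
have [c [c1 c2]] : exists c, A1 (f, g) = c * A1 Z /\ A2 (f, g) = c * A2 Z.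
  case/orP: ab => n0.
    exists (- (A2 (f, g) / (a * w%:C))); rewrite A1Z A2Z; split; last first.
      by rewrite mulrNN divfK// mulf_neq0// wC0.
    apply: (mulfI n0); have -> : a * A1 (f, g) = - (b * A2 (f, g)) by apply/eqP; rewrite -addr_eq0 H.
    by field; rewrite n0 wC0.
  exists (A1 (f, g) / (b * w%:C)); rewrite A1Z A2Z; split; first by rewrite divfK// mulf_neq0// wC0.
  apply: (mulfI n0); have -> : b * A2 (f, g) = - (a * A1 (f, g)) by apply/eqP; rewrite -addr_eq0 addrC H.
  by field; rewrite n0 wC0.
have mr : Lmin (plin (- c) Z (f, g)).
  apply/bvc_LminP; split; first exact: plin_Lmax.
    by rewrite bvc_lin// c1 mulNr addNr.
  by rewrite bvc_lin// c2 mulNr addNr.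
exists (plin (- c) Z (f, g)).1, c; split; first by exists (plin (- c) Z (f, g)).
apply: ae_imp (aeZ c (plin (- c) Z (f, g)).1) => x E hx; rewrite E// [RHS]/=; ring.
Qed.

Lemma bvc_dil tau u v (a b : R) p : hsol kappa u v -> L2zero u ->
  (forall x, 0 < x -> u x = a * u1 (expR tau * x) + b * u2 (expR tau * x)) -> Lmax p ->
  bvc u v (dil tau p) = (expR (tau / 2) * expR tau)%:C * (a%:C * A1 p + b%:C * A2 p).
Proof.
case: p => f g hu Lu uE /(LmaxP m2)[r i].
have [E1 E2] := dil_cx tau f g; have [E3 E4] := dilation_cx tau f.
rewrite /bvc E1 E2 E3 E4 (bv_dil h1 h2 hw w0 hs L1 L2' hu Lu uE r).
rewrite (bv_dil h1 h2 hw w0 hs L1 L2' hu Lu uE i); simpc.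
by congr (_ +i* _); rewrite !mulrDr.
Qed.

Lemma bspace_det (a b a' b' : C) : bspace a b = bspace a' b' -> a * b' = a' * b.
Proof.
move=> E; have [p [Mp p1 p2]] := bvc_surj (- b) a.
have : bspace a b p by split=> //; rewrite p1 p2; ring.
rewrite E => -[_]; rewrite p1 p2 => Z; apply/eqP; rewrite -subr_eq0 -Z; apply/eqP; ring.
Qed.

Lemma bspace_homogeneous (a b : C) (k : R -> C) :
  (forall tau p, Lmax p -> a * A1 (dil tau p) + b * A2 (dil tau p) =
     k tau * (a * A1 p + b * A2 p)) ->
  homogeneous (bspace a b).
Proof.
move=> sc; apply/homogeneousP => tau p [Mp E]; split; first exact: (Lmax_dil m2).
by rewrite sc// E mulr0.
Qed.

(** Let p in H be outside the minimal operator.  If a A1 + b A2 does not vanish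
    at p, then dil p - k p is in H and in the kernel of a A1 + b A2; were it
    outside the minimal operator, H would be that kernel.  So it is in the
    minimal operator, and p is an eigenvector of the dilations modulo it. *)
Lemma homogeneous_cases H (a b : C) (k : R -> C) :
  (forall tau p, Lmax p -> a * A1 (dil tau p) + b * A2 (dil tau p) =
     k tau * (a * A1 p + b * A2 p)) ->
  (a != 0) || (b != 0) -> strict_extension m H -> homogeneous H ->
  H = bspace a b \/ exists p, [/\ Lmax p, H p, ~ Lmin p,
    a * A1 p + b * A2 p != 0 &
    forall tau, A1 (dil tau p) = k tau * A1 p /\ A2 (dil tau p) = k tau * A2 p].
Proof.
move=> sc ab [opH [mH nm] [HM nM]] /homogeneousP hom.
have [p Hp np] : exists2 p, H p & ~ Lmin p.
  by apply/existsPNP => sub; apply: nm.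
have [E|E] := eqVneq (a * A1 p + b * A2 p) 0.
  by left; exact: (strict_bspace opH mH HM nM Hp np ab E).
right; exists p; have Mp := HM _ Hp; split=> // tau.
have Md := Lmax_dil m2 tau Mp; have Hd := hom tau p Hp.
have Hq := op_plin (- k tau) opH Hp Hd.
have [e1 e2] := (bvc_lin (- k tau) h1 L1 Mp Md, bvc_lin (- k tau) h2 L2' Mp Md).
have Eq : a * A1 (plin (- k tau) p (dil tau p)) + b * A2 (plin (- k tau) p (dil tau p)) = 0.
  rewrite e1 e2 (_ : _ + _ = a * A1 (dil tau p) + b * A2 (dil tau p) - k tau * (a * A1 p + b * A2 p)); last by ring.
  by rewrite sc// subrr.
have mq : Lmin (plin (- k tau) p (dil tau p)).
  apply: contrapT => nq; have HE := strict_bspace opH mH HM nM Hq nq ab Eq.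
  by move: Hp; rewrite HE => -[_ E0]; rewrite E0 eqxx in E.
have [_ z1 z2] := (bvc_LminP _).1 mq.
split; apply/eqP; rewrite -subr_eq0; [rewrite -z1 e1|rewrite -z2 e2]; apply/eqP; ring.
Qed.

(** Two functionals with different scaling factors: an eigenvector of the
    dilations is annihilated by one of the two. *)
Lemma two_homogeneous (a b a' b' : C) (k k' : R -> C) (tau0 : R) :
  (forall tau p, Lmax p -> a * A1 (dil tau p) + b * A2 (dil tau p) =
     k tau * (a * A1 p + b * A2 p)) ->
  (forall tau p, Lmax p -> a' * A1 (dil tau p) + b' * A2 (dil tau p) =
     k' tau * (a' * A1 p + b' * A2 p)) ->
  k tau0 != k' tau0 -> (a != 0) || (b != 0) -> (a' != 0) || (b' != 0) ->
  forall H, strict_extension m H /\ homogeneous H <-> H = bspace a b \/ H = bspace a' b'.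
Proof.
move=> sc sc' kk ab ab' H; split=> [[st hom]|[->|->]].
- have [|[p [Mp Hp np Bp ev]]] := homogeneous_cases sc ab st hom; first by left.
  right; have [opH [mH _] [HM nM]] := st; apply: (strict_bspace opH mH HM nM Hp np ab').
  have := sc' tau0 _ Mp; have [-> ->] := ev tau0 => E.
  have kk0 : k tau0 - k' tau0 != 0 by rewrite subr_eq0.
  apply: (mulfI kk0); rewrite mulr0 mulrBl -E; ring.
- by split; [exact: bspace_strict|exact: bspace_homogeneous sc].
- by split; [exact: bspace_strict|exact: bspace_homogeneous sc'].
Qed.

Lemma parametrization (u : R -> R -> C) :
  (forall t x, 0 < x -> u t x = (cos t * u1 x + sin t * u2 x)%:C) ->
  parametrizes_extensions m u /\ forall t, Lbc m (u t) = bspace (cos t)%:C (sin t)%:C.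
Proof.
move=> uE; have LE t : Lbc m (u t) = bspace (cos t)%:C (sin t)%:C by apply: Lbc_bspace => x; exact: uE.
split=> //; split=> [t _|H saH].
  rewrite LE; split; last exact: Lmin_bspace.
  apply: bspace_selfadjoint; rewrite -negb_and; apply/negP => /andP[/eqP c0 /eqP s0].
  by have := cos2Dsin2 t; rewrite c0 s0 expr0n addr0 => /eqP; rewrite eq_sym oner_eq0.
have [t tpi HE] := selfadjoint_bspace saH.
exists t; split; first by rewrite LE.
by move=> t' [tpi']; rewrite LE HE; exact: bspace_inj.
Qed.

End BoundarySpace.
End Boundary.

(** * The four ranges of the parameter *)

Section Cases.
Variable R : realType.
Local Notation C := R[i].
Local Notation pair := ((R -> C) * (R -> C))%type.
Implicit Types (H : set pair) (phi : R -> R).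

Lemma powR_half (x : R) : 0 < x -> x `^ 2^-1 = pw 2^-1 x.
Proof. by move=> x0; rewrite /powR gt_eqF. Qed.

Lemma cpowE (x c d : R) : cpow x (2^-1 + (c +i* d)) =
  (pw 2^-1 x * expR (c * ln x))%:C * (cos (d * ln x) +i* sin (d * ln x)).
Proof.
have -> : (2^-1 : C) = (2^-1)%:C by rewrite fmorphV/= rmorph_nat.
by rewrite /cpow /pw /= -expRD -mulrDl add0r.
Qed.

(** ln(e^tau x) = tau + ln x, so dilations of u are translations of phi. *)
Lemma uof_dil (a b tau : R) phi phi1 phi2 :
  (forall t, phi t = a * phi1 (tau + t) + b * phi2 (tau + t)) ->
  forall x, 0 < x -> uof phi x = (expR (- (tau / 2)) * a) * uof phi1 (expR tau * x) +
    (expR (- (tau / 2)) * b) * uof phi2 (expR tau * x).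
Proof.
move=> E x x0; rewrite /uof E lnM ?posrE ?expR_gt0// expRK.
have -> : pw 2^-1 (expR tau * x) = expR (tau / 2) * pw 2^-1 x.
  by rewrite /pw lnM ?posrE ?expR_gt0// expRK -expRD mulrDr [2^-1 * tau]mulrC.
have e : expR (- (tau / 2)) * expR (tau / 2) = 1 by rewrite -expRD addNr expR0.
move: (phi1 _) (phi2 _) (pw _ _) => p q r.
rewrite -[LHS]mul1r -[X in X * _ = _]e; ring.
Qed.

Lemma zeta_real (n x : R) : zeta n%:C x = (uof (fun t => expR (n * t)) x)%:C.
Proof.
rewrite /zeta -[n%:C]/(n +i* 0) cpowE mul0r cos0 sin0 /uof.
by rewrite -[1 +i* 0]/(1 : C) mulr1.
Qed.

Section Dilations.
Variables (m : C) (kappa w : R) (phi1 phi1' phi2 phi2' : R -> R) (xi : R -> C).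
Hypothesis m2 : m ^+ 2 = kappa%:C.
Hypothesis e1 : expsol kappa phi1 phi1'.
Hypothesis e2 : expsol kappa phi2 phi2'.
Hypothesis hw : forall x, 0 < x -> wr (uof phi1) (vof phi1 phi1') (uof phi2) (vof phi2 phi2') x = w.
Hypothesis w0 : w != 0.
Hypothesis L1 : L2zero (uof phi1).
Hypothesis L2' : L2zero (uof phi2).
Hypothesis xiP : cutoff xi.

Lemma bvc_dil_uof tau phi phi' (a b : R) p : expsol kappa phi phi' -> L2zero (uof phi) ->
  (forall t, phi t = a * phi1 (tau + t) + b * phi2 (tau + t)) -> Lmax m p ->
  bvc xi (uof phi) (vof phi phi') (dil tau p) =
  (expR tau)%:C * (a%:C * bvc xi (uof phi1) (vof phi1 phi1') p +
                   b%:C * bvc xi (uof phi2) (vof phi2 phi2') p).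
Proof.
move=> e L E M.
rewrite (bvc_dil m2 (uof_hsol e1) (uof_hsol e2) hw w0 L1 L2' xiP (uof_hsol e) L (uof_dil E) M).
have ee : expR (tau / 2) * expR (- (tau / 2)) = 1 by rewrite -expRD subrr expR0.
have ee' : (expR (tau / 2))%:C * (expR (- (tau / 2)))%:C = 1 :> C by rewrite -rmorphM/= ee.
rewrite !rmorphM/=; move: ee'; move: (_%:C) (_%:C) => c d cd.
rewrite -[X in _ = X * _]mul1r -[X in _ = X * _ * _]cd; ring.
Qed.

End Dilations.

Variable xi : R -> C.
Hypothesis xiP : cutoff xi.

(** Dilations multiply the two boundary values by different powers of e^tau. *)
Lemma real_case (n : R) (m : C) : 0 < n < 1 -> m = n%:C ->
  deficiency_indices (Lmin m) 1 1 /\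
  (parametrizes_extensions m (u_real m) /\
     (forall H, strict_extension m H /\ homogeneous H <->
                H = Hop xi m \/ H = Hop xi (- m)) /\
     Hop xi m <> Hop xi (- m) /\
     selfadjoint (Hop xi m) /\ selfadjoint (Hop xi (- m)) /\
     Hop xi m = Lbc m (u_real m (pi / 2)) /\
     Hop xi (- m) = Lbc m (u_real m 0)).
Proof.
move=> /andP[n0 n1] mE.
have m2 : m ^+ 2 = (n ^+ 2)%:C by rewrite mE rmorphXn.
have e1 := exp_expsol (- n); rewrite sqrrN in e1.
have e2 := exp_expsol n.
have hw x : 0 < x -> wr (uof (fun t => expR (- n * t))) (vof (fun t => expR (- n * t)) (fun t => - n * expR (- n * t)))
    (uof (fun t => expR (n * t))) (vof (fun t => expR (n * t)) (fun t => n * expR (n * t))) x = 2 * n.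
  move=> x0; rewrite wr_uof//.
  have : expR (- n * ln x) * expR (n * ln x) = 1 by rewrite -expRD mulNr addNr expR0.
  move: (expR (- n * _)) (expR (n * _)) => a b ab.
  have -> : a * (n * b) - - n * a * b = 2 * n * (a * b) by ring.
  by rewrite ab mulr1.
have w0 : 2 * n != 0 by rewrite mulf_neq0// gt_eqF.
have L1 : L2zero (uof (fun t => expR (- n * t))) by apply: exp_L2zero; lra.
have L2' : L2zero (uof (fun t => expR (n * t))) by apply: exp_L2zero; lra.
have h1 := uof_hsol e1; have h2 := uof_hsol e2.
have mm : (- m) ^+ 2 = m ^+ 2 by rewrite sqrrN.
have uE (t x : R) : u_real m t x = (cos t * uof (fun t => expR (- n * t)) x + sin t * uof (fun t => expR (n * t)) x)%:C.
  rewrite /u_real -[cpow x (2^-1 - m)]/(zeta (- m) x) -[cpow x (2^-1 + m)]/(zeta m x).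
  rewrite mE -rmorphN/= !zeta_real -!rmorphM/= -rmorphD/=; congr (_%:C); ring.
have [P LE] := parametrization m2 h1 h2 hw w0 L1 L2' xiP (fun t x _ => uE t x).
have ZE x : zeta m x = (0 : R)%:C * (uof (fun t => expR (- n * t)) x)%:C + (1 : R)%:C * (uof (fun t => expR (n * t)) x)%:C.
  by rewrite mE zeta_real rmorph0 rmorph1 mul0r mul1r add0r.
have ZE' x : zeta (- m) x = (1 : R)%:C * (uof (fun t => expR (- n * t)) x)%:C + (0 : R)%:C * (uof (fun t => expR (n * t)) x)%:C.
  by rewrite mE -rmorphN/= zeta_real rmorph0 rmorph1 mul0r mul1r addr0.
have n01 : ((0 : R)%:C != 0 :> C) || ((1 : R)%:C != 0 :> C) by rewrite oner_neq0 orbT.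
have n10 : ((1 : R)%:C != 0 :> C) || ((0 : R)%:C != 0 :> C) by rewrite oner_neq0.
have HP := Hop_bspace m2 h1 h2 hw w0 L1 L2' xiP (erefl _) n01 (fun x _ => ZE x).
have HM := Hop_bspace m2 h1 h2 hw w0 L1 L2' xiP mm n10 (fun x _ => ZE' x).
have R2 tau t : expR (n * t) = 0 * expR (- n * (tau + t)) + expR (- (n * tau)) * expR (n * (tau + t)).
  by rewrite mul0r add0r -expRD; congr expR; ring.
have R1 tau t : expR (- n * t) = expR (n * tau) * expR (- n * (tau + t)) + 0 * expR (n * (tau + t)).
  by rewrite mul0r addr0 -expRD; congr expR; ring.
have sc2 tau p (M : Lmax m p) := bvc_dil_uof m2 e1 e2 hw w0 L1 L2' xiP e2 L2' (R2 tau) M.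
have sc1 tau p (M : Lmax m p) := bvc_dil_uof m2 e1 e2 hw w0 L1 L2' xiP e1 L1 (R1 tau) M.
have two := @two_homogeneous _ _ _ _ _ _ _ _ _ m2 h1 h2 hw w0 L1 L2' xiP
  (0 : R)%:C (1 : R)%:C (1 : R)%:C (0 : R)%:C
  (fun tau => (expR tau * expR (- (n * tau)))%:C) (fun tau => (expR tau * expR (n * tau))%:C) 1.
have sa01 := bspace_selfadjoint m2 h1 h2 hw w0 L1 L2' xiP (a := 0) (b := 1).
have sa10 := bspace_selfadjoint m2 h1 h2 hw w0 L1 L2' xiP (a := 1) (b := 0).
split; first exact: (deficiency11 m2 h1 h2 hw w0 L1 L2' xiP).
split; first exact: P.
split.
  rewrite HP HM; apply: two; [| | |exact: n01|exact: n10].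
  - move=> tau p M; rewrite (sc2 _ _ M); move: (bvc _ _ _ _) (bvc _ _ _ _) (bvc _ _ _ _) => A A' B.
    by rewrite rmorphM/= rmorph0 rmorph1; move: (_%:C) (_%:C) => c d; ring.
  - move=> tau p M; rewrite (sc1 _ _ M); move: (bvc _ _ _ _) (bvc _ _ _ _) (bvc _ _ _ _) => A A' B.
    by rewrite rmorphM/= rmorph0 rmorph1; move: (_%:C) (_%:C) => c d; ring.
  - rewrite -subr_eq0 -rmorphB/= fmorph_eq0 subr_eq0 -!expRD; apply/eqP => /expR_inj; lra.
split.
  rewrite HP HM => /(bspace_det m2 h1 h2 hw w0 L1 L2' xiP)/eqP.
  by rewrite rmorph0 rmorph1 mul0r mulr1 eq_sym oner_eq0.
split; first by rewrite HP; apply: sa01; rewrite oner_neq0 orbT.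
split; first by rewrite HM; apply: sa10; rewrite oner_neq0.
by rewrite !LE cos_pihalf sin_pihalf cos0 sin0.
Qed.

(** The translation by tau sends t to t + tau and fixes 1: a Jordan block, with
    a single invariant line. *)
Lemma zero_case (m : C) : m = 0 ->
  deficiency_indices (Lmin m) 1 1 /\
  (parametrizes_extensions m (@u_zero R) /\
     (forall H, strict_extension m H /\ homogeneous H <-> H = Hop xi m) /\
     selfadjoint (Hop xi m) /\
     Hop xi m = Lbc m (u_zero (pi / 2))).
Proof.
move=> mE; have m2 : m ^+ 2 = (0 : R)%:C by rewrite mE expr0n.
have e1 := @id_expsol R; have e2 := @cst_expsol R.
have h1 := uof_hsol e1; have h2 := uof_hsol e2.
have hw x : 0 < x -> wr (uof (fun t : R => t)) (vof (fun t : R => t) (fun=> 1))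
    (uof (fun=> 1)) (vof (fun=> 1) (fun=> 0)) x = - 1.
  by move=> x0; rewrite wr_uof// mulr0 mul1r sub0r.
have w0 : - 1 != 0 :> R by rewrite oppr_eq0 oner_neq0.
have L1 := @id_L2zero R; have L2' := @cst_L2zero R.
have uE (t x : R) : 0 < x -> u_zero t x = (cos t * uof (fun t => t) x + sin t * uof (fun=> 1) x)%:C.
  by move=> x0; rewrite /u_zero !powR_half// /uof; congr (_%:C); ring.
have [P LE] := parametrization m2 h1 h2 hw w0 L1 L2' xiP uE.
have ZE x : zeta m x = (0 : R)%:C * (uof (fun t => t) x)%:C + (1 : R)%:C * (uof (fun=> 1) x)%:C.
  rewrite mE -(rmorph0 (real_complex R)) zeta_real rmorph1 mul1r rmorph0 mul0r add0r.
  by rewrite /uof mul0r expR0.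
have n01 : ((0 : R)%:C != 0 :> C) || ((1 : R)%:C != 0 :> C) by rewrite oner_neq0 orbT.
have HP := Hop_bspace m2 h1 h2 hw w0 L1 L2' xiP (erefl _) n01 (fun x _ => ZE x).
have sa01 := bspace_selfadjoint m2 h1 h2 hw w0 L1 L2' xiP (a := 0) (b := 1).
have R2 (tau t : R) : 1 = 0 * (tau + t) + 1 * 1 :> R by rewrite mul0r add0r mulr1.
have R1 (tau t : R) : t = 1 * (tau + t) + (- tau) * 1 by ring.
have sc2 tau p (M : Lmax m p) := bvc_dil_uof m2 e1 e2 hw w0 L1 L2' xiP e2 L2' (R2 tau) M.
have sc1 tau p (M : Lmax m p) := bvc_dil_uof m2 e1 e2 hw w0 L1 L2' xiP e1 L1 (R1 tau) M.
have sc tau p : Lmax m p -> (0 : R)%:C * bvc xi (uof (fun t => t)) (vof (fun t => t) (fun=> 1)) (dil tau p) +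
    (1 : R)%:C * bvc xi (uof (fun=> 1)) (vof (fun=> 1) (fun=> 0)) (dil tau p) =
    (expR tau)%:C * ((0 : R)%:C * bvc xi (uof (fun t => t)) (vof (fun t => t) (fun=> 1)) p +
    (1 : R)%:C * bvc xi (uof (fun=> 1)) (vof (fun=> 1) (fun=> 0)) p).
  move=> M; rewrite (sc2 _ _ M); move: (bvc _ _ _ _) (bvc _ _ _ _) (bvc _ _ _ _) => A A' B.
  by rewrite rmorph0 rmorph1; move: (_%:C) => c; ring.
split; first exact: (deficiency11 m2 h1 h2 hw w0 L1 L2' xiP).
split; first exact: P.
split.
  move=> H; rewrite HP; split=> [[st hom]|->]; last first.
    split; first exact: (bspace_strict m2 h1 h2 hw w0 L1 L2' xiP n01).
    exact: (bspace_homogeneous m2 sc).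
  have [//|[p [Mp Hp np Bp ev]]] := homogeneous_cases m2 h1 h2 hw w0 L1 L2' xiP sc n01 st hom.
  have [E _] := ev 1; move: E; rewrite (sc1 _ _ Mp).
  have k0 : (expR 1)%:C != 0 :> C by rewrite fmorph_eq0 gt_eqF// expR_gt0.
  move=> /(mulfI k0)/eqP; rewrite rmorph1 mul1r rmorphN/= rmorph1 mulN1r.
  rewrite -subr_eq0 addrAC subrr add0r oppr_eq0 => /eqP A2.
  by move: Bp; rewrite A2 rmorph0 mul0r mulr0 addr0 eqxx.
split; first by rewrite HP; apply: sa01; rewrite oner_neq0 orbT.
by rewrite LE cos_pihalf sin_pihalf.
Qed.

(** The rotation by the angle mu tau has the eigenfunctionals A1 + i A2 and A1
    - i A2, with factors e^(-i mu tau) and e^(i mu tau) that differ when mu tau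
    = pi / 2.  Neither of them is proportional to a real functional. *)
Lemma imag_case (mu : R) (m : C) : 0 < mu -> m = 0 +i* mu ->
  deficiency_indices (Lmin m) 1 1 /\
  (parametrizes_extensions m (u_imag mu) /\
     ~ (exists2 H, selfadjoint_extension m H & homogeneous H) /\
     (forall H, strict_extension m H /\ homogeneous H <->
                H = Hop xi m \/ H = Hop xi (- m)) /\
     Hop xi m <> Hop xi (- m)).
Proof.
move=> mu0 mE; have m2 : m ^+ 2 = (- mu ^+ 2)%:C.
  by rewrite mE expr2; simpc; rewrite expr2.
have e1 := cos_expsol mu; have e2 := sin_expsol mu.
have h1 := uof_hsol e1; have h2 := uof_hsol e2.
have hw x : 0 < x -> wr (uof (fun t => cos (mu * t))) (vof (fun t => cos (mu * t)) (fun t => - (mu * sin (mu * t))))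
    (uof (fun t => sin (mu * t))) (vof (fun t => sin (mu * t)) (fun t => mu * cos (mu * t))) x = mu.
  move=> x0; rewrite wr_uof//.
  by rewrite -[RHS]mulr1 -(cos2Dsin2 (mu * ln x)); ring.
have w0 : mu != 0 by rewrite gt_eqF.
have L1 := cos_L2zero mu; have L2' := sin_L2zero mu.
have mm : (- m) ^+ 2 = m ^+ 2 by rewrite sqrrN.
have uE (t x : R) : 0 < x -> u_imag mu t x = (cos t * uof (fun t => cos (mu * t)) x + sin t * uof (fun t => sin (mu * t)) x)%:C.
  by move=> x0; rewrite /u_imag !powR_half// /uof; congr (_%:C); ring.
have [P LE] := parametrization m2 h1 h2 hw w0 L1 L2' xiP uE.
have ZE x : zeta m x = 1 * (uof (fun t => cos (mu * t)) x)%:C + (0 +i* 1) * (uof (fun t => sin (mu * t)) x)%:C.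
  by rewrite mE /zeta cpowE mul0r expR0 mulr1 mul1r /uof; simpc.
have ZE' x : zeta (- m) x = 1 * (uof (fun t => cos (mu * t)) x)%:C + (0 +i* -1) * (uof (fun t => sin (mu * t)) x)%:C.
  rewrite /zeta (_ : - m = 0 +i* - mu); last by rewrite mE; simpc.
  by rewrite cpowE mul0r expR0 mulr1 mul1r /uof mulNr cosN sinN; simpc; rewrite ?mulN1r ?mulrN.
have n1 (z : C) : (1 != 0 :> C) || (z != 0) by rewrite oner_neq0.
have HP := Hop_bspace m2 h1 h2 hw w0 L1 L2' xiP (erefl _) (n1 _) (fun x _ => ZE x).
have HM := Hop_bspace m2 h1 h2 hw w0 L1 L2' xiP mm (n1 _) (fun x _ => ZE' x).
have rot tau t : mu * t = mu * (tau + t) - mu * tau by ring.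
have R2 tau t : sin (mu * t) = - sin (mu * tau) * cos (mu * (tau + t)) + cos (mu * tau) * sin (mu * (tau + t)).
  by rewrite (rot tau t) sinB; ring.
have R1 tau t : cos (mu * t) = cos (mu * tau) * cos (mu * (tau + t)) + sin (mu * tau) * sin (mu * (tau + t)).
  by rewrite (rot tau t) cosB; ring.
have sc2 tau p (M : Lmax m p) := bvc_dil_uof m2 e1 e2 hw w0 L1 L2' xiP e2 L2' (R2 tau) M.
have sc1 tau p (M : Lmax m p) := bvc_dil_uof m2 e1 e2 hw w0 L1 L2' xiP e1 L1 (R1 tau) M.
have ii : (0 +i* 1) * (0 +i* 1) = - 1 :> C by simpc.
have iN : (0 +i* -1) = - (0 +i* 1) :> C by simpc.
have two := @two_homogeneous _ _ _ _ _ _ _ _ _ m2 h1 h2 hw w0 L1 L2' xiP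
  1 (0 +i* 1) 1 (0 +i* -1)
  (fun tau => (expR tau)%:C * ((cos (mu * tau))%:C - (0 +i* 1) * (sin (mu * tau))%:C))
  (fun tau => (expR tau)%:C * ((cos (mu * tau))%:C + (0 +i* 1) * (sin (mu * tau))%:C))
  (pi / 2 / mu).
have det := bspace_det m2 h1 h2 hw w0 L1 L2' xiP.
have i0 : (0 +i* 1) != 0 :> C by rewrite eq_complex /= oner_eq0 andbF.
have Two : forall H, strict_extension m H /\ homogeneous H <-> H = Hop xi m \/ H = Hop xi (- m).
  rewrite HP HM; apply: two; [| | |exact: n1|exact: n1].
  - move=> tau p M; rewrite (sc1 _ _ M) (sc2 _ _ M).
    rewrite rmorphN/=; move: (bvc _ _ _ _) (bvc _ _ _ _) (expR _)%:C (cos _)%:C (sin _)%:C (0 +i* 1) ii.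
    move=> B A e c s i ii; apply/eqP; rewrite -subr_eq0.
    rewrite (_ : _ - _ = e * s * B * (1 + i * i)); last by ring.
    by rewrite ii subrr mulr0.
  - move=> tau p M; rewrite (sc1 _ _ M) (sc2 _ _ M).
    rewrite rmorphN/= iN; move: (bvc _ _ _ _) (bvc _ _ _ _) (expR _)%:C (cos _)%:C (sin _)%:C (0 +i* 1) ii.
    move=> B A e c s i ii; apply/eqP; rewrite -subr_eq0.
    rewrite (_ : _ - _ = e * s * B * (1 + i * i)); last by ring.
    by rewrite ii subrr mulr0.
  - have -> : mu * (pi / 2 / mu) = pi / 2 by rewrite mulrC divfK.
    rewrite cos_pihalf sin_pihalf rmorph0 rmorph1 mulr1 sub0r add0r.
    rewrite -subr_eq0 -mulrBr mulf_neq0//; first by rewrite fmorph_eq0 gt_eqF// expR_gt0.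
    by rewrite -opprD oppr_eq0 -mulr2n mulrn_eq0.
split; first exact: (deficiency11 m2 h1 h2 hw w0 L1 L2' xiP).
split; first exact: P.
split; last first.
  split; first exact: Two.
  rewrite HP HM => /det; rewrite !mul1r iN => /eqP.
  by rewrite eq_sym -addr_eq0 -mulr2n mulrn_eq0 (negbTE i0).
move=> [H saH hom].
have [t tpi HE] := selfadjoint_bspace m2 h1 h2 hw w0 L1 L2' xiP saH.
have ct : ~ (cos t = 0 /\ sin t = 0).
  by move=> [c0 s0]; have := cos2Dsin2 t; rewrite c0 s0 expr0n addr0 => /eqP; rewrite eq_sym oner_eq0.
have n0 : ((cos t)%:C != 0 :> C) || ((sin t)%:C != 0 :> C).
  by rewrite !fmorph_eq0 -negb_and; apply/negP => /andP[/eqP c0 /eqP s0]; apply: ct.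
have st : strict_extension m H.
  by rewrite HE; exact: (bspace_strict m2 h1 h2 hw w0 L1 L2' xiP n0).
have line (e : R) : e != 0 -> (cos t)%:C * (0 +i* e) = 1 * (sin t)%:C -> False.
  move=> e0 E; apply: ct; have := congr1 (@complex.Re R) E; have := congr1 (@complex.Im R) E.
  rewrite mul1r cReM cImM /= !mul0r mulr0 subr0 addr0 => /eqP.
  by rewrite mulf_eq0 (negbTE e0) orbF => /eqP -> <-.
have [] := (Two H).1 (conj st hom); rewrite ?HP ?HM HE => /det; apply: line; first exact: oner_neq0.
by rewrite oppr_eq0 oner_neq0.
Qed.

(** The minimal and the maximal operator coincide; the latter is the adjoint of
    the former and is invariant under dilations. *)
Lemma limit_point_case (n : R) (m : C) : 1 <= n -> m = n%:C ->
  [/\ Hop xi m = Lmin m, selfadjoint (Hop xi m) & homogeneous (Hop xi m)].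
Proof.
move=> n1 mE; have m2 : m ^+ 2 = (n ^+ 2)%:C by rewrite mE rmorphXn.
have hs := (cutoff_step xiP).1.
have ME : Lmax m = Lmin m.
  apply/seteqP; split=> p; last exact: (Lmin_max m2).
  case: p => f g /(LmaxP m2)[a b]; apply/(LminP m2).
  by split; exact: pow_limit_point n1 hs _.
have HE : Hop xi m = Lmin m.
  apply/seteqP; split=> p; first by move=> [Mp _]; rewrite -ME.
  move=> mp; split; first by rewrite ME.
  exists p.1, 0; split; first by exists p.
  by apply: aeW => x _; rewrite mul0r addr0.
rewrite HE; split=> //.
  have [op ds _] := symmetric_Lmin m2 hs; split=> //.
  by rewrite (adjoint_Lmin m2).
by rewrite -ME; apply/homogeneousP => tau p; exact: (Lmax_dil m2).
Qed.

End Cases.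

Theorem proposition4p17 (R : realType) (xi : R -> R[i]) (m : R[i])
  (xiP : cutoff xi)
  (m2_real : m ^+ 2 \is Num.real)
  (m_real : m \is Num.real -> 0 <= m)
  (m_imag : m \isn't Num.real -> exists2 mu : R, 0 < mu & m = 0 +i* mu) :
  (1 <= m ^+ 2 ->
     [/\ Hop xi m = Lmin m, selfadjoint (Hop xi m) & homogeneous (Hop xi m)])
  /\
  (m ^+ 2 < 1 -> deficiency_indices (Lmin m) 1 1)
  /\
  (0 < m < 1 ->
     parametrizes_extensions m (u_real m) /\
     (forall H, strict_extension m H /\ homogeneous H <->
                H = Hop xi m \/ H = Hop xi (- m)) /\
     Hop xi m <> Hop xi (- m) /\
     selfadjoint (Hop xi m) /\ selfadjoint (Hop xi (- m)) /\
     Hop xi m = Lbc m (u_real m (pi / 2)) /\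
     Hop xi (- m) = Lbc m (u_real m 0))
  /\
  (m = 0 ->
     parametrizes_extensions m (@u_zero R) /\
     (forall H, strict_extension m H /\ homogeneous H <-> H = Hop xi m) /\
     selfadjoint (Hop xi m) /\
     Hop xi m = Lbc m (u_zero (pi / 2)))
  /\
  (m ^+ 2 < 0 -> forall mu : R, 0 < mu -> m = 0 +i* mu ->
     parametrizes_extensions m (u_imag mu) /\
     ~ (exists2 H, selfadjoint_extension m H & homogeneous H) /\
     (forall H, strict_extension m H /\ homogeneous H <->
                H = Hop xi m \/ H = Hop xi (- m)) /\
     Hop xi m <> Hop xi (- m)).
Proof.
have imag_sq (mu : R) : (0 +i* mu) ^+ 2 = (- mu ^+ 2)%:C :> R[i].
  by rewrite expr2; simpc; rewrite expr2.
have realE : m \is Num.real -> exists2 n : R, 0 <= n & m = n%:C.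
  move=> mr; exists (complex.Re m); last by rewrite RRe_real.
  by have := m_real mr; rewrite -{1}(RRe_real mr) ler0c.
have cases : (exists2 n : R, 0 <= n & m = n%:C) \/ (exists2 mu : R, 0 < mu & m = 0 +i* mu).
  by have [/realE|/m_imag] := boolP (m \is Num.real); [left|right].
split; [|split; [|split; [|split]]].
- case: cases => [[n n0 mE]|[mu mu0 ->]].
    rewrite {1}mE -rmorphXn/= lecE /= eqxx/= => n1; apply: (limit_point_case xiP _ mE).
    by rewrite -(@ler_pXn2r _ 2) ?nnegrE// expr1n.
  rewrite imag_sq lecE /= eqxx/= => h; have := sqr_ge0 mu; lra.
- case: cases => [[n n0 mE]|[mu mu0 mE] _]; last by have [] := imag_case xiP mu0 mE.
  rewrite {1}mE -rmorphXn/= ltcE /= eqxx/= => n1.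
  have {}n1 : n < 1 by rewrite -(@ltr_pXn2r _ 2) ?nnegrE// expr1n.
  have [nE|nz] := eqVneq n 0; first by have [] := zero_case xiP (m := m); rewrite ?mE ?nE.
  have n01 : 0 < n < 1 by rewrite lt_def nz n0 n1.
  by have [] := real_case xiP n01 mE.
- case: cases => [[n n0 mE]|[mu mu0 ->]]; last by rewrite !ltcE /= [0 == mu]eq_sym gt_eqF.
  rewrite {1 2}mE !ltcE /= !eqxx /= => n01; by have [] := real_case xiP n01 mE.
- by move=> mE; have [] := zero_case xiP mE.
- by move=> _ mu mu0 mE; have [] := imag_case xiP mu0 mE.
Qed.
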